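(* Let $r\ge 2$, and consider the Segre-Veronese variety $SV^{\boldsymbol{n}}_{\boldsymbol{d}}\subset\mathbb{P}^{N}$ with $\boldsymbol{n}=(1,n_2,\dots,n_r)$ and $\boldsymbol{d}=(1,d_2,\dots,d_r)$, where the $n_i,d_i$ are positive integers and $n_2\le n_3\le\dots\le n_r$. Let $d:=\min\{d_2,\dots,d_r\}-1$. If $h$ is a positive integer with $$h<h_{n_2+1}(d),$$ then $SV^{\boldsymbol{n}}_{\boldsymbol{d}}$ is not $h$-tangentially weakly defective, and hence $SV^{\boldsymbol{n}}_{\boldsymbol{d}}$ is $h$-identifiable. In particular, under this bound $SV^{\boldsymbol{n}}_{\boldsymbol{d}}$ is not $h$-defective.
   Context: We work over the complex numbers. **Segre-Veronese variety.** For $r$-tuples of positive integers $\boldsymbol{n}=(n_1,\dots,n_r)$, $\boldsymbol{d}=(d_1,\dots,d_r)$, $SV^{\boldsymbol{n}}_{\boldsymbol{d}}\subset\mathbb{P}^{N}$, with $N=\prod_{i=1}^r\binom{n_i+d_i}{d_i}-1$, is the product $\mathbb{P}^{n_1}\times\dots\times\mathbb{P}^{n_r}$ embedded by the complete linear system $|\mathcal{O}(d_1,\dots,d_r)|$. **The function $h_m$.** For an integer $m\ge 0$, $h_m:\mathbb{Z}_{\ge0}\to\mathbb{Z}_{\ge0}$ is defined by $h_m(0)=0$ and, for $k>0$, writing $k+1=2^{\lambda_1}+2^{\lambda_2}+\dots+2^{\lambda_a}+\varepsilon$ with $\lambda_1>\lambda_2>\dots>\lambda_a\ge1$ and $\varepsilon\in\{0,1\}$,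 by $h_m(k)=m^{\lambda_1-1}+m^{\lambda_2-1}+\dots+m^{\lambda_a-1}$. Let $X\subset\mathbb{P}^N$ be an irreducible non-degenerate projective variety. **Secant defectiveness.** The $h$-secant variety $\mathrm{Sec}_h(X)\subset\mathbb{P}^N$ is the Zariski closure of the union of all linear spaces spanned by $h$ points of $X$. $X$ is $h$-defective if $\dim \mathrm{Sec}_h(X)<\min\{h\dim X+h-1,N\}$. **Identifiability.** A point $p\in\mathbb{P}^N$ has rank $h$ with respect to $X$ if it lies in the span of $h$ distinct points of $X$ but not in the span of $k$ distinct points of $X$ for any $k<h$. Let $\mathcal{S}_h(X)\subset\mathbb{G}(h-1,N)$ be the closure of the set of $(h-1)$-planes spanned by $h$ general points of $X$, and let $\pi_h$ be the projection to $\mathbb{P}^N$ of the abstract secant variety $\{(x,\Lambda): x\in\Lambda\in\mathcal{S}_h(X)\}$. The point $p$ is $h$-identifiable if it has rank $h$ and $\pi_h^{-1}(p)$ is a single point. $X$ is $h$-identifiable if the general point of $\mathrm{Sec}_h(X)$ is $h$-identifiable. **Tangential weak defectiveness.** Let $x_1,\dots,x_h\in X$ be general points. The $h$-tangential contact locus $\Gamma_{x_1,\dots,x_h}$ is the closure in $X$ of the union of those irreducible components, of the locus of points of $X$ where $\langle T_{x_1}X,\dots,T_{x_h}X\rangle$ is tangent to $X$, which contain at least one of the $x_i$. $X$ is $h$-tangentially weakly defective if some component of $\Gamma_{x_1,\dots,x_h}$ has positive dimension. *)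

(* Defs.v *)
From HB Require Import structures.
From mathcomp Require Import all_boot all_order all_algebra.
From mathcomp Require Import mathcomp_extra boolp classical_sets reals.
From mathcomp Require Import complex mpoly.

Set Implicit Arguments.
Unset Strict Implicit.
Unset Printing Implicit Defensive.

Import Order.TTheory GRing.Theory Num.Theory.
Local Open Scope classical_set_scope.
Local Open Scope ring_scope.

(* A point of P^(m-1) is given by its homogeneous coordinate vectors, and a   *)
(* subset of P^(m-1) by the set of the coordinate vectors of its points: a    *)
(* set of nonzero vectors that is stable under multiplication by nonzero      *)
(* scalars. A linear subspace of P^(m-1) is given by any matrix whose row     *)
(* space is the corresponding subspace of C^m, and a k-tuple of points by a   *)
(* k x m matrix whose rows are their coordinate vectors. The field is the     *)
(* complex field R[i] throughout.                                             *)

Section ProjectiveSets.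
Variables (R : realType) (m : nat).
Implicit Types (A B X Z : set 'rV[R[i]]_m) (v : 'rV[R[i]]_m).

Definition projective_set A : Prop :=
  forall v, A v -> v != 0 /\ forall c : R[i], c != 0 -> A (c *: v).

Definition zariski_closure A : set 'rV[R[i]]_m :=
  [set v : 'rV[R[i]]_m | v != 0 /\
    forall (e : nat) (F : {mpoly R[i][m]}), F \is e.-homog ->
      (forall a, A a -> F.@[a 0] = 0) -> F.@[v 0] = 0].

Definition zariski_closed Z : Prop := zariski_closure Z = Z.

Definition closed_in A Z : Prop := Z = A `&` zariski_closure Z.

Definition irreducible A : Prop :=
  [/\ projective_set A, A !=set0 &
      forall Z1 Z2, zariski_closed Z1 -> zariski_closed Z2 ->
        A `<=` Z1 `|` Z2 -> A `<=` Z1 \/ A `<=` Z2].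

Definition irreducible_component A B : Prop :=
  [/\ irreducible B, B `<=` A &
      forall B', irreducible B' -> B `<=` B' -> B' `<=` A -> B' = B].

Definition irreducible_chain A (k : nat) : Prop :=
  exists Z : nat -> set 'rV[R[i]]_m,
    (forall j, (j <= k)%N -> irreducible (Z j) /\ closed_in A (Z j)) /\
    (forall j, (j < k)%N -> Z j `<` Z j.+1).

(* Krull dimension; chains in P^(m-1) have bounded length, so the default     *)
(* value 0 is only used when A contains no chain at all, e.g. for A empty.    *)
Definition dim A : nat :=
  xget 0%N [set k | irreducible_chain A k /\
                    forall l, irreducible_chain A l -> (l <= k)%N].

Definition tuple_of_points X (k : nat) (x : 'M[R[i]]_(k, m)) : Prop :=
  forall j, X (row j x).

Definition distinct_points (k : nat) (x : 'M[R[i]]_(k, m)) : Prop :=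
  forall j l, j != l -> ~~ (row j x <= row l x)%MS.

(* P holds on a nonempty Zariski open subset of X^k. The nonvanishing loci of *)
(* multihomogeneous polynomials are a basis of the topology of (P^(m-1))^k;   *)
(* as the P used below only depend on the points represented by the rows,     *)
(* allowing an arbitrary F is the same as asking for a multihomogeneous one   *)
(* (take a multihomogeneous component of F that is not zero on X^k).          *)
Definition for_general X (k : nat) (P : 'M[R[i]]_(k, m) -> Prop) : Prop :=
  exists F : {mpoly R[i][k * m]},
    (exists2 x, tuple_of_points X x & F.@[mxvec x 0] != 0) /\
    (forall x, tuple_of_points X x -> F.@[mxvec x 0] != 0 -> P x).

Definition secant_variety X (h : nat) : set 'rV[R[i]]_m :=
  zariski_closure
    [set v : 'rV[R[i]]_m | v != 0 /\
       exists2 x : 'M[R[i]]_(h, m), tuple_of_points X x & (v <= x)%MS].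

Definition defective X (h : nat) : Prop :=
  (dim (secant_variety X h) < minn (h * dim X + h - 1) (m - 1))%N.

Definition in_span_of_points X (k : nat) v : Prop :=
  exists x : 'M[R[i]]_(k, m),
    [/\ tuple_of_points X x, distinct_points x & (v <= x)%MS].

Definition has_rank X (h : nat) v : Prop :=
  in_span_of_points X h v /\
  forall k, (k < h)%N -> ~ in_span_of_points X k v.

(* The closure of the set of (h-1)-planes spanned by h general points, i.e.   *)
(* the smallest closed subset of G(h-1, m-1) containing them. The             *)
(* Grassmannian is the quotient of the space of h x m matrices of rank h by   *)
(* GL_h, with the quotient topology: its closed subsets correspond to the     *)
(* GL_h-stable sets of such matrices defined by polynomials in the entries.   *)
Definition secant_planes X (h : nat) : set 'M[R[i]]_(h, m) :=
  [set L : 'M[R[i]]_(h, m) | row_free L /\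
    forall F : {mpoly R[i][h * m]},
      for_general X (fun x : 'M[R[i]]_(h, m) =>
        forall L' : 'M[R[i]]_(h, m),
          row_free L' -> (L' == x)%MS -> F.@[mxvec L' 0] = 0) ->
      F.@[mxvec L 0] = 0].

(* The fibre of the abstract secant variety over v is the set of the planes   *)
(* of secant_planes X h through v.                                            *)
Definition identifiable_point X (h : nat) v : Prop :=
  has_rank X h v /\
  exists L : 'M[R[i]]_(h, m),
    [/\ secant_planes X L, (v <= L)%MS &
        forall L' : 'M[R[i]]_(h, m),
          secant_planes X L' -> (v <= L')%MS -> (L' == L)%MS].

Definition identifiable X (h : nat) : Prop :=
  for_general (secant_variety X h)
    (fun v : 'M[R[i]]_(1, m) => identifiable_point X h v).

(* The subspace of C^m corresponding to the embedded tangent space at x.      *)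
Definition tangent_space X (x : 'rV[R[i]]_m) : set 'rV[R[i]]_m :=
  [set v : 'rV[R[i]]_m |
    forall (e : nat) (F : {mpoly R[i][m]}), F \is e.-homog ->
      (forall a, X a -> F.@[a 0] = 0) ->
      \sum_(j < m) (F^`M(j)).@[x 0] * v 0 j = 0].

Definition span_tangent_spaces X (h : nat) (x : 'M[R[i]]_(h, m)) :
    set 'rV[R[i]]_m :=
  [set v : 'rV[R[i]]_m | exists2 u : 'M[R[i]]_(h, m),
      forall j, tangent_space X (row j x) (row j u) & v = \sum_j row j u].

(* The points of X where <T_{x_1} X, ..., T_{x_h} X> is tangent to X.         *)
Definition tangency_locus X (h : nat) (x : 'M[R[i]]_(h, m)) :
    set 'rV[R[i]]_m :=
  [set y : 'rV[R[i]]_m | X y /\ tangent_space X y `<=` span_tangent_spaces X x].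

Definition contact_locus X (h : nat) (x : 'M[R[i]]_(h, m)) :
    set 'rV[R[i]]_m :=
  X `&` zariski_closure
    [set v : 'rV[R[i]]_m | exists B,
       [/\ irreducible_component (tangency_locus X x) B,
           exists j, B (row j x) & B v]].

Definition tangentially_weakly_defective X (h : nat) : Prop :=
  for_general X (fun x : 'M[R[i]]_(h, m) =>
    exists2 B, irreducible_component (contact_locus X x) B & (0 < dim B)%N).

End ProjectiveSets.

(* Exponents of the monomials of degree d in n + 1 variables.                 *)
Definition monomial (n d : nat) :=
  {t : n.+1.-tuple 'I_d.+1 | \sum_(a <- t) (a : nat) == d}%N.

(* Exponents of the monomials of multidegree d in r groups of variables.      *)
Definition multimonomial (r : nat) (n d : 'I_r -> nat) :=
  {dffun forall i : 'I_r, monomial (n i) (d i)}.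

Lemma card_monomial (n d : nat) : #|{: monomial n d}| = 'C(n + d, d).
Proof.
rewrite card_sig -bin_sub ?leq_addl // addnK -card_ord_partitions cardsE.
by apply: eq_card => t; rewrite !inE.
Qed.

Lemma card_multimonomial (r : nat) (n d : 'I_r -> nat) :
  #|{: multimonomial n d}| = (\prod_(i < r) 'C(n i + d i, d i))%N.
Proof.
rewrite card_dep_ffun foldrE big_map big_enum /=.
by apply: eq_bigr => i _; exact: card_monomial.
Qed.

Definition segre_veronese_map (R : realType) (r : nat) (n d : 'I_r -> nat)
    (p : forall i : 'I_r, 'rV[R[i]]_(n i).+1) :
    'rV[R[i]]_#|{: multimonomial n d}| :=
  \row_k \prod_(i < r) \prod_(j < (n i).+1)
    p i 0 j ^+ tnth (val ((enum_val k : multimonomial n d) i)) j.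

Definition segre_veronese (R : realType) (r : nat) (n d : 'I_r -> nat) :
    set 'rV[R[i]]_#|{: multimonomial n d}| :=
  [set v | exists p : forall i : 'I_r, 'rV[R[i]]_(n i).+1,
      (forall i, p i != 0) /\
      exists2 c : R[i], c != 0 & v = c *: segre_veronese_map d p].
Arguments segre_veronese R {r} n d _.

(* The sum of the m ^ (lambda_i - 1), where k + 1 = 2 ^ lambda_1 + ... +      *)
(* 2 ^ lambda_a + eps with lambda_1 > ... > lambda_a >= 1 and eps in {0, 1}:  *)
(* the lambda_i are the positions >= 1 of the nonzero binary digits of k + 1. *)
Definition h_ (m k : nat) : nat :=
  (\sum_(1 <= l < k.+2 | odd (k.+1 %/ 2 ^ l)) m ^ l.-1)%N.

Lemma odd_sum_exp2 (s : seq nat) (l : nat) :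
  uniq s -> odd ((\sum_(i <- s) 2 ^ i) %/ 2 ^ l)%N = (l \in s).
Proof.
move=> us.
have low : (\sum_(i <- s | i < l) 2 ^ i < 2 ^ l)%N.
  rewrite -big_filter.
  have p : perm_eq [seq i <- s | i < l]%N [seq i <- iota 0 l | i \in s].
    apply: uniq_perm; rewrite ?filter_uniq ?iota_uniq // => i.
    by rewrite !mem_filter mem_iota /= andbC.
  rewrite (perm_big _ p) /= big_filter.
  have le : (\sum_(i <- iota 0 l | i \in s) 2 ^ i <= \sum_(i <- iota 0 l) 2 ^ i)%N.
    by rewrite [leqRHS](bigID (mem s)) leq_addr.
  apply: leq_ltn_trans le _; elim: (l) => [|q IH]; first by rewrite big_nil.
  have := iotaD 0 q 1; rewrite addn1 => ->.
  by rewrite big_cat big_seq1 add0n expnS mul2n -addnn /= ltn_add2r.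
have [K hK] : exists K, (\sum_(i <- s | l < i) 2 ^ i = K.*2 * 2 ^ l)%N.
  elim: (s) => [|a t [K IH]]; first by exists 0%N; rewrite big_nil.
  rewrite big_cons IH; case: ltnP => [la|_]; last by exists K.
  exists (2 ^ (a - l.+1) + K)%N.
  rewrite -!muln2 !mulnDl; congr (_ + _)%N.
  by rewrite -mulnA -expnS -expnD subnK.
have split : (\sum_(i <- s) 2 ^ i =
    (K.*2 + (l \in s)) * 2 ^ l + \sum_(i <- s | i < l) 2 ^ i)%N.
  rewrite (bigID (fun i => i < l)%N) /= addnC; congr (_ + _)%N.
  rewrite (bigID (pred1 l)) /= addnC mulnDl -hK; congr (_ + _)%N.
    by apply: eq_bigl => i; rewrite -leqNgt ltn_neqAle eq_sym andbC.
  rewrite (eq_bigl (pred1 l)) => [|i]; last first.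
    by rewrite /=; case: eqP => [->|]; rewrite ?ltnn ?andbF.
  case ls: (l \in s).
    by rewrite (big_rem l) //= eqxx big_seq_cond big1 ?addn0 ?mul1n // => i /andP[];
      rewrite mem_rem_uniq // inE => /andP[/negPf ->].
  by rewrite mul0n big_seq_cond big1 // => i /andP[is_ /eqP il]; rewrite -il is_ in ls.
by rewrite split divnMDl ?expn_gt0 // divn_small // addn0 oddD odd_double oddb.
Qed.

Lemma h_E (m k : nat) (lambda : seq nat) (eps : bool) :
  sorted gtn lambda -> all (leq 1) lambda ->
  k.+1 = (\sum_(l <- lambda) 2 ^ l + eps)%N ->
  h_ m k = (\sum_(l <- lambda) m ^ l.-1)%N.
Proof.
move=> srt pos def_k.
have ul : uniq lambda by apply: sorted_uniq srt; [by move=> y x z xy yz; apply: ltn_trans yz xy | exact: ltnn].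
have n0 : 0%N \notin lambda by apply/negP => /(allP pos).
have bits l : (0 < l)%N -> odd (k.+1 %/ 2 ^ l) = (l \in lambda).
  move=> l0; pose s := if eps then (0 :: lambda)%N else lambda.
  have us : uniq s by rewrite /s; case: (eps); rewrite //= n0.
  have -> : k.+1 = (\sum_(i <- s) 2 ^ i)%N.
    by rewrite def_k /s; case: (eps); rewrite ?addn0 // big_cons addnC.
  rewrite odd_sum_exp2 // /s; case: (eps) => //.
  by rewrite inE (gtn_eqF l0).
rewrite /h_ -big_filter; apply: perm_big.
apply: uniq_perm; rewrite ?filter_uniq ?iota_uniq // => l.
rewrite mem_filter mem_index_iota; case: (posnP l) => [->|l0].
  by rewrite /= andbF (negPf n0).
rewrite bits //; case ll: (l \in lambda) => //=.
rewrite ltnS; apply: leq_trans (ltnW (ltn_expl l (ltnSn 1))) _.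
by rewrite def_k (big_rem l) //= -addnA leq_addr.
Qed.

(* Main.v *)
(* Write [phi] for the Segre-Veronese map, and let a vector [v] act on forms  *)
(* [f] of multidegree [d] by [<phi(p), f> = f(p)]. Put [b = floor((d_min) /   *)
(* 2)] with [d_min = min(d_2, .., d_r)] and [e = b - 1], so that [2 e < d_2]. *)
(* If [mu] runs over distinct monomials of degree [b - 1], the [x_c mu^2] are *)
(* distinct of degree [2 b - 1]; by induction on the binary digits of [b]     *)
(* there are at least [h_(n_2 + 1)(d_min - 1)] monomials of degree [e] in the *)
(* variables of the second factor, so [h] general points are separated by     *)
(* forms [H_j] of degree [e] in these variables alone. Everything follows     *)
(* from this separation.                                                      *)
(*                                                                            *)
(* Contact locus: for linear forms [l], [l'] on the first and another factor  *)
(* that vanish at [p_j], the form [(l H_j) (l' H_j S)] is singular at all     *)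
(* points, hence wherever the span of the tangent spaces is tangent. On an    *)
(* irreducible component through [p_j], where [H_j] is not identically zero,  *)
(* this forces [l = l' = 0], so the component is the point [p_j].             *)
(*                                                                            *)
(* Identifiability: by elimination a general vector of the secant variety is  *)
(* [v = sum_j phi(p_j)] with separated [p_j]. The flattening [<v, A B>], with *)
(* [A] of degree [e] in the second factor, has rank [h]. If a limit [L] of    *)
(* secant planes contains [v], the rank conditions force [<w, A B> = 0] for   *)
(* all [w] in [L] and all [B] vanishing at the points; these products span    *)
(* all forms of degree [d] vanishing at the points, so [L] is spanned by the  *)
(* [phi(p_j)].                                                                *)
(*                                                                            *)
(* Dimension: letting the points move one by one along a coordinate flag of   *)
(* [X] gives an increasing chain of unirational varieties; it is strict since *)
(* [det <v, A_a A_b G> = det(A_a(p_j))^2 prod_j G(p_j)] detects that one of   *)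
(* the points lies on [G = 0]. Upper bounds for dimensions come from          *)
(* algebraic independence.                                                    *)

(* All three conclusions are derived, independently of each other, from one separation property: [h]
   general points are separated by forms of degree [e] in the variables of the factor [i1] alone,
   where [2 * e < d i1]. Since the monomials x_c mu^2 are distinct for distinct pairs (c, mu),
   following the binary digits of floor(d_min / 2) produces more than [h] monomials of degree [e]
   ([many_monomials]), and distinct monomials have an invertible evaluation matrix at suitable
   points ([monomials_independent], [separators_exist]). Let H_j be forms dual to the points p_j.
   Two of them, and one more linear form, fit into degree [d i1].

   Tangency: a product of two forms that both vanish at every p_k kills the tangent spaces there
   ([tangent_perp]), hence the tangent space at any point where their span is tangent. With H_j
   twice and linear forms vanishing at p_j this confines a component of the contact locus through
   p_j to that point ([component_linear], [component_point]).

   Identifiability: pairing a vector with products A B, where A has degree [e] in the factor [i1],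
   gives a matrix that has rank [h] on a sum of [h] separated points ([rank_ge]). Its minors are
   polynomials, so they control limits of secant planes too ([apolar_plane]); a vector killed by all
   A B with B vanishing at the points lies in their span ([apolar_pairing]), so the plane is unique
   ([unique_plane]). That a general point of the closure is an actual sum of points is Chevalley's
   theorem ([image_contains_open]).

   Dimension: an explicit chain of irreducible sets in the secant variety, of length h (D + 1) - 1
   with D the sum of the n_i ([secant_chain]), is compared with the bound dim X <= D, which comes
   from algebraic dependence ([chain_bound], [dim_X_le]). *)
Require Import Defs.
From HB Require Import structures.
From mathcomp Require Import all_boot all_order all_algebra.
From mathcomp Require Import reals.
From mathcomp Require Import boolp classical_sets.
From mathcomp Require Import perm complex mpoly ring zify.

Set Implicit Arguments.
Unset Strict Implicit.
Unset Printing Implicit Defensive.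

Import Order.TTheory GRing.Theory Num.Theory.
Local Open Scope classical_set_scope.
Local Open Scope ring_scope.

(** * Polynomial functions *)

Section Polyfun.
Variable R : realType.
Local Notation C := R[i].

Lemma mpoly_ring_ind (K : comNzRingType) m (P : {mpoly K[m]} -> Prop) :
  (forall c, P c%:MP) -> (forall j, P 'X_j) ->
  (forall f g, P f -> P g -> P (f + g)) -> (forall f g, P f -> P g -> P (f * g)) ->
  forall f, P f.
Proof.
move=> Pc PX PD PM; elim/mpolyind => [|c mu f _ _ Pf]; first by rewrite -mpolyC0.
apply: (PD) Pf; rewrite -mul_mpolyC; apply: (PM) => //.
rewrite mpolyXE_id; elim/big_ind: _ => [|F G|j _]; [by rewrite -mpolyC1; exact: Pc|exact: PM|].
by elim: (mu j) => [|k IH]; rewrite ?expr0 ?exprS -?mpolyC1; [exact: Pc|exact: PM].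
Qed.

Lemma poly0_inf (p : {poly C}) : (forall t : C, p.[t] = 0) -> p = 0.
Proof.
move=> p0; apply/eqP/negPn/negP => pn0.
have := max_poly_roots pn0 (rs := [seq (k%:R : C) | k <- iota 0 (size p)]).
rewrite size_map size_iota ltnn => H; apply: (negP (isT : ~~ false)); apply: H.
  by apply/allP => x _; apply/eqP/p0.
rewrite map_inj_uniq ?iota_uniq // => a b /eqP; by rewrite eqr_nat => /eqP.
Qed.

Lemma poly0_inf_neq0 (p : {poly C}) : (forall t : C, t != 0 -> p.[t] = 0) -> p = 0.
Proof.
move=> p0; have : 'X * p = 0.
  apply: poly0_inf => t; rewrite hornerM hornerX; have [->|t0] := eqVneq t 0; first by rewrite mul0r.
  by rewrite p0 ?mulr0.
by move/eqP; rewrite mulf_eq0 polyX_eq0 => /eqP.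
Qed.

(** Polynomials are handled as functions, so that closure under composition, products and
    determinants needs no explicit coefficients. *)
Definition polyfun m (f : 'rV[C]_m -> C) := exists F : {mpoly C[m]}, forall v : 'rV[C]_m, F.@[v 0] = f v.

Lemma polyfun_ext m (f g : 'rV[C]_m -> C) : f =1 g -> polyfun f -> polyfun g.
Proof. by move=> e [F HF]; exists F => v; rewrite HF. Qed.

Lemma polyfun_cst m c : polyfun (fun _ : 'rV[C]_m => c).
Proof. by exists c%:MP => v; rewrite mevalC. Qed.

Lemma polyfun_coord m j : polyfun (fun v : 'rV[C]_m => v 0 j).
Proof. by exists 'X_j => v; rewrite mevalXU. Qed.

Lemma polyfunD m (f g : 'rV[C]_m -> C) : polyfun f -> polyfun g -> polyfun (fun v => f v + g v).
Proof. by move=> [F HF] [G HG]; exists (F + G) => v; rewrite mevalD HF HG. Qed.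

Lemma polyfunM m (f g : 'rV[C]_m -> C) : polyfun f -> polyfun g -> polyfun (fun v => f v * g v).
Proof. by move=> [F HF] [G HG]; exists (F * G) => v; rewrite mevalM HF HG. Qed.

Lemma polyfun_sum m (I : Type) (s : seq I) (P : pred I) (f : I -> 'rV[C]_m -> C) :
  (forall a, polyfun (f a)) -> polyfun (fun v => \sum_(a <- s | P a) f a v).
Proof.
move=> H; elim: s => [|a s IH]; first by apply: polyfun_ext (polyfun_cst m 0) => v; rewrite big_nil.
case Pa: (P a).
  by apply: polyfun_ext (polyfunD (H a) IH) => v; rewrite big_cons Pa.
by apply: polyfun_ext IH => v; rewrite big_cons Pa.
Qed.

Lemma polyfun_prod m (I : Type) (s : seq I) (P : pred I) (f : I -> 'rV[C]_m -> C) :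
  (forall a, polyfun (f a)) -> polyfun (fun v => \prod_(a <- s | P a) f a v).
Proof.
move=> H; elim: s => [|a s IH]; first by apply: polyfun_ext (polyfun_cst m 1) => v; rewrite big_nil.
case Pa: (P a).
  by apply: polyfun_ext (polyfunM (H a) IH) => v; rewrite big_cons Pa.
by apply: polyfun_ext IH => v; rewrite big_cons Pa.
Qed.

Lemma polyfunX m (f : 'rV[C]_m -> C) k : polyfun f -> polyfun (fun v => f v ^+ k).
Proof. by move=> [F HF]; exists (F ^+ k) => v; rewrite rmorphXn /= HF. Qed.

Lemma polyfun_det m k (A : 'rV[C]_m -> 'M[C]_k) :
  (forall a b, polyfun (fun v => A v a b)) -> polyfun (fun v => \det (A v)).
Proof.
move=> H; rewrite /determinant; apply: polyfun_sum => s.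
apply: polyfunM; first exact: polyfun_cst.
exact: polyfun_prod.
Qed.

Lemma polyfun_comp m k (f : 'rV[C]_k -> C) (g : 'rV[C]_m -> 'rV[C]_k) :
  polyfun f -> (forall a, polyfun (fun v => g v 0 a)) -> polyfun (fun v => f (g v)).
Proof.
move=> [F HF] Hg; apply: (@polyfun_ext _ (fun v => F.@[(g v) 0])) => [v|]; first exact: HF.
elim/mpoly_ring_ind: F {HF} => [c|j|F G HF HG|F G HF HG].
- by apply: polyfun_ext (polyfun_cst m c) => v; rewrite mevalC.
- by apply: polyfun_ext (Hg j) => v; rewrite mevalXU.
- by apply: polyfun_ext (polyfunD HF HG) => v; rewrite mevalD.
- by apply: polyfun_ext (polyfunM HF HG) => v; rewrite mevalM.
Qed.

Lemma polyfun_line m (f : 'rV[C]_m -> C) (a b : 'rV[C]_m) :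
  polyfun f -> exists q : {poly C}, forall t, q.[t] = f (a + t *: b).
Proof.
move=> [F HF]; suff [q Hq] : exists q : {poly C}, forall t, q.[t] = F.@[(a + t *: b) 0].
  by exists q => t; rewrite Hq HF.
elim/mpoly_ring_ind: F {HF} => [c|j|F G [p Hp] [q Hq]|F G [p Hp] [q Hq]].
- by exists c%:P => t; rewrite hornerC mevalC.
- by exists ((a 0 j)%:P + 'X * (b 0 j)%:P) => t; rewrite !hornerE mevalXU !mxE.
- by exists (p + q) => t; rewrite hornerD mevalD Hp Hq.
- by exists (p * q) => t; rewrite hornerM mevalM Hp Hq.
Qed.

(* Restrict to the line through a point where [f] does not vanish and a point where [g] does not. *)
Lemma polyfun_prime m (f g : 'rV[C]_m -> C) : polyfun f -> polyfun g ->
  (exists v, f v != 0) -> (exists v, g v != 0) -> exists v, f v * g v != 0.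
Proof.
move=> Pf Pg [a fa] [b gb].
have [p Hp] := polyfun_line a (b - a) Pf; have [q Hq] := polyfun_line a (b - a) Pg.
apply: contrapT => /forallNP H.
have : p * q = 0.
  by apply: poly0_inf => t; rewrite hornerM Hp Hq; apply/eqP/negPn/negP; apply: H.
move/eqP; rewrite mulf_eq0 => /orP[] /eqP z.
  by move: fa; rewrite -[a]addr0 -(scale0r (b - a)) -Hp z horner0 eqxx.
by move: gb; rewrite -[b](subrK a) addrC -[b - a]scale1r -Hq z horner0 eqxx.
Qed.

Lemma polyfun_lin m (c : 'cV[C]_m) : polyfun (fun v => (v *m c) 0 0).
Proof.
apply: (@polyfun_ext _ (fun v => \sum_j v 0 j * c j 0)) => [v|]; first by rewrite mxE.
by apply: polyfun_sum => j; apply: polyfunM; [exact: polyfun_coord | exact: polyfun_cst].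
Qed.

End Polyfun.

(** * Zariski closure and irreducibility *)

Section Closure.
Variables (R : realType) (m : nat).
Local Notation C := R[i].
Implicit Types (A B Z : set 'rV[C]_m) (v : 'rV[C]_m).

Lemma dhomog_mevalZ (F : {mpoly C[m]}) e (c : C) v :
  F \is e.-homog -> F.@[(c *: v) 0] = c ^+ e * F.@[v 0].
Proof.
move=> /dhomogP hF; rewrite !mevalE mulr_sumr !big_seq; apply: eq_bigr => mu /hF <-.
rewrite mulrCA; congr (_ * _).
rewrite (eq_bigr (fun j => c ^+ mu j * v 0 j ^+ mu j)) => [|j _]; last by rewrite !mxE exprMn.
by rewrite big_split /= prodrXr mdegE.
Qed.

(** The values at [a] of the homogeneous components of a polynomial are the coefficients of its
    restriction to the line through 0 and [a]. On a cone that restriction is zero away from 0, so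
    every component vanishes. *)
Lemma closure_polyfun A (f : 'rV[C]_m -> C) v : projective_set A -> polyfun f ->
  (forall a, A a -> f a = 0) -> zariski_closure A v -> f v = 0.
Proof.
move=> hA [F HF] fA [v0 cv].
rewrite -HF (pihomog_partitionE (leqnn (mmeasure mdeg F))).
rewrite raddf_sum big1 //= => d _; apply: cv (pihomogP mdeg d F) _ => a Aa.
pose q := \poly_(e < mmeasure mdeg F) (pihomog mdeg e F).@[a 0].
have q0 : q = 0.
  apply: poly0_inf_neq0 => c c0.
  rewrite -(fA _ ((hA a Aa).2 c c0)) -HF [in RHS](pihomog_partitionE (leqnn (mmeasure mdeg F))).
  rewrite horner_poly raddf_sum /=; apply: eq_bigr => e _.
  by rewrite (dhomog_mevalZ _ _ (pihomogP _ _ _)) mulrC.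
by have := congr1 (fun p : {poly C} => p`_d) q0; rewrite coef_poly ltn_ord coef0.
Qed.

Lemma sub_closure A : projective_set A -> A `<=` zariski_closure A.
Proof. by move=> hA a Aa; split=> [|e F _]; [case: (hA a Aa) | exact]. Qed.

Lemma closure_mono A B : A `<=` B -> zariski_closure A `<=` zariski_closure B.
Proof. by move=> AB v [v0 H]; split=> // e F hF FB; apply: H hF _ => a /AB /FB. Qed.

Lemma projective_closure A : projective_set (zariski_closure A).
Proof.
move=> v [v0 H]; split=> // c c0; split; first by rewrite scaler_eq0 negb_or c0.
by move=> e F hF FA; rewrite (dhomog_mevalZ _ _ hF) (H _ _ hF FA) mulr0.
Qed.

Lemma zariski_closure_closed A : zariski_closed (zariski_closure A).
Proof.
apply/seteqP; split=> [v [v0 H]|]; last exact/sub_closure/projective_closure.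
by split=> // e F hF FA; apply: H (hF) _ => a [_ Ha]; exact: Ha hF FA.
Qed.

Lemma closed_in_sub A B : A `<=` B -> zariski_closed A -> closed_in B A.
Proof. by move=> AB cA; rewrite /closed_in cA; apply/esym/setIidr. Qed.

Lemma zariski_closed_polyfun (I : Type) (f : I -> 'rV[C]_m -> C) : (forall a, polyfun (f a)) ->
  (forall v c, c != 0 -> (forall a, f a v = 0) -> forall a, f a (c *: v) = 0) ->
  zariski_closed [set v | v != 0 /\ forall a, f a v = 0].
Proof.
move=> Pf hf; have pZ : projective_set [set v | v != 0 /\ forall a, f a v = 0].
  move=> v [v0 fv]; split=> // c c0; split; first by rewrite scaler_eq0 negb_or c0.
  exact: hf.
apply/seteqP; split=> [v cv|]; last exact: sub_closure.
split=> [|a]; first by case: cv.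
by apply: closure_polyfun cv => // w [].
Qed.

(** As [f] and [g] need not be homogeneous, the closed sets used are those where [f], resp. [g],
    vanishes on the whole punctured line; on each line of [A] one of the two restrictions is the
    zero polynomial. *)
Lemma irreducible_polyfun A (f g : 'rV[C]_m -> C) : irreducible A -> polyfun f -> polyfun g ->
  (forall a, A a -> f a * g a = 0) -> (forall a, A a -> f a = 0) \/ (forall a, A a -> g a = 0).
Proof.
move=> [pA _ hA] Pf Pg fg.
have PZ (c : C) k : polyfun k -> polyfun (fun v : 'rV[C]_m => k (c *: v)).
  move=> Pk; apply: polyfun_comp => // a.
  apply: (@polyfun_ext _ _ (fun v : 'rV[C]_m => c * v 0 a)) => [v|]; first by rewrite mxE.
  by apply: polyfunM; [exact: polyfun_cst | exact: polyfun_coord].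
pose Z (k : 'rV[C]_m -> C) := [set v | v != 0 /\ forall c : {c : C | c != 0}, k (sval c *: v) = 0].
have cZ k : polyfun k -> zariski_closed (Z k).
  move=> Pk; apply: zariski_closed_polyfun => [c|v d d0 H [c c0]]; first exact: PZ.
  have cd : c * d != 0 by rewrite mulf_neq0.
  by have := H (exist (fun c : C => c != 0) _ cd); rewrite /= scalerA.
have H1 : A `<=` Z f `|` Z g.
  move=> a Aa; have [a0 aZ] := pA a Aa.
  have [p Hp] := polyfun_line 0 a Pf; have [q Hq] := polyfun_line 0 a Pg.
  have /eqP : p * q = 0.
    by apply: poly0_inf_neq0 => c c0; rewrite hornerM Hp Hq add0r; apply/fg/aZ.
  rewrite mulf_eq0 => /orP[] /eqP e0; [left|right]; split=> // -[c c0] /=.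
    by rewrite -[c *: a]add0r -Hp e0 horner0.
  by rewrite -[c *: a]add0r -Hq e0 horner0.
by have [H|H] := hA _ _ (cZ f Pf) (cZ g Pg) H1; [left|right] => a /H [_ /(_ (exist (fun c : C => c != 0) 1 (oner_neq0 _)))]; rewrite /= scale1r.
Qed.

(** A closed set that misses part of the image has an equation whose pullback is not zero; pullbacks
    of two such equations have a common point of nonvanishing. *)
Lemma irreducible_closure_param k (psi : 'rV[C]_k -> 'rV[C]_m) :
  (forall a, polyfun (fun u => psi u 0 a)) -> 
  projective_set [set v | v != 0 /\ exists u, v = psi u] -> (exists u, psi u != 0) ->
  irreducible (zariski_closure [set v | v != 0 /\ exists u, v = psi u]).
Proof.
set W := [set v | _]; move=> Ppsi pW [u0 psiu0]; split; first exact: projective_closure.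
  by exists (psi u0); apply: sub_closure => //; split=> //; exists u0.
have sep Z : zariski_closed Z -> ~ zariski_closure W `<=` Z ->
    exists f, [/\ polyfun f, (forall a, Z a -> f a = 0) & exists u, f (psi u) != 0].
  move=> cZ WZ; have {}WZ : ~ W `<=` Z by move=> /closure_mono; rewrite cZ.
  have [w Ww Zw] : exists2 w, W w & ~ Z w.
    by apply: contrapT => H; apply: WZ => w Ww; apply: contrapT => Zw; apply: H; exists w.
  apply: contrapT => H; apply: Zw; rewrite -cZ; split=> [|e F hF FZ]; first by case: Ww.
  apply/eqP/negPn/negP => Fw; apply: H; exists (fun v => F.@[v 0]); split=> //; first by exists F.
  by case: Ww => _ [u wu]; exists u; rewrite -wu.
move=> Z1 Z2 c1 c2 W12.
apply: contrapT => /not_orP[/(sep _ c1)[f [Pf fZ fu]] /(sep _ c2)[g [Pg gZ gu]]].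
(* The coordinate [a] is a third factor that keeps [psi u] nonzero. *)
have [a pa] : exists a, psi u0 0 a != 0 by apply/rV0Pn.
have Pc f' : polyfun f' -> polyfun (fun u => f' (psi u)) by move=> ?; apply: polyfun_comp.
have [u2 H2] := polyfun_prime (Pc _ Pf) (Pc _ Pg) fu gu.
have [u] := polyfun_prime (polyfunM (Pc _ Pf) (Pc _ Pg)) (Ppsi a) (ex_intro _ u2 H2) (ex_intro _ u0 pa).
rewrite !mulf_eq0 !negb_or => /andP[/andP[f0 g0] p0].
have Wu : zariski_closure W (psi u).
  by apply: sub_closure => //; split; [apply/rV0Pn; exists a | exists u].
by case: (W12 _ Wu) => [/fZ|/gZ] e; rewrite e eqxx in f0 g0.
Qed.

End Closure.

(** * Elimination: the image of a polynomial map contains an open subset of its closure *)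

Lemma size_min (K : nzRingType) (P : {poly K} -> Prop) : (exists g, P g) ->
  exists2 g, P g & forall g', P g' -> (size g <= size g')%N.
Proof.
move=> [g0 Pg0].
have exP : exists s, `[< exists2 g, P g & size g = s >] by exists (size g0); apply/asboolP; exists g0.
case: (ex_minnP exP) => s /asboolP[g Pg <-] ming; exists g => // g' Pg'.
by apply: ming; apply/asboolP; exists g'.
Qed.

Lemma pseudo_division (K : idomainType) (p q : {poly K}) : q != 0 ->
  exists j u r, [/\ lead_coef q ^+ j *: p = u * q + r, (size r < size q)%N &
    size u = (size p - (size q).-1)%N].
Proof.
move=> q0; do 3!eexists; split; [exact: Pdiv.Idomain.divp_eq | exact: Pdiv.Idomain.ltn_modpN0 |].
exact: Pdiv.Idomain.size_divp.
Qed.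

(* [K] stands for the polynomials in the first coordinates, evaluated at a point [v] by [ev v], and [W] for *)
(* an irreducible set. *)
Section EliminationStep.
Variables (K : idomainType) (C : closedFieldType) (V : Type) (ev : V -> {rmorphism K -> C}) (W : set (V * C)).
Implicit Types (a b : K) (f g q r s : {poly K}) (v : V).
Hypothesis poly_inf : forall p : {poly C}, (forall t, p.[t] = 0) -> p = 0.

Definition poly_at g v (t : C) : C := (map_poly (ev v) g).[t].

Lemma poly_at0 v t : poly_at 0 v t = 0.
Proof. by rewrite /poly_at rmorph0 horner0. Qed.
Lemma poly_atD f g v t : poly_at (f + g) v t = poly_at f v t + poly_at g v t.
Proof. by rewrite /poly_at rmorphD hornerD. Qed.
Lemma poly_atB f g v t : poly_at (f - g) v t = poly_at f v t - poly_at g v t.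
Proof. by rewrite /poly_at rmorphB hornerD hornerN. Qed.
Lemma poly_atN g v t : poly_at (- g) v t = - poly_at g v t.
Proof. by rewrite /poly_at rmorphN hornerN. Qed.
Lemma poly_atM f g v t : poly_at (f * g) v t = poly_at f v t * poly_at g v t.
Proof. by rewrite /poly_at rmorphM hornerM. Qed.
Lemma poly_atC a v t : poly_at a%:P v t = ev v a.
Proof. by rewrite /poly_at map_polyC hornerC. Qed.
Lemma poly_atX v t : poly_at 'X v t = t.
Proof. by rewrite /poly_at map_polyX hornerX. Qed.
Lemma poly_atZ a g v t : poly_at (a *: g) v t = ev v a * poly_at g v t.
Proof. by rewrite -mul_polyC poly_atM poly_atC. Qed.
Definition poly_atE := (poly_atB, poly_atD, poly_atN, poly_atM, poly_atC, poly_atX, poly_atZ).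

Definition null a := forall w, W w -> ev w.1 a = 0.
Definition Null g := forall w, W w -> poly_at g w.1 w.2 = 0.

Hypothesis NullM : forall f g, Null (f * g) -> Null f \/ Null g.

Lemma NullC a : Null a%:P <-> null a.
Proof. by split=> N w Ww; have := N w Ww; rewrite poly_atC. Qed.

Lemma nullM a b : null (a * b) -> null a \/ null b.
Proof. by move=> /NullC; rewrite polyCM => /NullM[] /NullC; [left|right]. Qed.

Lemma nullX a j : null (a ^+ j) -> (exists w, W w) -> null a.
Proof.
move=> + [w Ww]; elim: j => [|j IH] n0; first by have := n0 w Ww; rewrite rmorph1 => /eqP; rewrite oner_eq0.
by move: n0; rewrite exprS => /nullM[].
Qed.

(** Used to see that polynomials of minimal degree have a leading coefficient that is not null. *)
Lemma drop_null_lead (g : {poly K}) : g != 0 -> null (lead_coef g) ->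
  exists g' : {poly K}, [/\ (size g' < size g)%N, Null (g - g') &
     forall i, ~ null g`_i -> g'`_i = g`_i].
Proof.
move=> g0 ng; exists (\poly_(i < (size g).-1) g`_i).
have sg : (0 < size g)%N by rewrite size_poly_gt0.
split=> [||i ni]; rewrite ?coef_poly.
- by apply: leq_ltn_trans (size_poly _ _) _; rewrite prednK.
- have -> : g - \poly_(i < (size g).-1) g`_i = lead_coef g *: 'X^((size g).-1).
    apply/polyP => i; rewrite coefB coef_poly coefZ coefXn.
    case: ltngtP => h /=; rewrite ?subrr ?mulr0 // ?mulr1 ?subr0.
      by rewrite nth_default // -(prednK sg).
    by rewrite h.
  by move=> w Ww; rewrite poly_atZ ng // mul0r.
case: ltnP => // h; case: (ltngtP i (size g).-1) h => // h _; last by rewrite h in ni; case: ni.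
by rewrite nth_default // -(prednK sg).
Qed.

(* [G]: a relation of minimal degree for the last coordinate over the others; without one, the last *)
(* coordinate is free. The minimal [E] in the ideal generated by [b] has degree 0, which bounds [b] away from 0. *)
Lemma eliminate_step (b : {poly K}) : ~ Null b -> exists2 alpha, ~ null alpha &
  forall v, (forall a, null a -> ev v a = 0) -> ev v alpha != 0 ->
    exists t, (forall g, Null g -> poly_at g v t = 0) /\ poly_at b v t != 0.
Proof.
move=> nb.
have nn a : ~ null a -> exists2 w, W w & ev w.1 a != 0.
  move=> na; apply: contrapT => H; apply: na => w Ww; apply/eqP/negPn/negP => aw.
  by apply: H; exists w.
have [w0 Ww0 _] : exists2 w, W w & poly_at b w.1 w.2 != 0.
  apply: contrapT => H; apply: nb => w Ww; apply/eqP/negPn/negP => bw.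
  by apply: H; exists w.
have exW : exists w, W w by exists w0.
(* Free case: every relation has null coefficients only, so a non-null coefficient of [b] serves as
   [alpha]. *)
have [[g [Ng [i ni]]]|free] := pselect (exists g : {poly K}, Null g /\ exists i, ~ null g`_i); last first.
  have {}free g : Null g -> forall i, null g`_i.
    by move=> Ng i; apply: contrapT => ni; apply: free; exists g; split=> //; exists i.
  have [i nbi] : exists i, ~ null b`_i.
    apply: contrapT => H; apply: nb => w Ww; rewrite /poly_at horner_coef big1 // => i _.
    rewrite coef_map /=; suff -> : ev w.1 (b`_i) = 0 by rewrite mul0r.
    by have /(_ w Ww) : null b`_i by apply: contrapT => ni; apply: H; exists i.
  exists b`_i => // v nv bv.
  have [t bt] : exists t, poly_at b v t != 0.
    apply: contrapT => /forallNP H; have : map_poly (ev v) b = 0.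
      by apply: poly_inf => t; apply/eqP/negPn/negP/H.
    by move=> /(congr1 (fun p : {poly C} => p`_i)); rewrite coef_map coef0 /= => e; rewrite e eqxx in bv.
  exists t; split=> // g Ng; rewrite /poly_at horner_coef big1 // => j _.
  by rewrite coef_map /= (nv _ (free _ Ng j)) mul0r.
have [G [NG [iG niG]] minG] :
    exists2 G : {poly K}, Null G /\ (exists i, ~ null G`_i) &
      forall g', Null g' /\ (exists i, ~ null g'`_i) -> (size G <= size g')%N.
  by apply: size_min; exists g; split=> //; exists i.
have small r : Null r -> (size r < size G)%N -> forall j, null r`_j.
  move=> Nr sr j; apply: contrapT => nj; move: sr; rewrite ltnNge minG //.
  by split=> //; exists j.
have G0 : G != 0 by apply: contra_notN niG => /eqP -> w _; rewrite coef0 rmorph0.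
have nlG : ~ null (lead_coef G).
  move=> /(drop_null_lead G0)[g' [sg' Ng' cg']]; move: sg'; rewrite ltnNge minG //; split.
    by move=> w Ww; have := Ng' w Ww; rewrite poly_atB NG // sub0r => /eqP; rewrite oppr_eq0 => /eqP.
  by exists iG; rewrite cg'.
have NGM q : Null (q * G) by move=> w Ww; rewrite poly_atM NG // mulr0.
have lGX j : ~ null (lead_coef G ^+ j) by move=> /nullX; auto.
have nZ a r : ~ null a -> ~ Null r -> ~ Null (a *: r) by move=> na nr; rewrite -mul_polyC => /NullM[/NullC|].
(* The multiples of [b] modulo relations that are not relations themselves. *)
pose J E := (exists s, Null (E - s * b)) /\ ~ Null E.
have Jb : exists E, J E by exists b; split=> //; exists 1; rewrite mul1r subrr => w _; rewrite poly_at0.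
have [E [[S HS] nE] minE] := size_min Jb.
have E0 : E != 0 by apply: contra_notN nE => /eqP -> w _; rewrite poly_at0.
have nlE : ~ null (lead_coef E).
  move=> /(drop_null_lead E0)[E' [sE' NE' _]]; move: sE'; rewrite ltnNge minE //; split.
    exists S => w Ww; rewrite poly_atB; have := HS w Ww; have := NE' w Ww; rewrite !poly_atB.
    by move=> /eqP; rewrite subr_eq0 => /eqP ->.
  by move=> NE; apply: nE => w Ww; have := NE' w Ww; rewrite poly_atB NE // subr0.
(* The pseudo-remainder of [E] modulo [G] is again in [J]. *)
have sEG : (size E < size G)%N.
  have [u [q [r [eqE srG _]]]] := pseudo_division E G0; set a := _ ^+ _ in eqE.
  apply: leq_ltn_trans srG; apply: minE; split.
    exists (a *: S) => w Ww; have -> : r = a *: E - q * G by rewrite eqE addrC addKr.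
    have := HS w Ww; rewrite !poly_atE; rewrite NG // mulr0 subr0 -mulrA -mulrBr => ->; rewrite ?mulr0 //.
  move=> Nr; apply: (nZ a E (lGX u) nE) => w Ww.
  by rewrite eqE poly_atD (NGM q w Ww) Nr // addr0.
(* Otherwise divide [G] by [E]. By minimality of [E] the remainder is a relation, hence so is the
   quotient; both are shorter than [G], so their coefficients are null, and the leading coefficient
   of [G] would be null. *)
have sE1 : (size E <= 1)%N.
  rewrite leqNgt; apply/negP => sE2.
  have [u [q [r [eqG srE sq]]]] := pseudo_division G E0; set a := _ ^+ _ in eqG.
  have NaG : Null (a *: G) by rewrite -mul_polyC.
  have Nr : Null r.
    apply: contrapT => nr; move: srE; rewrite ltnNge minE //; split=> //.
    exists (- q * S) => w Ww; have := NaG w Ww; have := HS w Ww; rewrite eqG !poly_atE.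
    move=> /eqP; rewrite subr_eq0 => /eqP ->.
    by rewrite !mulNr opprK mulrA addrC.
  have NqE : Null (q * E) by move=> w Ww; have := NaG w Ww; rewrite eqG poly_atD Nr // addr0.
  have Nq : Null q by case: (NullM NqE).
  have sqG : (size q < size G)%N.
    rewrite sq; move: sE2 sEG; case: (size E) => [|[|l]] //= _ h.
    by rewrite ltn_subrL /=; apply: leq_trans h.
  apply: nlG; suff : null (a * lead_coef G).
    by case/nullM => // na; case: nlE; exact: nullX na exW.
  rewrite -[a * lead_coef G](coefZ a G) eqG coefD => w Ww.
  rewrite rmorphD (small _ Nr (ltn_trans srE sEG)) // addr0 coefM raddf_sum big1 //= => j _.
  by rewrite rmorphM (small _ Nq sqG) // mul0r.
have [e eE] : exists e, E = e%:P by exists E`_0; exact: size1_polyC.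
have ne : ~ null e by move=> /NullC; rewrite -eE.
(* Where the leading coefficient does not vanish, [G] specializes to a polynomial with a root; where
   [e] does not vanish, neither does [b] at a common zero of the relations, because [e] is a
   multiple of [b] there. *)
exists (e * lead_coef G); first by move=> /nullM[].
move=> v nv; rewrite rmorphM mulf_eq0 negb_or => /andP[ev_e lv].
have [t Gt] : exists t, poly_at G v t = 0.
  have szG : (1 < size G)%N.
    rewrite ltnNge; apply/negP => /size1_polyC eG; apply: nlG; rewrite eG lead_coefC.
    by apply/NullC; rewrite -eG.
  have /closed_rootP[t /rootP rt] : size (map_poly (ev v) G) != 1.
    by rewrite size_poly_eq // gtn_eqF.
  by exists t.
exists t.
(* A pseudo-remainder modulo [G] of a relation is a relation shorter than [G], so its coefficients
   are null. *)
have clt g' : Null g' -> poly_at g' v t = 0.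
  move=> Ng'; have [j [q [r [eqg srG _]]]] := pseudo_division g' G0; set a := _ ^+ _ in eqg.
  have Nr : Null r.
    have -> : r = a *: g' - q * G by rewrite eqg addrC addKr.
    by move=> u Wu; rewrite !poly_atE Ng' // NG // !mulr0 subr0.
  have av : ev v a != 0 by rewrite rmorphXn expf_neq0.
  apply: (mulfI av); rewrite mulr0 -poly_atZ eqg poly_atD poly_atM Gt mulr0 add0r.
  rewrite /poly_at horner_coef big1 // => l _; rewrite coef_map /=.
  by rewrite (nv _ (small _ Nr srG l)) mul0r.
split=> //; apply: contra_neq ev_e => bv.
have := clt _ HS; rewrite eE !poly_atE bv mulr0 subr0; exact.
Qed.

End EliminationStep.

Section Chevalley.
Variable R : realType.
Local Notation C := R[i].

Section OneStep.
Variable k : nat.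

Definition ext (v : 'rV[C]_k) (t : C) : 'rV[C]_k.+1 :=
  \row_a (if unlift ord_max a is Some b then v 0 b else t).
Definition init (w : 'rV[C]_k.+1) : 'rV[C]_k := \row_a w 0 (lift ord_max a).

Lemma ext_last v t : ext v t 0 ord_max = t.
Proof. by rewrite mxE unlift_none. Qed.
Lemma init_ext v t : init (ext v t) = v.
Proof. by apply/rowP => a; rewrite !mxE liftK. Qed.
Lemma ext_init w : ext (init w) (w 0 ord_max) = w.
Proof. by apply/rowP => a; rewrite !mxE; case: unliftP => [b|] ->; rewrite ?mxE. Qed.

Lemma polyfun_init a : polyfun (fun w => init w 0 a).
Proof. by apply: polyfun_ext (polyfun_coord R (lift ord_max a)) => w; rewrite mxE. Qed.

Definition mev (v : 'rV[C]_k) : {rmorphism {mpoly C[k]} -> C} := meval (v 0).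
Definition eval2 := poly_at mev.

Lemma polyfun_eval2 g : polyfun (fun w => eval2 g (init w) (w 0 ord_max)).
Proof.
elim/poly_ind: g => [|g a IH].
  by apply: polyfun_ext (polyfun_cst _ 0) => w; rewrite /eval2 poly_at0.
apply: (@polyfun_ext _ _ (fun w => eval2 g (init w) (w 0 ord_max) * w 0 ord_max + a.@[(init w) 0])) => [w|].
  by rewrite /eval2 !poly_atE.
apply: polyfunD; first by apply: polyfunM => //; exact: polyfun_coord.
apply: (@polyfun_comp _ _ _ (fun v : 'rV[C]_k => a.@[v 0])); [by exists a | exact: polyfun_init].
Qed.

Lemma polyfun_eval2P f : polyfun f -> exists g, forall v t, eval2 g v t = f (ext v t).
Proof.
move=> [F HF]; suff [g Hg] : exists g, forall v t, eval2 g v t = F.@[(ext v t) 0].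
  by exists g => v t; rewrite Hg HF.
elim/mpoly_ring_ind: F {HF} => [c|j|F G [p Hp] [q Hq]|F G [p Hp] [q Hq]].
- by exists (c%:MP)%:P => v t; rewrite /eval2 poly_atC /= !mevalC.
- case: (unliftP ord_max j) => [b|] ->.
    by exists ('X_b)%:P => v t; rewrite /eval2 poly_atC /= !mevalXU mxE liftK.
  by exists 'X => v t; rewrite /eval2 poly_atX mevalXU ext_last.
- by exists (p + q) => v t; rewrite /eval2 poly_atD -/eval2 mevalD Hp Hq.
- by exists (p * q) => v t; rewrite /eval2 poly_atM -/eval2 mevalM Hp Hq.
Qed.

End OneStep.

Definition prime_set k (W : set 'rV[C]_k) := forall f g, polyfun f -> polyfun g ->
  (forall w, W w -> f w * g w = 0) -> (forall w, W w -> f w = 0) \/ (forall w, W w -> g w = 0).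

(** Closure in affine space, in contrast to [zariski_closure]: elimination is applied to graphs,
    which are not cones. *)
Definition cl k (W : set 'rV[C]_k) := [set v : 'rV[C]_k | forall f, polyfun f ->
  (forall w, W w -> f w = 0) -> f v = 0].

Lemma eliminate_last k (W : set 'rV[C]_k.+1) (beta : 'rV[C]_k.+1 -> C) : prime_set W ->
  polyfun beta -> (exists2 w, W w & beta w != 0) ->
  exists2 alpha : 'rV[C]_k -> C, polyfun alpha & (exists2 w, W w & alpha (init w) != 0) /\
   forall v, cl (@init k @` W) v -> alpha v != 0 -> exists t, cl W (ext v t) /\ beta (ext v t) != 0.
Proof.
move=> prW Pbeta [w0 Ww0 beta0]; have [b Hb] := polyfun_eval2P Pbeta.
pose W2 : set ('rV[C]_k * C) := [set w | W (ext w.1 w.2)].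
have W2W w : W w -> W2 (init w, w 0 ord_max) by move=> Ww; rewrite /W2 /= ext_init.
have NullM f g : Null (@mev k) W2 (f * g) -> Null (@mev k) W2 f \/ Null (@mev k) W2 g.
  move=> N; case: (prW _ _ (polyfun_eval2 f) (polyfun_eval2 g)) => [w Ww|H|H].
  - by have := N _ (W2W w Ww); rewrite poly_atM.
  - by left=> -[v t] W2w; have := H _ W2w; rewrite init_ext ext_last.
  by right=> -[v t] W2w; have := H _ W2w; rewrite init_ext ext_last.
have nb : ~ Null (@mev k) W2 b.
  by move/(_ _ (W2W _ Ww0)); rewrite /= -/(eval2 _ _ _) Hb ext_init => e; rewrite e eqxx in beta0.
have [alpha na Ha] := eliminate_step (@poly0_inf R) NullM nb.
exists (fun v => alpha.@[v 0]); first by exists alpha.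
split=> [|v cv av].
  apply: contrapT => H; apply: na => -[v t] W2w; apply/eqP/negPn/negP => aw; apply: H.
  by exists (ext v t); [exact: W2w | rewrite init_ext; exact: aw].
have [|t [Nt bt]] := Ha v _ av.
  by move=> a Na; apply: (cv (fun v => a.@[v 0])); [exists a | move=> _ [w Ww <-]; exact: Na _ (W2W w Ww)].
exists t; split=> [f Pf fW|]; last by rewrite -Hb.
have [g Hg] := polyfun_eval2P Pf; rewrite -Hg; apply: Nt => -[u s] W2w.
by rewrite -/(eval2 _ _ _) Hg fW.
Qed.

Section Several.
Variable m : nat.

(** With the number of dropped coordinates on the left, [k.+1 + m] is convertible to [(k + m).+1]
    and no casts arise. *)
Fixpoint initk k : 'rV[C]_(k + m) -> 'rV[C]_m :=
  if k is k'.+1 then fun w => @initk k' (init w) else id.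
Fixpoint lastk k : 'rV[C]_(k + m) -> 'rV[C]_k :=
  if k is k'.+1 then fun w => ext (@lastk k' (init w)) (w 0 ord_max) else fun=> 0.
Fixpoint joink k (v : 'rV[C]_m) : 'rV[C]_k -> 'rV[C]_(k + m) :=
  if k is k'.+1 then fun u => ext (@joink k' v (init u)) (u 0 ord_max) else fun=> v.

Lemma polyfun_ext_coord M k (f : 'rV[C]_M -> 'rV[C]_k) (g : 'rV[C]_M -> C) a :
  (forall b, polyfun (fun u => f u 0 b)) -> polyfun g -> polyfun (fun u => ext (f u) (g u) 0 a).
Proof.
move=> Pf Pg; case: (unliftP ord_max a) => [b|] ->.
  by apply: polyfun_ext (Pf b) => u; rewrite mxE liftK.
by apply: polyfun_ext Pg => u; rewrite ext_last.
Qed.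

Lemma polyfun_initk k a : polyfun (fun w => @initk k w 0 a).
Proof.
elim: k => [|k IH]; first exact: polyfun_coord.
exact: (polyfun_comp IH (@polyfun_init _)).
Qed.

Lemma polyfun_lastk k a : polyfun (fun w => @lastk k w 0 a).
Proof.
elim: k a => [[]//|k IH] a; apply: polyfun_ext_coord => [b|]; last exact: polyfun_coord.
exact: (polyfun_comp (IH b) (@polyfun_init _)).
Qed.

Lemma polyfun_joink M k (f : 'rV[C]_M -> 'rV[C]_m) (g : 'rV[C]_M -> 'rV[C]_k) a :
  (forall b, polyfun (fun u => f u 0 b)) -> (forall b, polyfun (fun u => g u 0 b)) ->
  polyfun (fun u => joink (f u) (g u) 0 a).
Proof.
move=> Pf; elim: k g a => [|k IH] g a Pg; first exact: Pf.
apply: (@polyfun_ext_coord _ _ (fun u => joink (f u) (init (g u)))) => [b|]; last exact: Pg.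
by apply: IH => c; apply: polyfun_ext (Pg (lift ord_max c)) => u; rewrite mxE.
Qed.

Lemma initk_joink k v (u : 'rV[C]_k) : initk (joink v u) = v.
Proof. by elim: k u => //= k IH u; rewrite init_ext IH. Qed.

Lemma lastk_joink k v (u : 'rV[C]_k) : lastk (joink v u) = u.
Proof.
elim: k u => [|k IH] u /=; first by rewrite thinmx0.
by rewrite init_ext IH ext_last ext_init.
Qed.

(** The condition [beta] carries the induction: lifting the last coordinate requires that [beta1] is
    nonzero at the point below, and this is what the induction hypothesis is asked to provide. *)
Lemma eliminate k (W : set 'rV[C]_(k + m)) (beta : 'rV[C]_(k + m) -> C) :
  prime_set W -> polyfun beta -> (exists2 w, W w & beta w != 0) ->
  exists2 alpha : 'rV[C]_m -> C, polyfun alpha & (exists2 w, W w & alpha (initk w) != 0) /\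
   forall v, cl (@initk k @` W) v -> alpha v != 0 -> exists w, [/\ cl W w, initk w = v & beta w != 0].
Proof.
elim: k W beta => [|k IH] W beta prW Pbeta exb.
  exists beta => //; split=> // v cv bv; exists v; split=> // f Pf fW; apply: cv => // _ [w Ww <-].
  exact: fW.
have [beta1 Pbeta1 [[w Ww b1w] H1]] := eliminate_last prW Pbeta exb.
have prW1 : prime_set (@init (k + m) @` W).
  move=> f g Pf Pg fg;
  have := prW _ _ (polyfun_comp Pf (@polyfun_init _)) (polyfun_comp Pg (@polyfun_init _)).
  by case=> [u Wu|H|H]; [apply: fg; exists u|left=> _ [u Wu <-]; exact: H|right=> _ [u Wu <-]; exact: H].
have [|alpha Pa [[_ [u Wu <-] au] Ha]] := IH _ beta1 prW1 Pbeta1; first by exists (init w) => //; exists w.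
exists alpha => //; split; first by exists u.
move=> v cv av; have [|w1 [cw1 w1v bw1]] := Ha v _ av.
  by move=> f Pf fW; apply: cv => // _ [x Wx <-]; apply: fW; exists (init x) => //; exists x.
have [t [ct bt]] := H1 w1 cw1 bw1.
by exists (ext w1 t); rewrite /= init_ext.
Qed.

(** The parameters are eliminated from the graph of [psi]; as the graph is closed, a point of its
    closure is a point of the graph. *)
Theorem image_contains_open M (psi : 'rV[C]_M -> 'rV[C]_m) : (forall a, polyfun (fun u => psi u 0 a)) ->
  exists2 alpha : 'rV[C]_m -> C, polyfun alpha & (exists u, alpha (psi u) != 0) /\
   forall v, cl (range psi) v -> alpha v != 0 -> exists u, v = psi u.
Proof.
move=> Ppsi; pose W : set 'rV[C]_(M + m) := range (fun u => joink (psi u) u).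
have Pj f : polyfun f -> polyfun (fun u => f (joink (psi u) u)).
  by move=> Pf; apply: polyfun_comp Pf _ => a; apply: polyfun_joink => // b; exact: polyfun_coord.
have prW : prime_set W.
  move=> f g Pf Pg fg; apply: contrapT => /not_orP[Hf Hg].
  have ex (h : _ -> C) : ~ (forall w, W w -> h w = 0) -> exists u, h (joink (psi u) u) != 0.
    move=> H; apply: contrapT => /forallNP H'; apply: H => _ [u _ <-].
    by apply/eqP/negPn/negP/H'.
  have [u] := polyfun_prime (Pj _ Pf) (Pj _ Pg) (ex f Hf) (ex g Hg).
  by rewrite (fg (joink (psi u) u)) ?eqxx //; exists u.
have [|alpha Pa [[_ [u _ <-] au] Ha]] := @eliminate M W (fun=> 1) prW (polyfun_cst _ 1).
  by exists (joink (psi 0) 0); [exists 0 | exact: oner_neq0].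
exists alpha => //; split; first by exists u; rewrite initk_joink in au.
move=> v cv av; have [|w [cw wv _]] := Ha v _ av.
  move=> f Pf fW; apply: cv => // _ [x _ <-]; rewrite -(initk_joink (psi x) x).
  by apply: fW; exists (joink (psi x) x) => //; exists x.
exists (lastk w); apply/rowP => a; apply/eqP; rewrite -subr_eq0 -wv; apply/eqP.
apply: (cw (fun w => initk w 0 a - psi (lastk w) 0 a)).
  apply: polyfunD; first exact: polyfun_initk.
  apply: (@polyfun_ext _ _ (fun w => -1 * psi (lastk w) 0 a)) => [x|]; first by rewrite mulN1r.
  apply: polyfunM; first exact: polyfun_cst.
  exact: (polyfun_comp (Ppsi a) (@polyfun_lastk _)).
by move=> _ [x _ <-]; rewrite initk_joink lastk_joink subrr.
Qed.

End Several.
End Chevalley.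

(** * Algebraic independence and dimension *)

Section Exponents.
Variable R : realType.
Local Notation C := R[i].

(** Some increasing sequence of primes, not necessarily of consecutive ones. *)
Fixpoint nprime c := if c is c'.+1 then s2val (prime_above (nprime c')) else 2%N.

Lemma prime_nprime c : prime (nprime c).
Proof. by case: c => //= c; case: (prime_above _). Qed.

Lemma nprime_inj : injective nprime.
Proof.
have inc : {homo nprime : a b / (a < b)%N >-> (a < b)%N}.
  by apply: homo_ltn; [exact: ltn_trans | move=> c /=; case: (prime_above _)].
by move=> a b e; case: (ltngtP a b) => // /inc; rewrite e ltnn.
Qed.

(** Unique factorization. *)
Lemma node_inj n (mu nu : 'I_n -> nat) :
  (\prod_(c < n) nprime c ^ mu c = \prod_(c < n) nprime c ^ nu c)%N -> mu =1 nu.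
Proof.
have node_gt0 (la : 'I_n -> nat) (P : pred 'I_n) : (0 < \prod_(c < n | P c) nprime c ^ la c)%N.
  by apply: prodn_gt0 => c; rewrite expn_gt0 prime_gt0 ?prime_nprime.
have logE (la : 'I_n -> nat) (a : 'I_n) : logn (nprime a) (\prod_(c < n) nprime c ^ la c) = la a.
  rewrite (bigD1 a) //= lognM ?node_gt0 ?expn_gt0 ?(prime_gt0 (prime_nprime a)) //.
  rewrite lognX (logn_prime (nprime a) (prime_nprime a)) eqxx muln1.
  suff -> : logn (nprime a) (\prod_(c < n | c != a) nprime c ^ la c) = 0%N by rewrite addn0.
  apply/eqP; rewrite lognE prime_nprime node_gt0 /= Euclid_dvd_prod ?prime_nprime //.
  rewrite big1_seq // => c /andP[ca _]; rewrite Euclid_dvdX ?prime_nprime //.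
  rewrite dvdn_prime2 ?prime_nprime // (inj_eq nprime_inj) (inj_eq val_inj) eq_sym.
  by rewrite (negPf ca).
by move=> e a; rewrite -(logE mu a) e logE.
Qed.

(* At the points [(p_c ^ j)_c], with distinct primes [p_c], distinct monomials give a Vandermonde matrix. *)
Lemma monomials_independent n s (mu : 'I_s -> 'I_n -> nat) :
  (forall a b, mu a =1 mu b -> a = b) ->
  \matrix_(j < s, a < s) \prod_(c < n) ((nprime c)%:R ^+ j : C) ^+ mu a c \in unitmx.
Proof.
move=> inj; pose x : 'rV[C]_s := \row_a (\prod_(c < n) nprime c ^ mu a c)%N%:R.
have -> : \matrix_(j, a) \prod_(c < n) ((nprime c)%:R ^+ j : C) ^+ mu a c = Vandermonde s x.
  apply/matrixP => j a; rewrite !mxE natr_prod -prodrXl; apply: eq_bigr => c _.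
  by rewrite natrX -!exprM mulnC.
rewrite unitmxE unitfE det_Vandermonde; apply/prodf_neq0 => a _; apply/prodf_neq0 => b ab.
rewrite !mxE subr_eq0 eqr_nat; apply/eqP => /node_inj /inj e.
by rewrite e ltnn in ab.
Qed.

End Exponents.

(** * More polynomials than variables are algebraically dependent *)

Section Dependence.
Variable R : realType.
Local Notation C := R[i].

Lemma msizeM_bound n (f g : {mpoly C[n]}) a b :
  (msize f <= a.+1)%N -> (msize g <= b.+1)%N -> (msize (f * g) <= (a + b).+1)%N.
Proof.
move=> fa gb; have [->|f0] := eqVneq f 0; first by rewrite mul0r msize0.
have [->|g0] := eqVneq g 0; first by rewrite mulr0 msize0.
rewrite msizeM // -ltnS prednK ?addn_gt0 ?lt0n ?msize_poly_eq0 ?f0 //.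
by rewrite (leq_trans (leq_add fa gb)) // addSn addnS.
Qed.

Lemma msize_prod_bound n (I : Type) (r : seq I) (f : I -> {mpoly C[n]}) a :
  (forall i, msize (f i) <= a.+1)%N -> (msize (\prod_(i <- r) f i) <= (size r * a).+1)%N.
Proof.
move=> fa; elim: r => [|i r IH]; first by rewrite big_nil msize1.
by rewrite big_cons mulSn; exact: msizeM_bound.
Qed.

(** Count dimensions: the products of the [F a] with exponents below [s] outnumber the monomials in
    [N] variables with exponents below [K], so they satisfy a linear relation. It is a nonzero
    function because monomials are independent. *)
Lemma alg_dependent N t (F : 'rV[C]_N -> 'rV[C]_t) : (N < t)%N -> (forall a, polyfun (fun u => F u 0 a)) ->
  exists G : 'rV[C]_t -> C, [/\ polyfun G, exists y, G y != 0 & forall u, G (F u) = 0].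
Proof.
move=> Nt PF; have [f Hf] := choice PF.
pose dl := (\max_a msize (f a))%N.
have msf a : (msize (f a) <= dl.+1)%N by apply: leqW; rewrite /dl (bigD1 a) //= leq_maxl.
(* [K] bounds the degrees of the products, and K <= (t dl + 1) s gives K^N <= (t dl + 1)^N s^N <
   s^(N + 1) <= s^t. *)
pose s := ((t * dl).+1 ^ N).+1; pose K := (t * (s * dl)).+1.
pose P (mu : {ffun 'I_t -> 'I_s}) : {mpoly C[N]} := \prod_a f a ^+ mu a.
have msP mu : (msize (P mu) <= K)%N.
  have szt : size (enum 'I_t) = t by rewrite size_enum_ord.
  rewrite /P -big_enum /K -[X in (X * _)%N]szt; apply: msize_prod_bound => a.
  suff H k : (msize (f a ^+ k) <= (k * dl).+1)%N.
    by rewrite (leq_trans (H _)) // ltnS leq_mul2r ltnW ?orbT.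
  elim: k => [|k IH]; first by rewrite expr0 msize1.
  by rewrite exprS mulSn; exact: msizeM_bound.
pose M := \matrix_(a < #|{ffun 'I_t -> 'I_s}|, b < #|{ffun 'I_N -> 'I_K}|)
  (P (enum_val a))@_[multinom (enum_val b c : nat) | c < N].
have ltKs : (#|{ffun 'I_N -> 'I_K}| < #|{ffun 'I_t -> 'I_s}|)%N.
  rewrite !card_ffun !card_ord; apply: (@leq_trans (s ^ N.+1)%N); last by rewrite leq_pexp2l.
  apply: (@leq_ltn_trans ((t * dl).+1 ^ N * s ^ N)%N).
    rewrite -expnMn; case: (N) => [|N']; rewrite // leq_exp2r // /K mulnCA mulSn mulnC.
    by rewrite -addn1 addnC leq_add.
  by rewrite expnS ltn_mul2r ltnSn expn_gt0.
have [u u0 uM] : exists2 u : 'rV_#|{ffun 'I_t -> 'I_s}|, u != 0 & u *m M = 0.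
  have : kermx M != 0.
    rewrite -mxrank_eq0 mxrank_ker subn_eq0 -ltnNge.
    exact: leq_ltn_trans (rank_leq_col _) ltKs.
  by move=> /rowV0Pn[u /sub_kermxP uM u0]; exists u.
have uP : \sum_a u 0 a *: P (enum_val a) = 0.
  apply/mpolyP => nu; rewrite mcoeff0 raddf_sum /=.
  have [nuK|/existsNP[c nuc]] := pselect (forall c, nu c < K)%N.
    pose b := enum_rank [ffun c => Ordinal (nuK c)].
    have := congr1 (fun A : 'rV_ _ => A 0 b) uM; rewrite !mxE => uM0; rewrite -[RHS]uM0.
    apply: eq_bigr => a _; rewrite mcoeffZ mxE; congr (_ * _@__).
    by apply/mnmP => c; rewrite mnmE enum_rankK ffunE.
  rewrite big1 // => a _; rewrite mcoeffZ memN_msupp_eq0 ?mulr0 //.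
  apply/negP => /msize_mdeg_lt /leq_trans /(_ (msP _)); apply/negP; rewrite -leqNgt.
  by rewrite mdegE (bigD1 c) //= (leq_trans _ (leq_addr _ _)) // leqNgt; apply/negP.
exists (fun y => \sum_a u 0 a * \prod_(c < t) y 0 c ^+ (enum_val a : {ffun 'I_t -> 'I_s}) c); split.
- apply: polyfun_sum => a; apply: polyfunM; first exact: polyfun_cst.
  by apply: polyfun_prod => c; apply: polyfunX; exact: polyfun_coord.
- have := @monomials_independent R t #|{ffun 'I_t -> 'I_s}| (fun a c => (enum_val a : {ffun 'I_t -> 'I_s}) c).
  set A := (X in X \in unitmx); move=> uA.
  have inj (a b : 'I_#|{ffun 'I_t -> 'I_s}|) : (fun c => (enum_val a : {ffun 'I_t -> 'I_s}) c : nat) =1 (fun c => (enum_val b : {ffun 'I_t -> 'I_s}) c : nat) -> a = b.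
    by move=> e; apply: enum_val_inj; apply/ffunP => c; apply: val_inj; exact: e.
  have {}uA := uA inj; apply: contrapT => /forallNP H; case/eqP: u0.
  have : A *m u^T = 0.
    apply/matrixP => j z; rewrite !mxE.
    have := H (\row_c ((nprime c)%:R ^+ j)) => /negP; rewrite negbK => /eqP H0; rewrite -[RHS]H0.
    apply: eq_bigr => a _; rewrite !mxE mulrC ord1; congr (_ * _).
    by apply: eq_bigr => c _; rewrite mxE.
  by move=> /(congr1 (mulmx (invmx A))); rewrite mulKmx // mulmx0 => /(congr1 trmx); rewrite trmxK trmx0.
move=> v; transitivity ((\sum_a u 0 a *: P (enum_val a)).@[v 0]); last by rewrite uP meval0.
rewrite raddf_sum /=; apply: eq_bigr => a _; rewrite mevalZ rmorph_prod /=; congr (_ * _).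
by apply: eq_bigr => c _; rewrite rmorphXn /= Hf.
Qed.

End Dependence.

(** * Chains of irreducible sets and algebraic independence *)

Section Dimension.
Variables (R : realType) (m : nat).
Local Notation C := R[i].
Implicit Types (A Z : set 'rV[C]_m).

Definition algind Z t (F : 'rV[C]_m -> 'rV[C]_t) := forall G, polyfun G ->
  (forall z, Z z -> G (F z) = 0) -> forall y, G y = 0.

(** Take a relation between [F] and [f] on [Z']. Restricted to [Z] it loses all terms containing
    [f], so its constant coefficient is zero by independence on [Z]; as [Z'] is irreducible, [f] can
    be divided out and the argument repeated. *)
Lemma algind_step Z Z' t (F : 'rV[C]_m -> 'rV[C]_t) f : irreducible Z' -> Z `<=` Z' ->
  (forall a, polyfun (fun z => F z 0 a)) -> polyfun f -> (forall z, Z z -> f z = 0) ->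
  (exists2 z, Z' z & f z != 0) -> algind Z F -> algind Z' (fun z => ext (F z) (f z)).
Proof.
move=> irr ZZ' PF Pf fZ [z0 Zz0 fz0] ind G PG; have [g Hg] := polyfun_eval2P PG.
move=> GZ y; rewrite -(ext_init y) -Hg; move: (init y) (y 0 _) => v s.
have {GZ} : forall z, Z' z -> eval2 g (F z) (f z) = 0 by move=> z Zz; rewrite Hg GZ.
elim/poly_ind: g {G PG Hg y} v s => [|g a IH] v s gZ; first by rewrite /eval2 poly_at0.
have a0 (w : 'rV[C]_t) : mev w a = 0.
  apply: (ind (fun x : 'rV[C]_t => a.@[x 0]) _ _ w); first by exists a.
  by move=> z Zz; have := gZ z (ZZ' _ Zz); rewrite /eval2 !poly_atE (fZ z Zz) mulr0 add0r.
rewrite /eval2 !poly_atE a0 addr0 -/(eval2 _ _ _) IH ?mul0r // => z Zz.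
have Pg : polyfun (fun z => eval2 g (F z) (f z)).
  apply: (@polyfun_ext _ _ (fun z => eval2 g (init (ext (F z) (f z))) (ext (F z) (f z) 0 ord_max))) => [w|].
    by rewrite init_ext ext_last.
  by apply: (polyfun_comp (polyfun_eval2 g)) => b; exact: polyfun_ext_coord.
have [|H|H] := irreducible_polyfun irr Pg Pf; last by move: fz0; rewrite H ?eqxx.
  by move=> w Zw; have := gZ w Zw; rewrite /eval2 !poly_atE a0 addr0.
exact: H.
Qed.

Lemma algind_start Z : irreducible Z ->
  exists2 F : 'rV[C]_m -> 'rV[C]_1, (forall a, polyfun (fun z => F z 0 a)) & algind Z F.
Proof.
move=> [pZ [z Zz] _]; have [z0 cZ] := pZ z Zz; have /rV0Pn[a za] := z0.
exists (fun z => \row__ z 0 a) => [b|G PG GZ y].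
  by apply: polyfun_ext (polyfun_coord R a) => w; rewrite mxE.
have [q Hq] := polyfun_line 0 (\row__ z 0 a) PG.
have q0 : q = 0.
  apply: poly0_inf_neq0 => c c0; rewrite Hq add0r -[RHS](GZ _ (cZ c c0)).
  by congr G; apply/rowP => b; rewrite !mxE.
have := Hq (y 0 0 / z 0 a); rewrite q0 horner0 add0r => ->; congr G.
by apply/rowP => b; rewrite !mxE ord1 divfK.
Qed.

(** The sets are cones, so there is one function more than the length: a coordinate for the smallest
    set, then one equation for each strict inclusion. *)
Lemma chain_algind A k : irreducible_chain A k ->
  exists2 F : 'rV[C]_m -> 'rV[C]_k.+1, (forall a, polyfun (fun z => F z 0 a)) & algind A F.
Proof.
move=> [Z [irrZ ltZ]].
suff [F PF indF] : exists2 F : 'rV[C]_m -> 'rV[C]_k.+1, (forall a, polyfun (fun z => F z 0 a)) & algind (Z k) F.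
  exists F => // G PG GA; apply: indF => // z Zz; apply: GA.
  by move: Zz; have [_ clk] := irrZ k (leqnn k); rewrite clk => -[].
elim: k irrZ ltZ => [|k IH] irrZ ltZ.
  by apply: algind_start; case: (irrZ 0%N (leqnn 0)).
have [j /leqW|j /leqW|F PF indF] := IH; [exact: irrZ|exact: ltZ|].
have [sub nsub] := ltZ k (leqnn _).
have [irrk clk] := irrZ k (leqnSn k); have [irrk' clk'] := irrZ k.+1 (leqnn _).
have [z Zz nz] : exists2 z, Z k.+1 z & ~ Z k z.
  by apply: contrapT => H; apply: nsub => z Zz; apply: contrapT => nz; apply: H; exists z.
have [f [Pf fZ fz]] : exists f, [/\ polyfun f, forall z, Z k z -> f z = 0 & f z != 0].
  apply: contrapT => H; apply: nz; rewrite clk; split; first by move: Zz; rewrite clk' => -[].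
  split=> [|e G hG GZ]; first by case: irrk' => pZ _ _; case: (pZ z Zz).
  by apply/eqP/negPn/negP => Gz; apply: H; exists (fun v => G.@[v 0]); split=> //; exists G.
exists (fun z => ext (F z) (f z)); first by move=> a; exact: polyfun_ext_coord.
by apply: algind_step indF => //; exists z.
Qed.

(** Functions independent on [A] stay independent after pullback by the dense [rho], so there are at
    most [N] of them. *)
Lemma chain_bound A N (rho : 'rV[C]_N -> 'rV[C]_m) k : (forall a, polyfun (fun u => rho u 0 a)) ->
  (forall f, polyfun f -> (forall u, f (rho u) = 0) -> forall a, A a -> f a = 0) ->
  irreducible_chain A k -> (k < N)%N.
Proof.
move=> Prho dense /chain_algind[F PF indF]; rewrite ltnNge; apply/negP => Nk.
have PFr a : polyfun (fun u => F (rho u) 0 a) by exact: polyfun_comp (PF a) Prho.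
have [G [PG [y Gy] GF]] := alg_dependent (Nk : (N < k.+1)%N) PFr.
by case/eqP: Gy; apply: indF => // z Az; apply: (dense (fun z => G (F z))) => //; exact: polyfun_comp PG PF.
Qed.

Lemma dim_le A D : (forall k, irreducible_chain A k -> (k <= D)%N) -> (Defs.dim A <= D)%N.
Proof. by move=> H; rewrite /Defs.dim; case: xgetP => // k _ [/H]. Qed.

Lemma dim_ge A k : irreducible_chain A k -> (k <= Defs.dim A)%N.
Proof.
move=> ck; have bnd l : irreducible_chain A l -> (l <= m)%N.
  by move=> cl; apply: ltnW; apply: chain_bound cl => [a|f Pf f0 a _]; [exact: polyfun_coord | exact: f0].
have exk : exists l, `[< irreducible_chain A l >] by exists k; apply/asboolP.
have bnd' l : `[< irreducible_chain A l >] -> (l <= m)%N by move=> /asboolP /bnd.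
have [l /asboolP cl maxl] := ex_maxnP exk bnd'.
have : [set k | irreducible_chain A k /\ forall l, irreducible_chain A l -> (l <= k)%N] (Defs.dim A).
  by apply: xgetPex; exists l; split=> // j cj; apply: maxl; apply/asboolP.
by case=> _; apply.
Qed.

Lemma dim_chain A : (0 < Defs.dim A)%N -> irreducible_chain A (Defs.dim A).
Proof. by rewrite /Defs.dim; case: xgetP => // k _ []. Qed.

End Dimension.

(** * Multihomogeneous forms *)

Section Dot.
Variables (K : comNzRingType) (k : nat) (w : 'rV[K]_k).
Implicit Types (c : 'cV[K]_k).

Lemma dotD c c' : (w *m (c + c')) 0 0 = (w *m c) 0 0 + (w *m c') 0 0.
Proof. by rewrite mulmxDr mxE. Qed.
Lemma dotB c c' : (w *m (c - c')) 0 0 = (w *m c) 0 0 - (w *m c') 0 0.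
Proof. by rewrite mulmxBr [LHS]mxE [X in _ + X]mxE. Qed.
Lemma dotZ a c : (w *m (a *: c)) 0 0 = a * (w *m c) 0 0.
Proof. by rewrite -scalemxAr mxE. Qed.
End Dot.

Section Forms.
Variables (R : realType) (r : nat) (n : 'I_r -> nat).
Local Notation C := R[i].
Definition params := forall i : 'I_r, 'rV[C]_(n i).+1.
Implicit Types (p q : params) (f g : params -> C) (delta : 'I_r -> nat).

(** Multihomogeneous forms as functions: the coordinates of the Segre-Veronese map of multidegree
    [delta] are the monomials of that multidegree. *)
Definition mform delta f := exists c : 'cV[C]_#|{: multimonomial n delta}|,
  forall p, f p = (segre_veronese_map delta p *m c) 0 0.

Lemma mform_ext delta delta' f g : delta =1 delta' -> f =1 g -> mform delta f -> mform delta' g.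
Proof. by move=> /funext <- /funext <-. Qed.

Lemma mform0 delta : mform delta (fun=> 0).
Proof. by exists 0 => p; rewrite mulmx0 mxE. Qed.

Lemma mformD delta f g : mform delta f -> mform delta g -> mform delta (fun p => f p + g p).
Proof. by move=> [c Hc] [c' Hc']; exists (c + c') => p; rewrite Hc Hc' mulmxDr [RHS]mxE. Qed.

Lemma mformZ delta a f : mform delta f -> mform delta (fun p => a * f p).
Proof. by move=> [c Hc]; exists (a *: c) => p; rewrite Hc -scalemxAr [RHS]mxE. Qed.

Lemma mform_sum delta (I : Type) (s : seq I) (P : pred I) (f : I -> params -> C) :
  (forall a, mform delta (f a)) -> mform delta (fun p => \sum_(a <- s | P a) f a p).
Proof.
move=> H; elim: s => [|a s IH]; first by apply: mform_ext (mform0 delta) => // p; rewrite big_nil.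
case Pa: (P a).
  by apply: mform_ext (mformD (H a) IH) => // p; rewrite big_cons Pa.
by apply: mform_ext IH => // p; rewrite big_cons Pa.
Qed.

Lemma mform_mon delta (alpha : forall i, 'I_(n i).+1 -> nat) : (forall i, \sum_j alpha i j = delta i)%N ->
  mform delta (fun p => \prod_i \prod_j p i 0 j ^+ alpha i j).
Proof.
move=> da; have le i j : (alpha i j < (delta i).+1)%N by rewrite ltnS -da (bigD1 j) //= leq_addr.
have Pt i : (\sum_(a <- [tuple Ordinal (le i j) | j < (n i).+1]) (a : nat) == delta i)%N.
  by rewrite big_tuple; apply/eqP; rewrite -[RHS]da; apply: eq_bigr => j _; rewrite tnth_mktuple.
pose mu : multimonomial n delta := [ffun i => exist _ [tuple Ordinal (le i j) | j < (n i).+1] (Pt i)].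
exists (delta_mx (enum_rank mu) 0) => p.
rewrite -colE !mxE enum_rankK; apply: eq_bigr => i _; apply: eq_bigr => j _.
by rewrite ffunE /= tnth_mktuple.
Qed.

Lemma mform_ind (P : (params -> C) -> Prop) delta : 
  (forall f g, f =1 g -> P f -> P g) -> P (fun=> 0) ->
  (forall f g, P f -> P g -> P (fun p => f p + g p)) ->
  (forall a f, P f -> P (fun p => a * f p)) -> 
  (forall alpha : forall i, 'I_(n i).+1 -> nat, (forall i, \sum_j alpha i j = delta i)%N ->
     P (fun p => \prod_i \prod_j p i 0 j ^+ alpha i j)) ->
  forall f, mform delta f -> P f.
Proof.
move=> Pe P0 PD PZ PM f [c Hc].
apply: (Pe (fun p => \sum_k c k 0 * segre_veronese_map delta p 0 k)) => [p|].
  by rewrite Hc mxE; apply: eq_bigr => k _; rewrite mulrC.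
elim: index_enum => [|k s IH].
  by apply: Pe P0 => p; rewrite big_nil.
apply: (Pe (fun p => c k 0 * segre_veronese_map delta p 0 k + \sum_(k <- s) c k 0 * segre_veronese_map delta p 0 k)).
  by move=> p; rewrite big_cons.
apply: PD => //; apply: PZ; pose mu := enum_val k : multimonomial n delta.
apply: (Pe (fun p => \prod_i \prod_j p i 0 j ^+ tnth (val (mu i)) j)) => [p|]; first by rewrite mxE.
by apply: PM => i; have := valP (mu i); rewrite big_tuple => /eqP.
Qed.

Lemma mformM delta delta' f g : mform delta f -> mform delta' g ->
  mform (fun i => delta i + delta' i)%N (fun p => f p * g p).
Proof.
move=> Ff Fg; elim/mform_ind: Ff => [f1 f2 e|||a f1 IH|alpha da].
- by apply: mform_ext => // p; rewrite e.
- by apply: mform_ext (mform0 _) => // p; rewrite mul0r.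
- by move=> f1 f2 H1 H2; apply: mform_ext (mformD H1 H2) => // p; rewrite mulrDl.
- by apply: mform_ext (mformZ a IH) => // p; rewrite mulrA.
elim/mform_ind: Fg => [f1 f2 e|||a f1 IH|beta db].
- by apply: mform_ext => // p; rewrite e.
- by apply: mform_ext (mform0 _) => // p; rewrite mulr0.
- by move=> f1 f2 H1 H2; apply: mform_ext (mformD H1 H2) => // p; rewrite mulrDr.
- by apply: mform_ext (mformZ a IH) => // p; rewrite mulrCA.
apply: mform_ext (@mform_mon _ (fun i j => alpha i j + beta i j)%N _) => // [p|i].
  by rewrite -big_split; apply: eq_bigr => i _; rewrite -big_split; apply: eq_bigr => j _; rewrite exprD.
by rewrite big_split /= da db.
Qed.

(** The multidegree of a linear form on the factor [i]. *)
Definition eps (i k : 'I_r) : nat := (k == i).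

Lemma mform_coord i (j : 'I_(n i).+1) : mform (eps i) (fun p => p i 0 j).
Proof.
(* Indices of different factors have different types, hence the comparison of tagged pairs. *)
apply: mform_ext (@mform_mon _ (fun k l => (Tagged (fun k => 'I_(n k).+1) l == Tagged (fun k => 'I_(n k).+1) j)) _) => // [p|k].
  rewrite (bigD1 i) //= [X in _ * X]big1 ?mulr1 => [|k ki].
    rewrite (bigD1 j) //= eqxx expr1 big1 ?mulr1 // => l lj.
    by rewrite eq_Tagged (negPf lj).
  rewrite big1 // => l _; suff -> : (Tagged (fun k => 'I_(n k).+1) l == Tagged (fun k => 'I_(n k).+1) j) = false by [].
  by apply: contraNF ki => /eqP/(congr1 tag) /= ->.
rewrite /eps; have [->|ki] := eqVneq k i.
  rewrite (bigD1 j) //= eqxx big1 // => l lj; by rewrite eq_Tagged (negPf lj).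
rewrite big1 // => l _; suff -> : (Tagged (fun k => 'I_(n k).+1) l == Tagged (fun k => 'I_(n k).+1) j) = false by [].
by apply: contraNF ki => /eqP/(congr1 tag) /= ->.
Qed.

Lemma mform_lin i (a : 'cV[C]_(n i).+1) : mform (eps i) (fun p => (p i *m a) 0 0).
Proof.
apply: (@mform_ext (eps i) _ (fun p => \sum_j a j 0 * p i 0 j)) => // [p|].
  by rewrite mxE; apply: eq_bigr => j _; rewrite mulrC.
by apply: mform_sum => j; apply: mformZ; exact: mform_coord.
Qed.

Lemma mform_nonzero delta p : (forall i, p i != 0) -> exists2 f, mform delta f & f p != 0.
Proof.
move=> p0; have ex_j i : exists j, p i 0 j != 0 by apply/rV0Pn.
pose j i := xchoose (ex_j i); have Hj i : p i 0 (j i) != 0 by exact: (xchooseP (ex_j i)).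
exists (fun p => \prod_i \prod_k p i 0 k ^+ (if k == j i then delta i else 0)%N).
  apply: mform_mon => i; rewrite (bigD1 (j i)) //= eqxx big1 ?addn0 // => k /negPf -> //.
apply/prodf_neq0 => i _; apply/prodf_neq0 => k _.
by have [->|_] := eqVneq k (j i); [exact: expf_neq0 | rewrite expr0 oner_neq0].
Qed.

Lemma mform_local delta f p q i : mform delta f -> delta i = 0%N ->
  (forall k, k != i -> p k = q k) -> f p = f q.
Proof.
move=> [c Hc] d0 pq; rewrite !Hc; congr ((_ *m _) _ _); apply/rowP => k; rewrite !mxE.
apply: eq_bigr => l _; have [->|/pq -> //] := eqVneq l i.
set mu := (enum_val k : multimonomial n delta) i.
have mu0 j : tnth (val mu) j = 0%N :> nat.
  by apply/eqP; rewrite -leqn0 -[X in (_ <= X)%N]d0 -ltnS ltn_ord.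
by apply: eq_bigr => j _; rewrite mu0 !expr0.
Qed.

Lemma mform_homog delta f p q (c : 'I_r -> C) : mform delta f ->
  (forall k, q k = c k *: p k) -> f q = (\prod_k c k ^+ delta k) * f p.
Proof.
move=> Ff qp; elim/mform_ind: Ff => [f1 f2 e|||a f1 IH|alpha da].
- by rewrite !e.
- by rewrite mulr0.
- by move=> f1 f2 -> ->; rewrite mulrDr.
- by rewrite IH mulrCA.
rewrite -big_split; apply: eq_bigr => i _; rewrite -da -prodrXr -big_split /=.
by apply: eq_bigr => j _; rewrite qp !mxE exprMn.
Qed.

Lemma mform_entry delta k : mform delta (fun p => segre_veronese_map delta p 0 k).
Proof. by exists (delta_mx k 0) => p; rewrite -colE [RHS]mxE. Qed.

Lemma map_homog delta p q (c : 'I_r -> C) : (forall k, q k = c k *: p k) ->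
  segre_veronese_map delta q = (\prod_k c k ^+ delta k) *: segre_veronese_map delta p.
Proof.
move=> qp; apply/rowP => k; rewrite [RHS]mxE.
exact: (mform_homog (mform_entry k) qp).
Qed.

Lemma map_neq0 delta p : (forall i, p i != 0) -> segre_veronese_map delta p != 0.
Proof.
move=> p0; have [f [c Hc] fp] := mform_nonzero delta p0.
by apply: contraNneq fp => e; rewrite Hc e mul0mx mxE.
Qed.

Lemma map_eq0 delta p i : (0 < delta i)%N -> p i = 0 -> segre_veronese_map delta p = 0.
Proof.
move=> di pi; rewrite (@map_homog delta p p (fun k => if k == i then 0 else 1)).
  by rewrite (bigD1 i) //= eqxx expr0n gtn_eqF // mul0r scale0r.
by move=> k; have [->|_] := eqVneq; rewrite ?scale1r // pi scaler0.
Qed.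

Definition nparams := #|{: {i : 'I_r & 'I_(n i).+1}}|.
Definition params_of (u : 'rV[C]_nparams) : params :=
  fun i => \row_j u 0 (enum_rank (Tagged (fun i => 'I_(n i).+1) j)).
Definition of_params p : 'rV[C]_nparams :=
  \row_k p (tag (enum_val k)) 0 (tagged (enum_val k)).

Lemma of_paramsK p : params_of (of_params p) = p.
Proof. by apply: functional_extensionality_dep => i; apply/rowP => j; rewrite !mxE enum_rankK. Qed.

Lemma polyfun_params i j : polyfun (fun u => params_of u i 0 j).
Proof. by apply: polyfun_ext (polyfun_coord R (enum_rank (Tagged (fun i => 'I_(n i).+1) j))) => u; rewrite mxE. Qed.

Lemma polyfun_form delta f : mform delta f -> polyfun (fun u => f (params_of u)).
Proof.
elim/mform_ind => [f1 f2 e|||a f1 IH|alpha da].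
- by apply: polyfun_ext => u.
- exact: polyfun_cst.
- by move=> f1 f2; exact: polyfunD.
- by apply: polyfunM IH; exact: polyfun_cst.
by apply: polyfun_prod => i; apply: polyfun_prod => j; apply: polyfunX; exact: polyfun_params.
Qed.

Lemma polyfun_map delta k : polyfun (fun u => segre_veronese_map delta (params_of u) 0 k).
Proof. exact: (polyfun_form (mform_entry k)). Qed.

Lemma mform_line delta f p q : mform delta f ->
  exists s : {poly C}, forall t, s.[t] = f (fun i => p i + t *: q i).
Proof.
move=> /polyfun_form /(polyfun_line (of_params p) (of_params q))[s Hs]; exists s => t; rewrite Hs; congr f.
by apply: functional_extensionality_dep => i; apply/rowP => j; rewrite !mxE enum_rankK.
Qed.

End Forms.

(** * Tangent spaces and contact loci of Segre-Veronese varieties *)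

Lemma irreducible_polyfun_prod (R : realType) m (A : set 'rV[R[i]]_m) k (f : 'I_k -> 'rV[R[i]]_m -> R[i]) :
  irreducible A -> (forall j, polyfun (f j)) -> (forall a, A a -> \prod_j f j a = 0) ->
  exists j, forall a, A a -> f j a = 0.
Proof.
move=> irrA; elim: k f => [|k IH] f Pf fA.
  by case: irrA => _ [a Aa] _; have := fA a Aa; rewrite big_ord0 => /eqP; rewrite oner_eq0.
have [|H|H] := irreducible_polyfun irrA (Pf ord0) (polyfun_prod (index_enum 'I_k) xpredT (fun j => Pf (lift ord0 j))).
- by move=> a Aa; have := fA a Aa; rewrite big_ord_recl.
- by exists ord0.
by have [j Hj] := IH (fun j => f (lift ord0 j)) (fun j => Pf _) H; exists (lift ord0 j).
Qed.

Lemma mderivXU (K : comNzRingType) k (l j : 'I_k) : ('X_l : {mpoly K[k]})^`M(j) = (l == j)%:R.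
Proof.
rewrite mderivX mnm1E; case: eqP => [->|_]; last by rewrite scale0r.
by rewrite scale1r -mpolyX0; congr 'X_[_]; apply/mnmP => c; rewrite mnmBE subnn mnm0E.
Qed.

Section SegreVeronese.
Variables (R : realType) (r : nat) (n d : 'I_r -> nat).
Hypotheses (n_gt0 : forall i, (0 < n i)%N) (d_gt0 : forall i, (0 < d i)%N).
(** [i0] is the factor of degree 1 and [i1] the one whose forms of degree [e] separate points;
    [2 * e < d i1] leaves room for a linear form beside two separating forms. *)
Variables (i0 i1 : 'I_r) (e : nat).
Hypotheses (i10 : i1 != i0) (d0 : d i0 = 1%N) (d1 : (2 * e < d i1)%N).
Local Notation C := R[i].
Local Notation params := (params R n).
Local Notation X := (segre_veronese R n d).
Local Notation phi := (@segre_veronese_map R r n d).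
Local Notation mform := (@mform R r n).
Local Notation m := #|{: multimonomial n d}|.
Implicit Types (p q : params) (f g : params -> C).

Local Notation params_of := (@params_of R r n).

Definition nonzero p := forall i, p i != 0.

(** As [d i0 = 1], a scalar can be absorbed in the factor [i0]. *)
Lemma memX v : X v <-> exists2 p, nonzero p & v = phi p.
Proof.
split=> [[p [p0 [c c0 ->]]]|[p p0 ->]]; last by exists p; split=> //; exists 1; rewrite ?oner_neq0 ?scale1r.
exists (fun k => (if k == i0 then c else 1) *: p k) => [i|].
  by rewrite scaler_eq0 (negPf (p0 i)) orbF; case: ifP => // _; exact: oner_neq0.
rewrite [in RHS](@map_homog R r n d p _ (fun k => if k == i0 then c else 1)) //; congr (_ *: _).
rewrite (bigD1 i0) //= eqxx d0 expr1 big1 ?mulr1 // => k /negPf ->.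
by rewrite expr1n.
Qed.

Lemma polyfun_phi (f : 'rV[C]_m -> C) : polyfun f -> polyfun (fun u => f (phi (params_of u))).
Proof. by move=> Pf; apply: polyfun_comp Pf _ => k; exact: polyfun_map. Qed.

Definition ones : params := fun=> const_mx 1.

Lemma nonzero_coord0 p : \prod_i p i 0 0 != 0 -> nonzero p.
Proof. by move=> /prodf_neq0 H i; apply/rV0Pn; exists 0; exact: H. Qed.

Lemma X_dense (f : 'rV[C]_m -> C) : polyfun f -> (forall p, \prod_i p i 0 0 != 0 -> f (phi p) = 0) ->
  forall p, f (phi p) = 0.
Proof.
move=> Pf f0 p; apply/eqP/negPn/negP => fp.
have Pk : polyfun (fun u => \prod_i params_of u i 0 0 : C).
  by apply: polyfun_prod => i; exact: polyfun_params.
have [||u] := polyfun_prime (polyfun_phi Pf) Pk.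
- by exists (of_params p); rewrite of_paramsK.
- by exists (of_params ones); rewrite of_paramsK big1 ?oner_neq0 // => i _; rewrite mxE.
by rewrite mulf_eq0 negb_or => /andP[fu pu]; rewrite f0 ?eqxx in fu.
Qed.

Lemma map_polyfun_eq0 (f : 'rV[C]_m -> C) : polyfun f -> (forall v, X v -> f v = 0) -> forall p, f (phi p) = 0.
Proof.
move=> Pf fX; apply: X_dense => // p p0; apply: fX; apply/memX; exists p => //.
exact: nonzero_coord0.
Qed.

Definition coef f : 'cV[C]_m := xget 0 [set c | forall p, f p = (phi p *m c) 0 0].
(* The value of the functional [v] at the form [f] of multidegree [d]; junk when [f] is not such a form. *)
Definition pairing (v : 'rV[C]_m) f : C := (v *m coef f) 0 0.

Lemma pairing_phi f p : mform d f -> pairing (phi p) f = f p.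
Proof. by move=> Ff; rewrite /pairing /coef; case: xgetP => [c _ ->|/forallNP]. Qed.

Lemma polyfun_pairing f : polyfun (fun v => pairing v f).
Proof. exact: polyfun_lin. Qed.

Lemma pairing_sum (I : Type) (s : seq I) (v : I -> 'rV[C]_m) f : pairing (\sum_(j <- s) v j) f = \sum_(j <- s) pairing (v j) f.
Proof. by rewrite /pairing mulmx_suml summxE. Qed.

Lemma mformMd alpha beta A B : mform alpha A -> mform beta B -> (forall k, alpha k + beta k = d k)%N ->
  mform d (fun p => A p * B p).
Proof. by move=> FA FB ab; apply: mform_ext (mformM FA FB). Qed.

Definition linpoly (c : 'cV[C]_m) : {mpoly C[m]} := \sum_k c k 0 *: 'X_k.

Lemma linpolyE c (v : 'rV[C]_m) : (linpoly c).@[v 0] = (v *m c) 0 0.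
Proof. by rewrite mxE raddf_sum; apply: eq_bigr => k _; rewrite /= mevalZ mevalXU mulrC. Qed.

Lemma mderiv_linpoly c j : (linpoly c)^`M(j) = (c j 0)%:MP.
Proof.
rewrite raddf_sum /= (bigD1 j) //= mderivZ mderivXU eqxx big1 ?addr0 => [|k kj].
  by rewrite -mul_mpolyC mulr1.
by rewrite mderivZ mderivXU (negPf kj) scaler0.
Qed.

Lemma dhomog_linpoly c : linpoly c \is 1.-homog.
Proof. by apply: rpred_sum => k _; apply: rpredZ; rewrite dhomogX /= mdeg1. Qed.

(* The quadric [(AB)(A'B') = (AB')(A'B)] contains [X] and has gradient [(A'B')(p) AB] at [p]. *)
Lemma tangent_perp alpha beta A B p v : nonzero p -> mform alpha A -> mform beta B ->
  (forall k, alpha k + beta k = d k)%N -> A p = 0 -> B p = 0 ->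
  tangent_space X (phi p) v -> pairing v (fun p => A p * B p) = 0.
Proof.
move=> p0 FA FB ab Ap Bp tv.
have [A' FA' A'p] := mform_nonzero alpha p0; have [B' FB' B'p] := mform_nonzero beta p0.
have cE A1 B1 : mform alpha A1 -> mform beta B1 -> forall q, (phi q *m coef (fun q => A1 q * B1 q)) 0 0 = A1 q * B1 q.
  by move=> F1 F2 q; apply: (@pairing_phi (fun q => A1 q * B1 q)); exact: mformMd F1 F2 ab.
rewrite /pairing; set c1 := coef _ => /=.
pose c2 := coef (fun q => A' q * B' q); pose c3 := coef (fun q => A q * B' q).
pose c4 := coef (fun q => A' q * B q).
have := tv 2 (linpoly c1 * linpoly c2 - linpoly c3 * linpoly c4).
have hF : linpoly c1 * linpoly c2 - linpoly c3 * linpoly c4 \is 2.-homog.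
  by apply: rpredB; apply: (@dhomogM _ _ _ 1 _ 1); exact: dhomog_linpoly.
move=> /(_ hF) H.
have FX a : X a -> (linpoly c1 * linpoly c2 - linpoly c3 * linpoly c4).@[a 0] = 0.
  by case/memX => q _ ->; rewrite mevalB !mevalM !linpolyE !cE //; ring.
have {H FX} := H FX.
under eq_bigr => j _ do rewrite mderivB !mderivM !mderiv_linpoly mevalB !mevalD !mevalM !linpolyE !mevalC !cE // Ap Bp !(mul0r, mulr0, addr0, subr0, add0r).
rewrite (eq_bigr (fun j => (A' p * B' p) * (v 0 j * c1 j 0))) => [|j _]; last by ring.
rewrite -mulr_sumr => /eqP; rewrite !mulf_eq0 (negPf A'p) (negPf B'p) /= => /eqP; by rewrite mxE.
Qed.

(** Chain rule along a polynomial curve. *)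
Lemma mpoly_curve (k : nat) (F : {mpoly C[k]}) (Q : 'I_k -> {poly C}) :
  exists2 g : {poly C}, (forall t, g.[t] = F.@[fun a => (Q a).[t]]) &
    g^`().[0] = \sum_j F^`M(j).@[fun a => (Q a).[0]] * (Q j)^`().[0].
Proof.
elim/mpoly_ring_ind: F => [c|j|F G [f Hf Hf'] [g Hg Hg']|F G [f Hf Hf'] [g Hg Hg']].
- exists c%:P => [t|]; first by rewrite hornerC mevalC.
  by rewrite derivC horner0 big1 // => j _; rewrite mderivC meval0 mul0r.
- exists (Q j) => [t|]; first by rewrite mevalXU.
  rewrite (bigD1 j) //= big1 ?addr0 => [|l lj].
    by rewrite mderivXU eqxx meval1 mul1r.
  by rewrite mderivXU eq_sym (negPf lj) meval0 mul0r.
- exists (f + g) => [t|]; first by rewrite hornerD Hf Hg mevalD.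
  rewrite derivD hornerD Hf' Hg' -big_split; apply: eq_bigr => j _ /=.
  by rewrite mderivD mevalD mulrDl.
exists (f * g) => [t|]; first by rewrite hornerM Hf Hg mevalM.
rewrite derivM hornerD !hornerM Hf' Hg' Hf Hg mulr_suml mulr_sumr -big_split; apply: eq_bigr => j _ /=.
by rewrite mderivM mevalD !mevalM mulrDl mulrAC mulrA.
Qed.

(** [tau] is the velocity at 0 of the curve t -> phi(p + t q), on which all equations of [X]
    vanish. *)
Lemma tangent_mem p q : exists2 tau, tangent_space X (phi p) tau &
  forall f (s : {poly C}), mform d f -> (forall t, s.[t] = f (fun i => p i + t *: q i)) ->
    pairing tau f = s^`().[0].
Proof.
have [Q HQ] := choice (fun k => mform_line p q (@mform_entry R r n d k)).
exists (\row_k (Q k)^`().[0]) => [E F hF FX|f s Ff Hs].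
  have [g Hg Hg'] := mpoly_curve F Q.
  have Q0 : (fun a => (Q a).[0]) = (phi p) 0.
    apply: functional_extensionality_dep => a; rewrite HQ; congr (segre_veronese_map _ _ _ _).
    by apply: functional_extensionality_dep => i; rewrite scale0r addr0.
  rewrite Q0 in Hg'; under eq_bigr do rewrite mxE.
  rewrite -Hg' (_ : g = 0) ?deriv0 ?horner0 //.
  apply: poly0_inf => t; rewrite Hg.
  have -> : (fun a => (Q a).[t]) = phi (fun i => p i + t *: q i) 0.
    by apply: functional_extensionality_dep => a; rewrite HQ.
  by apply: (map_polyfun_eq0 (f := fun v => F.@[v 0])) => //; exists F.
rewrite /pairing mxE; have -> : s = \sum_k coef f k 0 *: Q k.
  apply/eqP; rewrite -subr_eq0; apply/eqP/poly0_inf => t; rewrite hornerD hornerN Hs -(pairing_phi _ Ff).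
  rewrite /pairing mxE horner_sum; apply/eqP; rewrite subr_eq0; apply/eqP.
  by apply: eq_bigr => k _; rewrite hornerZ HQ mulrC.
rewrite raddf_sum horner_sum; apply: eq_bigr => k _ /=.
by rewrite derivZ hornerZ mxE mulrC.
Qed.


Definition separated h (p : 'I_h -> params) := exists H : 'I_h -> params -> C,
  (forall j, mform (fun k => e * eps i1 k)%N (H j)) /\ forall j k, H j (p k) = (j == k)%:R.

Definition good h (p : 'I_h -> params) := separated p /\ forall j, nonzero (p j).

Lemma span_pairing h (p : 'I_h -> params) (x : 'M[C]_(h, m)) f v :
  (forall j, row j x = phi (p j)) ->
  (forall j tau, tangent_space X (phi (p j)) tau -> pairing tau f = 0) ->
  span_tangent_spaces X x v -> pairing v f = 0.
Proof.
move=> xp Hf [u Hu ->]; rewrite pairing_sum big1 // => j _.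
by apply: Hf; rewrite -xp.
Qed.

(** On an irreducible set one of two factors vanishes, and [Q] does not vanish at [p]. To become
    functions of the ambient vector, [l] and [Q] are first multiplied up to multidegree [d], by
    forms nonzero at [q] and at [p]. *)
Lemma vanish_on_component (B : set 'rV[C]_m) p (l Q : params -> C) (dl dQ : 'I_r -> nat) : irreducible B -> B `<=` X ->
  nonzero p -> B (phi p) -> mform dl l -> mform dQ Q -> (forall k, dl k <= d k)%N -> (forall k, dQ k <= d k)%N ->
  Q p != 0 -> (forall q, nonzero q -> B (phi q) -> l q * Q q = 0) ->
  forall q, nonzero q -> B (phi q) -> l q = 0.
Proof.
move=> irrB BX p0 Bp Fl FQ led ledQ Qp lQ q q0 Bq.
have [W FW Wp] := mform_nonzero (fun k => d k - dQ k)%N p0.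
have [V FV Vq] := mform_nonzero (fun k => d k - dl k)%N q0.
have FlV : mform d (fun p => l p * V p) by apply: mformMd Fl FV _ => k; rewrite subnKC.
have FQW : mform d (fun p => Q p * W p) by apply: mformMd FQ FW _ => k; rewrite subnKC.
have [a Ba|H|H] := irreducible_polyfun irrB (polyfun_pairing (fun p => l p * V p)) (polyfun_pairing (fun p => Q p * W p)).
- have /memX[q' q'0 aq] := BX _ Ba; rewrite aq !pairing_phi //.
  by rewrite mulrACA lQ ?mul0r // -aq.
- by have := H _ Bq; rewrite pairing_phi // => /eqP; rewrite mulf_eq0 (negPf Vq) orbF => /eqP.
have := H _ Bp; rewrite pairing_phi // => /eqP; rewrite mulf_eq0 (negPf Qp) => /eqP Wp0.
by rewrite Wp0 eqxx in Wp.
Qed.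

Lemma ker_row k (u : 'rV[C]_k.+1) : (0 < k)%N -> exists2 a : 'cV[C]_k.+1, a != 0 & (u *m a) 0 0 = 0.
Proof.
move=> k0; have : cokermx u != 0.
  rewrite -mxrank_eq0 mxrank_coker subn_eq0 -ltnNge.
  by apply: leq_ltn_trans (rank_leq_row _) _.
rewrite -trmx_eq0 => /rowV0Pn[a /submxP[D Da] a0]; exists a^T; first by rewrite trmx_eq0.
by rewrite -[a^T]trmxK trmxK Da trmx_mul trmxK mulmxA mulmx_coker mul0mx mxE.
Qed.

Lemma proportional k (u v : 'rV[C]_k) : (forall a : 'cV[C]_k, (u *m a) 0 0 = 0 -> (v *m a) 0 0 = 0) ->
  exists c, v = c *: u.
Proof.
move=> H; apply/sub_rVP; rewrite submxE; apply/eqP/rowP => j.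
have u0 : u *m col j (cokermx u) = 0 by rewrite colE mulmxA mulmx_coker mul0mx.
have := H (col j (cokermx u)); rewrite u0 mxE => /(_ erefl) => v0; rewrite [RHS]mxE -[RHS]v0 !mxE.
by apply: eq_bigr => l _; rewrite [in RHS]mxE.
Qed.

Section Component.
Variables (h : nat) (p : 'I_h -> params) (x : 'M[C]_(h, m)) (B : set 'rV[C]_m) (j : 'I_h).
Hypotheses (gp : good p) (xp : forall k, row k x = phi (p k)).
Hypotheses (irrB : irreducible B) (BT : B `<=` tangency_locus X x) (Bj : B (phi (p j))).

Let BX : B `<=` X. Proof. by move=> y /BT[]. Qed.

Let direction i (w : 'rV[C]_(n i).+1) : params := @eqtype.dfwith 'I_r (fun k => 'rV[C]_(n k).+1) (fun k => 0) i w.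

Let direction_in i w : direction w i = w. Proof. by rewrite /direction eqtype.dfwith_in. Qed.
Let direction_out i (w : 'rV[C]_(n i).+1) k : k != i -> direction w k = 0.
Proof. by move=> ki; rewrite /direction eqtype.dfwith_out // eq_sym. Qed.

Let lin i (a : 'cV[C]_(n i).+1) : params -> C := fun q => (q i *m a) 0 0.

Let lin_move i (a : 'cV[C]_(n i).+1) k (w : 'rV[C]_(n k).+1) q t :
  lin a (fun l => q l + t *: direction w l) = lin a q + t * lin a (direction w).
Proof. by rewrite /lin mulmxDl -scalemxAl !mxE. Qed.

Let lin_out i (a : 'cV[C]_(n i).+1) k (w : 'rV[C]_(n k).+1) : i != k -> lin a (direction w) = 0.
Proof. by move=> ik; rewrite /lin direction_out // mul0mx mxE. Qed.

Let dual_dir i (a : 'cV[C]_(n i).+1) : a != 0 -> exists w : 'rV[C]_(n i).+1, lin a (direction w) != 0.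
Proof.
rewrite -trmx_eq0 => /rV0Pn[k]; rewrite mxE => ak; exists (delta_mx 0 k).
by rewrite /lin direction_in -rowE mxE.
Qed.

(** Both [lin a * H j] and [lin b * (H j * S)] vanish at all points: at [p j] by [a] and [b], at the
    others by [H j]. Their product thus kills the tangent spaces along [B], and its derivatives in
    one factor at a time isolate first [b], then [a]. *)
Lemma component_linear i (a : 'cV[C]_(n i0).+1) (b : 'cV[C]_(n i).+1) : i != i0 -> a != 0 -> b != 0 ->
  lin a (p j) = 0 -> lin b (p j) = 0 -> forall q, nonzero q -> B (phi q) -> lin a q = 0 /\ lin b q = 0.
Proof.
move=> ii0 a0 b0 apj bpj; case: gp => [[H [FH Hp]] p0].
(* [S] fills up the multidegree. For [i = i1] the other forms already have degree [2 * e + 1]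
   there. *)
pose dS k := (d k - (eps i0 k + eps i k + 2 * (e * eps i1 k)))%N.
have dSE k : (eps i0 k + eps i k + 2 * (e * eps i1 k) + dS k = d k)%N.
  rewrite subnKC // /eps; have [->|ki0] := eqVneq k i0.
    by rewrite d0 eq_sym (negPf ii0) eq_sym (negPf i10) !muln0.
  have [->|ki1] := eqVneq k i1.
    by rewrite muln1; apply: leq_trans d1; rewrite add0n -[X in (_ <= X)%N]add1n leq_add2r leq_b1.
  by rewrite !muln0 addn0 add0n; apply: leq_trans (leq_b1 _) (d_gt0 k).
have dG0 : (e * eps i1 i0 + (eps i i0 + (e * eps i1 i0 + dS i0)) = 0)%N.
  have z1 : eps i1 i0 = 0%N by rewrite /eps eq_sym (negPf i10).
  have zi : eps i i0 = 0%N by rewrite /eps eq_sym (negPf ii0).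
  by rewrite /dS z1 zi {1}/eps eqxx d0 !muln0.
have [S FS Sp] := mform_nonzero dS (p0 j).
pose Q q := H j q * (H j q * S q).
have FHS := mformM (FH j) FS; have FQ := mformM (FH j) FHS.
have Qp : Q (p j) != 0 by rewrite /Q Hp eqxx !mul1r.
have FA := mformM (mform_lin a) (FH j); have FB := mformM (mform_lin b) FHS.
have key y tau : B y -> tangent_space X y tau ->
    pairing tau (fun q => (lin a q * H j q) * (lin b q * (H j q * S q))) = 0.
  move=> By ty; apply: (span_pairing xp) => [k|]; last by case: (BT By) => _; apply.
  have vA : lin a (p k) * H j (p k) = 0 by rewrite Hp; case: eqP => [<-|_]; rewrite ?apj ?mul0r ?mulr0.
  have vB : lin b (p k) * (H j (p k) * S (p k)) = 0.
    by rewrite Hp; case: eqP => [<-|_]; rewrite ?bpj ?mul0r ?mulr0.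
  move=> t; apply: (tangent_perp (p0 k) FA FB) => // l; rewrite -(dSE l); ring.
have FAB : mform d (fun q => (lin a q * H j q) * (lin b q * (H j q * S q))).
  by apply: mformMd FA FB _ => l; rewrite -(dSE l); ring.
have dQ k : (e * eps i1 k + (e * eps i1 k + dS k) <= d k)%N by rewrite -(dSE k); lia.
have dl k l : (eps k l <= d l)%N by apply: leq_trans (leq_b1 _) (d_gt0 l).
pose G q := H j q * (lin b q * (H j q * S q)).
have FG := mformM (FH j) FB.
(* Only the factor [i0] moves. [G] has degree 0 in it, so the derivative is
   [lin a (direction w) * G q]. *)
have bQ q : nonzero q -> B (phi q) -> lin b q * Q q = 0.
  move=> q0 Bq; have [w aw] := dual_dir a0.
  have [tau ttau Htau] := tangent_mem q (direction w).
  have := key _ _ Bq ttau.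
  rewrite (Htau _ ((lin a q)%:P * (G q)%:P + (lin a (direction w) * G q) *: 'X)) // => [|t].
    rewrite derivD derivZ derivX -polyCM derivC add0r hornerZ hornerC mulr1 => /eqP.
    rewrite mulf_eq0 (negPf aw) /= /G mulrCA => /eqP <-.
    by rewrite /Q.
  pose mv : params := fun l => q l + t *: direction w l.
  transitivity (lin a mv * G mv); last by rewrite /G mulrA.
  have <- : G q = G mv.
    by apply: (mform_local FG dG0) => k ki; rewrite /mv direction_out // scaler0 addr0.
  rewrite lin_move hornerD hornerM hornerZ hornerX !hornerC; ring.
have b_q : forall q, nonzero q -> B (phi q) -> lin b q = 0.
  exact: (vanish_on_component irrB BX (p0 j) Bj (mform_lin b) FQ (dl i) dQ Qp bQ).
(* Now the factor [i] moves. Since [lin b q = 0], the product rule leaves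
   [lin a q * lin b (direction w) * Q q]. *)
have aQ q : nonzero q -> B (phi q) -> lin a q * Q q = 0.
  move=> q0 Bq; have [w bw] := dual_dir b0.
  have [tau ttau Htau] := tangent_mem q (direction w).
  have [s Hs] := mform_line q (direction w) FQ.
  have := key _ _ Bq ttau.
  rewrite (Htau _ ('X * ((lin a q * lin b (direction w)) *: s))) // => [|t].
    rewrite derivM derivX mul1r hornerD hornerM hornerX mul0r addr0 hornerZ Hs => /eqP.
    rewrite mulf_eq0 mulf_eq0 (negPf bw) orbF -mulf_eq0 => /eqP <-.
    congr (_ * Q _); apply: functional_extensionality_dep => k; by rewrite scale0r addr0.
  rewrite hornerM hornerX hornerZ Hs !lin_move (b_q q q0 Bq) add0r (lin_out a) 1?eq_sym // mulr0 addr0 /Q; ring.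
move=> q q0 Bq; split; last exact: b_q.
exact: (vanish_on_component irrB BX (p0 j) Bj (mform_lin a) FQ (dl i0) dQ Qp aQ).
Qed.

(** In each factor, every linear form vanishing at [p j] vanishes at [q]: pair it with such a form
    on [i0], or on [i1] if its own factor is [i0]. *)
Lemma component_point y : B y -> exists c, y = c *: phi (p j).
Proof.
move=> By; have [q q0 yq] := (iffLR (memX y)) (BX By); rewrite yq in By *.
have lin0 i (a : 'cV[C]_(n i).+1) : lin a (p j) = 0 -> lin a q = 0.
  have [->|a0] := eqVneq a 0; first by rewrite /lin !mulmx0.
  have [b b0 bp] := ker_row (p j i0) (n_gt0 i0); have [b' b'0 b'p] := ker_row (p j i1) (n_gt0 i1).
  have [ei ap|ii0 ap] := eqVneq i i0; last by case: (component_linear ii0 b0 a0 bp ap q0 By).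
  by move: a a0 ap; rewrite ei => a a0 ap; case: (component_linear i10 a0 b'0 ap b'p q0 By).
have /choice[c Hc] : forall i, exists c, q i = c *: p j i by move=> i; apply: proportional => a; exact: lin0.
by exists (\prod_k c k ^+ d k); exact: map_homog.
Qed.

End Component.

(** The contact locus lies in the closure of a subset of finitely many points, so an irreducible
    component is a single one of them. *)
Lemma contact_component_dim h (p : 'I_h -> params) (x : 'M[C]_(h, m)) B : good p ->
  (forall j, row j x = phi (p j)) -> irreducible_component (contact_locus X x) B -> ~ (0 < Defs.dim B)%N.
Proof.
move=> gp xp [irrB + _]; rewrite /contact_locus; set T := (Y in zariski_closure Y) => BC.
have Tp v : T v -> v != 0 /\ exists j c, v = c *: phi (p j).
  move=> [B0 [[irr0 B0T _] [j Bj] B0v]]; split; first by case: irr0 => pB _ _; case: (pB v B0v).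
  rewrite xp in Bj; exists j; exact: (component_point gp xp irr0 B0T Bj).
have pT : projective_set T.
  move=> v [B0 [cB0 Bj B0v]]; have [[pB _ _] _ _] := cB0; have [v0 cv] := pB v B0v.
  by split=> // c c0; exists B0; split=> //; exact: cv.
(* Otherwise each point has an equation that is not zero on [B], while the product of these
   equations vanishes on the contact locus. *)
have [j Hj] : exists j, forall v, B v -> exists c, v = c *: phi (p j).
  apply: contrapT => /forallNP H.
  have ex_a j : exists a, ~ forall v, B v -> (v *m cokermx (phi (p j))) 0 a = 0.
    apply: contrapT => /forallNP H'; apply: (H j) => v Bv; apply/sub_rVP; rewrite submxE.
    apply/eqP/rowP => a; rewrite [RHS]mxE; have /contrapT := H' a; exact.
  have [a Ha] := choice ex_a.
  pose f j (v : 'rV[C]_m) := (v *m cokermx (phi (p j))) 0 (a j).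
  have Pf j : polyfun (f j).
    apply: (@polyfun_ext _ _ (fun v => (v *m col (a j) (cokermx (phi (p j)))) 0 0)) => [v|].
      by rewrite /f !mxE; apply: eq_bigr => l _; rewrite mxE.
    exact: polyfun_lin.
  have [v /BC[_ cv]|j Hj] := irreducible_polyfun_prod irrB Pf; last exact: Ha Hj.
  apply: (closure_polyfun (f := fun v => \prod_j f j v) pT _ _ cv); first exact: polyfun_prod.
  move=> w /Tp[_ [j [c ->]]]; apply/eqP; rewrite prodf_seq_eq0; apply/hasP; exists j; rewrite ?mem_index_enum //=.
  by rewrite /f -scalemxAl mulmx_coker scaler0 mxE.
move=> dB; have [Z [irrZ ltZ]] := dim_chain dB.
have [sub nsub] := ltZ 0%N dB; have [[pZ0 [z Zz] _] _] := irrZ 0%N (leq0n _).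
have [[pZ1 _ _] cZ1] := irrZ 1%N dB; apply: nsub => z' Z1z'.
have inB w : Z 1%N w -> B w by rewrite cZ1 => -[].
have [c zc] := Hj _ (inB _ (sub _ Zz)); have [c' zc'] := Hj _ (inB _ Z1z').
have [z0 cZ] := pZ0 _ Zz; have [z'0 _] := pZ1 _ Z1z'.
have c0 : c != 0 by apply: contraNneq z0 => c0; rewrite zc c0 scale0r.
have c'0 : c' != 0 by apply: contraNneq z'0 => c'0; rewrite zc' c'0 scale0r.
have -> : z' = (c' / c) *: z by rewrite zc zc' scalerA divfK.
by apply: cZ; rewrite mulf_neq0 ?invr_eq0.
Qed.

(** * Tuples of points and their parameters *)

Definition tuple_params h (u : 'rV[C]_(h * nparams n)) : 'I_h -> params :=
  fun j => params_of (row j (vec_mx u)).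

Definition of_tuple_params h (p : 'I_h -> params) : 'rV[C]_(h * nparams n) :=
  mxvec (\matrix_j of_params (p j)).

Lemma of_tuple_paramsK h (p : 'I_h -> params) : tuple_params (of_tuple_params p) = p.
Proof.
by apply: functional_extensionality_dep => j; rewrite /tuple_params mxvecK rowK of_paramsK.
Qed.

Lemma polyfun_row h k (j : 'I_h) (f : 'rV[C]_k -> C) : polyfun f ->
  polyfun (fun u : 'rV_(h * k) => f (row j (vec_mx u))).
Proof.
move=> Pf; apply: polyfun_comp Pf _ => a.
by apply: polyfun_ext (polyfun_coord R (mxvec_index j a)) => u; rewrite !mxE.
Qed.

Lemma polyfun_tuple_form h delta f (j : 'I_h) : mform delta f -> polyfun (fun u => f (tuple_params u j)).
Proof. by move=> /polyfun_form; exact: polyfun_row. Qed.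

Lemma polyfun_tuple_phi h k (j : 'I_h) : polyfun (fun u => phi (tuple_params u j) 0 k).
Proof. exact: (polyfun_tuple_form j (@mform_entry R r n d k)). Qed.

Definition map_rows h (p : 'I_h -> params) : 'M[C]_(h, m) := \matrix_j phi (p j).

Lemma polyfun_rows h (f : 'rV[C]_(h * m) -> C) : polyfun f ->
  polyfun (fun u => f (mxvec (map_rows (@tuple_params h u)))).
Proof.
move=> Pf; apply: polyfun_comp Pf _ => k; case/mxvec_indexP: k => j k.
by apply: polyfun_ext (polyfun_tuple_phi k j) => u; rewrite mxvecE [RHS]mxE.
Qed.

Lemma tuple_of_pointsP h (x : 'M[C]_(h, m)) : tuple_of_points X x ->
  exists2 p : 'I_h -> params, (forall j, nonzero (p j)) & x = map_rows p.
Proof.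
move=> Xx; have ex_p j : exists p, nonzero p /\ row j x = phi p by have /memX[p p0 xp] := Xx j; exists p.
have [p Hp] := choice ex_p; exists p => [j|]; first by case: (Hp j).
by apply/row_matrixP => j; rewrite rowK; case: (Hp j).
Qed.

Lemma points_map_rows h (p : 'I_h -> params) : (forall j, nonzero (p j)) -> tuple_of_points X (map_rows p).
Proof. by move=> p0 j; rewrite rowK; apply/memX; exists (p j). Qed.

Lemma polyfun_tuple_nonzero h : exists g : 'rV[C]_(h * nparams n) -> C,
  [/\ polyfun g, exists u, g u != 0 & forall u, g u != 0 -> forall j, nonzero (tuple_params u j)].
Proof.
exists (fun u => \prod_j \prod_i tuple_params u j i 0 0); split.
- apply: polyfun_prod => j; apply: polyfun_prod => i.
  exact: (polyfun_tuple_form j (@mform_coord R r n i 0)).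
- exists (of_tuple_params (fun=> ones)); rewrite of_tuple_paramsK.
  by apply/prodf_neq0 => j _; apply/prodf_neq0 => i _; rewrite mxE oner_eq0.
by move=> u /prodf_neq0 H j; apply: nonzero_coord0; exact: H.
Qed.

(** The parameter space is irreducible, so the nonvanishing loci of [g], of the polynomial
    expressing generality and of the first coordinates have a common point. *)
Lemma for_general_params h (P : 'M[C]_(h, m) -> Prop) (g : 'rV[C]_(h * nparams n) -> C) :
  for_general X P -> polyfun g -> (exists u, g u != 0) ->
  exists2 u, g u != 0 & (forall j, nonzero (tuple_params u j)) /\ P (map_rows (tuple_params u)).
Proof.
move=> [F [[x /tuple_of_pointsP[p p0 ->] Fx] FP]] Pg g0.
have PF : polyfun (fun v : 'rV[C]_(h * m) => F.@[v 0]) by exists F.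
have [k [Pk k0 kn]] := polyfun_tuple_nonzero h.
have [||u0 gk] := polyfun_prime Pg Pk; [by []|by []|].
have [||u] := polyfun_prime (polyfunM Pg Pk) (polyfun_rows PF); first by exists u0.
  by exists (of_tuple_params p); rewrite of_tuple_paramsK.
rewrite !mulf_eq0 !negb_or => /andP[/andP[gu ku] Fu]; exists u => //.
by split; [exact: kn | apply: FP => //; apply: points_map_rows; exact: kn].
Qed.

Lemma separated_det h (A : 'I_h -> params -> C) (p : 'I_h -> params) :
  (forall a, mform (fun k => e * eps i1 k)%N (A a)) -> \det (\matrix_(j, a) A a (p j)) != 0 -> separated p.
Proof.
set E := \matrix_(j, a) _; move=> FA dE; have uE : E \in unitmx by rewrite unitmxE unitfE.
exists (fun j q => \sum_a invmx E a j * A a q); split=> [j|j k].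
  apply: mform_sum => a. exact: (mformZ (invmx E a j) (FA a)).
have := congr1 (fun M : 'M_h => M k j) (mulmxV uE); rewrite !mxE eq_sym => <-.
by apply: eq_bigr => a _; rewrite mxE mulrC.
Qed.

Lemma polyfun_tuple_det h delta k (A : 'I_h -> params -> C) (s : 'I_h -> 'I_k) :
  (forall a, mform delta (A a)) -> polyfun (fun u => \det (\matrix_(j, a) A a (tuple_params u (s j)))).
Proof.
move=> FA; apply: polyfun_det => j a.
by apply: polyfun_ext (polyfun_tuple_form (s j) (FA a)) => u; rewrite mxE.
Qed.

Theorem not_tangentially_weakly_defective h (A : 'I_h -> params -> C) (p : 'I_h -> params) :
  (forall a, mform (fun k => e * eps i1 k)%N (A a)) -> \det (\matrix_(j, a) A a (p j)) != 0 ->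
  ~ tangentially_weakly_defective X h.
Proof.
move=> FA dA twd; have [|u gu [u0 [B cB dB]]] := for_general_params twd (polyfun_tuple_det id FA).
  by exists (of_tuple_params p); rewrite of_tuple_paramsK.
apply: (contact_component_dim (p := tuple_params u) _ _ cB dB); last by move=> j; rewrite rowK.
by split=> //; exact: separated_det gu.
Qed.

(** * Identifiability *)

Lemma dual_forms h (p : 'I_h -> params) delta : good p -> (forall k, e * eps i1 k <= delta k)%N ->
  exists2 K : 'I_h -> params -> C, forall j, mform delta (K j) & forall j k, K j (p k) = (j == k)%:R.
Proof.
move=> [[H [FH Hp]] p0] led.
have ex_S j : exists S, mform (fun k => delta k - e * eps i1 k)%N S /\ S (p j) != 0.
  by have [S FS Sp] := mform_nonzero (fun k => delta k - e * eps i1 k)%N (p0 j); exists S.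
have [S HS] := choice ex_S.
exists (fun j q => (S j (p j))^-1 * (H j q * S j q)) => [j|j k].
  apply: mformZ; have [FS _] := HS j.
  by apply: mform_ext (mformM (FH j) FS) => // k; rewrite subnKC.
rewrite Hp; case: eqP => [->|_]; last by rewrite mul0r mulr0.
by rewrite mul1r mulVf //; case: (HS k).
Qed.

Lemma mform_split delta i f : mform (fun k => delta k + eps i k)%N f ->
  exists2 g : 'I_(n i).+1 -> params -> C, forall j, mform delta (g j) &
    forall q, f q = \sum_j q i 0 j * g j q.
Proof.
elim/mform_ind => [f1 f2 e12 [g Fg Hg]|||a f1 [g Fg Hg]|alpha da].
- by exists g => // q; rewrite -e12.
- by exists (fun _ _ => 0) => [j|q]; [exact: mform0 | rewrite big1 // => j _; rewrite mulr0].
- move=> f1 f2 [g1 F1 H1] [g2 F2 H2]; exists (fun j q => g1 j q + g2 j q) => [j|q]; first exact: mformD.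
  by rewrite H1 H2 -big_split; apply: eq_bigr => j _; rewrite mulrDr.
- exists (fun j q => a * g j q) => [j|q]; first exact: mformZ.
  by rewrite Hg mulr_sumr; apply: eq_bigr => j _; rewrite mulrCA.
have [j aj] : exists j, (0 < alpha i j)%N.
  apply: contrapT => /forallNP H; have := da i; rewrite /eps eqxx addn1 big1 // => j _.
  by apply/eqP; rewrite -leqn0 leqNgt; apply/negP/H.
pose delt k (l : 'I_(n k).+1) : nat := Tagged (fun k => 'I_(n k).+1) l == Tagged (fun k => 'I_(n k).+1) j.
have delti l : delt i l = (l == j) by rewrite /delt eq_Tagged.
have deltk k l : k != i -> delt k l = 0%N.
  move=> ki; rewrite /delt; apply/eqP; rewrite eqb0; apply: contraNN ki => /eqP/(congr1 tag) /= ->.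
  exact: eqxx.
have ledelt k l : (delt k l <= alpha k l)%N.
  case: (eqVneq k i) l => [->|ki] l; last by rewrite deltk.
  by rewrite delti; case: eqP => [->|].
pose g q := \prod_k \prod_l q k 0 l ^+ (alpha k l - delt k l).
exists (fun l => if l == j then g else fun=> 0) => [l|q].
  case: ifP => _; last exact: mform0.
  apply: mform_mon => k; rewrite sumnB => [|l' _]; last exact: ledelt.
  rewrite da; have [->|ki] := eqVneq k i.
    rewrite (bigD1 j) //= delti eqxx big1 ?addn0 /eps ?eqxx ?addnK // => l' /negPf l'j.
    by rewrite delti l'j.
  by rewrite big1 => [|l' _]; rewrite ?deltk // /eps (negPf ki) addn0 subn0.
rewrite (bigD1 j) //= eqxx [X in _ + X]big1 ?addr0; last by move=> l /negPf lj; rewrite lj mulr0.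
have -> : q i 0 j = \prod_k \prod_l q k 0 l ^+ delt k l.
  rewrite (bigD1 i) //= [X in _ * X]big1 ?mulr1 => [|k ki]; last by rewrite big1 // => l _; rewrite deltk.
  rewrite (bigD1 j) //= delti eqxx expr1 big1 ?mulr1 // => l /negPf lj.
  by rewrite delti lj.
rewrite -big_split; apply: eq_bigr => k _; rewrite -big_split; apply: eq_bigr => l _ /=.
by rewrite -exprD subnKC.
Qed.

(** For such [w] the pairing does not depend on the choice made by [coef], and is therefore linear
    in the form. *)
Definition spanned (w : 'rV[C]_m) := forall c : 'cV[C]_m, (forall q, (phi q *m c) 0 0 = 0) -> (w *m c) 0 0 = 0.

Lemma pairing_coef w f (c : 'cV[C]_m) : spanned w -> (forall q, f q = (phi q *m c) 0 0) -> pairing w f = (w *m c) 0 0.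
Proof.
move=> sw Hc; have Ff : mform d f by exists c.
apply/eqP; rewrite -subr_eq0 /pairing; apply/eqP.
rewrite -dotB; apply: sw => q.
by rewrite dotB -/(pairing _ _) pairing_phi // Hc subrr.
Qed.

Lemma pairingD w f g : spanned w -> mform d f -> mform d g ->
  pairing w (fun q => f q + g q) = pairing w f + pairing w g.
Proof.
move=> sw Ff Fg; rewrite (@pairing_coef w _ (coef f + coef g)) //; first by rewrite dotD.
by move=> q; rewrite dotD -!/(pairing _ _) !pairing_phi.
Qed.

Lemma pairingZ w a f : spanned w -> mform d f -> pairing w (fun q => a * f q) = a * pairing w f.
Proof.
move=> sw Ff; rewrite (@pairing_coef w _ (a *: coef f)) //; first by rewrite dotZ.
by move=> q; rewrite dotZ -!/(pairing _ _) !pairing_phi.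
Qed.

Lemma pairing_big w (I : Type) (s : seq I) (f : I -> params -> C) : spanned w -> (forall a, mform d (f a)) ->
  pairing w (fun q => \sum_(a <- s) f a q) = \sum_(a <- s) pairing w (f a).
Proof.
move=> sw Ff; elim: s => [|a s IH].
  rewrite big_nil (@pairing_coef w _ 0) // ?mulmx0 ?mxE // => q.
  by rewrite big_nil mulmx0 mxE.
rewrite big_cons -IH -pairingD //; last exact: mform_sum.
by congr (pairing w _); apply: functional_extensionality_dep => q; rewrite big_cons.
Qed.

Lemma pairing_ext (w : 'rV[C]_m) f g : f =1 g -> pairing w f = pairing w g :> C.
Proof. by move=> /funext ->. Qed.

Section Uniqueness.
Variables (h : nat) (p : 'I_h -> params) (w : 'rV[C]_m).
Hypotheses (gp : good p) (sw : spanned w).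
Let alpha k := (e * eps i1 k)%N.
Let beta k := (d k - alpha k)%N.
Hypothesis apolar : forall A B, mform alpha A -> mform beta B -> (forall j, B (p j) = 0) ->
  pairing w (fun q => A q * B q) = 0.

Let led k : (alpha k <= d k)%N.
Proof. rewrite /alpha /eps; case: eqP => [->|_]; last by rewrite muln0. by rewrite muln1; lia. Qed.

Let abd k : (alpha k + beta k = d k)%N. Proof. by rewrite subnKC. Qed.

Definition linprod (s : seq 'cV[C]_(n i1).+1) : params -> C := fun q => \prod_(l <- s) (q i1 *m l) 0 0.

Lemma mform_linprod s : mform (fun k => size s * eps i1 k)%N (linprod s).
Proof.
elim: s => [|l s IH].
  apply: mform_ext (@mform_mon R r n _ (fun _ _ => 0%N) _) => [|q|i] //.
    by rewrite /linprod big_nil big1 // => i _; rewrite big1.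
  by rewrite big1.
apply: mform_ext (mformM (mform_lin l) IH) => [k|q]; first by rewrite mulSn.
by rewrite /linprod big_cons.
Qed.

Let linprod_cons l s q : linprod (l :: s) q = (q i1 *m l) 0 0 * linprod s q.
Proof. by rewrite /linprod big_cons. Qed.

(* Modulo the forms [l K'] with [l(p_j) = 0], which vanish at all points, each linear factor *)
(* next to the dual form [K = l_j K'] can be replaced by a multiple of [l_j]. *)
Lemma pairing_linprod_dual j (K' : params -> C) (mj : 'cV[C]_(n i1).+1) :
  (p j i1 *m mj) 0 0 = 1 -> mform (fun k => beta k - eps i1 k)%N K' -> (forall k, k != j -> K' (p k) = 0) ->
  forall s t, (size s + t = e)%N ->
  pairing w (fun q => linprod (s ++ nseq t mj) q * ((q i1 *m mj) 0 0 * K' q)) =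
  linprod s (p j) * pairing w (fun q => linprod (nseq e mj) q * ((q i1 *m mj) 0 0 * K' q)).
Proof.
move=> mjp FK' K'p.
have beta1 k : (eps i1 k + (beta k - eps i1 k) = beta k)%N.
  rewrite subnKC // /beta /alpha /eps; case: eqP => [->|//]; rewrite muln1; lia.
have FB (l : 'cV[C]_(n i1).+1) : mform beta (fun q => (q i1 *m l) 0 0 * K' q).
  by apply: mform_ext (mformM (mform_lin l) FK').
elim=> [|l s IH] t st; first by move: st => /= st; rewrite -{1}st /linprod big_nil mul1r.
rewrite linprod_cons -mulrA -(IH t.+1); last by rewrite addnS -addSn.
set lp := (p j i1 *m l) 0 0.
have Fl s' (l' : 'cV[C]_(n i1).+1) : size s' = e -> mform d (fun q => linprod s' q * ((q i1 *m l') 0 0 * K' q)).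
  move=> sz; have FA := mform_linprod s'; rewrite sz in FA.
  exact: (mformMd FA (FB l') abd).
have sz1 : size (s ++ nseq t.+1 mj) = e by rewrite size_cat size_nseq addnS -addSn.
have sz2 : size ((l :: s) ++ nseq t mj) = e by rewrite size_cat size_nseq.
rewrite -pairingZ //; last exact: Fl.
apply/eqP; rewrite -subr_eq0 -mulN1r -pairingZ //; last by apply: mformZ; exact: Fl.
rewrite -pairingD //; [|exact: Fl|by do 2 apply: mformZ; exact: Fl].
have Fl' : mform beta (fun q => (q i1 *m (l - lp *: mj)) 0 0 * K' q) by exact: FB.
apply/eqP; rewrite -[RHS](apolar (A := linprod (s ++ nseq t.+1 mj)) _ Fl').
- apply: pairing_ext => q; rewrite cat_cons linprod_cons.
  have -> : linprod (s ++ nseq t.+1 mj) q = (q i1 *m mj) 0 0 * linprod (s ++ nseq t mj) q.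
    by rewrite /linprod !big_cat /= big_cons mulrCA.
  rewrite dotB dotZ; ring.
- by have FA := mform_linprod (s ++ nseq t.+1 mj); rewrite sz1 in FA.
move=> k; have [->|kj] := eqVneq k j; last by rewrite K'p ?mulr0.
suff -> : (p j i1 *m (l - lp *: mj)) 0 0 = 0 by rewrite mul0r.
by rewrite dotB dotZ mjp mulr1 subrr.
Qed.

(** Subtracting from [B] its interpolation by the dual forms [K j] leaves a form vanishing at all
    points; so [apolar] reduces products with [B] to products with the [K j], which
    [pairing_linprod_dual] evaluates. Such products span the forms of multidegree [d]. *)
Lemma apolar_pairing : exists lambda : 'I_h -> C, forall f, mform d f -> pairing w f = \sum_j lambda j * f (p j).
Proof.
have [K' FK' K'p] : exists2 K' : 'I_h -> params -> C, forall j, mform (fun k => beta k - eps i1 k)%N (K' j) &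
    forall j k, K' j (p k) = (j == k)%:R.
  by apply: dual_forms gp _ => k; rewrite /beta /alpha /eps; case: eqP => [->|_]; rewrite ?muln0 // !muln1; lia.
have ex_m j : exists c : 'cV[C]_(n i1).+1, (p j i1 *m c) 0 0 = 1.
  have [_ p0] := gp; have /rV0Pn[k pk] := p0 j i1.
  exists ((p j i1 0 k)^-1 *: delta_mx k 0).
  by rewrite dotZ -colE mxE mulVf.
have [mj Hm] := choice ex_m.
pose K j q := (q i1 *m mj j) 0 0 * K' j q.
pose lambda j := pairing w (fun q => linprod (nseq e (mj j)) q * K j q).
exists lambda.
have beta1 k : (eps i1 k + (beta k - eps i1 k) = beta k)%N.
  rewrite subnKC // /beta /alpha /eps; case: eqP => [->|//]; rewrite muln1; lia.
have FK j : mform beta (K j) by apply: mform_ext (mformM (mform_lin (mj j)) (FK' j)).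
have Kp j k : K j (p k) = (j == k)%:R.
  by rewrite /K K'p; case: eqP => [->|_]; rewrite ?mulr0 // Hm mulr1.
have lK s j : size s = e -> pairing w (fun q => linprod s q * K j q) = linprod s (p j) * lambda j.
  move=> sz; have := @pairing_linprod_dual j (K' j) (mj j) (Hm j) (FK' j) _ s 0%N.
  rewrite cats0 addn0; apply=> // k kj; by rewrite K'p eq_sym (negPf kj).
have base s B : size s = e -> mform beta B ->
    pairing w (fun q => linprod s q * B q) = \sum_j lambda j * (linprod s (p j) * B (p j)).
  move=> sz FB; have FA := mform_linprod s; rewrite sz in FA.
  have FsK j : mform d (fun q => linprod s q * K j q) by exact: mformMd FA (FK j) abd.
  have FsB : mform d (fun q => linprod s q * B q) by exact: mformMd FA FB abd.
  have FB' : mform beta (fun q => B q + \sum_j - B (p j) * K j q).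
    by apply: mformD FB _; apply: mform_sum => j; apply: mformZ.
  have B'p j : B (p j) + \sum_l - B (p l) * K l (p j) = 0.
    rewrite (bigD1 j) //= [X in _ + (_ + X)]big1 ?addr0 => [|k kj]; last by rewrite Kp (negPf kj) mulr0.
    by rewrite Kp eqxx mulr1 subrr.
  have := apolar FA FB' B'p.
  have -> : (fun q => linprod s q * (B q + \sum_j - B (p j) * K j q)) =
            (fun q => linprod s q * B q + \sum_j - B (p j) * (linprod s q * K j q)).
    apply: functional_extensionality_dep => q; rewrite mulrDr mulr_sumr; congr (_ + _).
    by apply: eq_bigr => j _; rewrite mulrCA.
  rewrite pairingD //; last by apply: mform_sum => j; apply: mformZ.
  rewrite pairing_big // => [|j]; last exact: mformZ.
  under eq_bigr => j _ do rewrite pairingZ // lK //.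
  move/eqP; rewrite addr_eq0 => /eqP ->; rewrite -sumrN; apply: eq_bigr => j _; ring.
(* [t] of the [e] linear factors are still inside [B]; [mform_split] extracts them one by one. *)
have step t : forall s B, (size s + t = e)%N -> mform (fun k => beta k + t * eps i1 k)%N B ->
    pairing w (fun q => linprod s q * B q) = \sum_j lambda j * (linprod s (p j) * B (p j)).
  elim: t => [|t IH] s B st FB.
    by apply: base; [rewrite -st addn0 | apply: mform_ext FB => // k; rewrite mul0n addn0].
  have FB1 : mform (fun k => (beta k + t * eps i1 k) + eps i1 k)%N B.
    by apply: mform_ext FB => // k; rewrite mulSn; lia.
  have [g Fg Hg] := mform_split FB1.
  have Fdg (l : 'I_(n i1).+1) : mform d (fun q => linprod (delta_mx l 0 :: s) q * g l q).
    apply: mformMd (mform_linprod (delta_mx l 0 :: s)) (Fg l) _ => k.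
    by rewrite /= -(abd k) /alpha -st; lia.
  have dE (l : 'I_(n i1).+1) q : linprod (delta_mx l 0 :: s) q = q i1 0 l * linprod s q.
    by rewrite linprod_cons -colE mxE.
  rewrite (pairing_ext w (g := fun q => \sum_l linprod (delta_mx l 0 :: s) q * g l q)) => [|q]; last first.
    by rewrite Hg mulr_sumr; apply: eq_bigr => l _; rewrite dE mulrCA mulrA.
  rewrite pairing_big //.
  under eq_bigr => l _ do rewrite IH ?addSn -?addnS //.
  rewrite exchange_big; apply: eq_bigr => j _; rewrite -mulr_sumr Hg; congr (_ * _); rewrite mulr_sumr.
  by apply: eq_bigr => l _; rewrite dE; ring.
move=> f Ff; rewrite (pairing_ext w (g := fun q => linprod [::] q * f q)) => [|q]; last first.
  by rewrite /linprod big_nil mul1r.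
rewrite (step e) //; last by apply: mform_ext Ff => // k; rewrite addnC abd.
by apply: eq_bigr => j _; rewrite /linprod big_nil mul1r.
Qed.

Lemma apolar_sub : (w <= map_rows p)%MS.
Proof.
have [lambda Hl] := apolar_pairing; rewrite submxE; apply/eqP/rowP => k.
set c := col k (cokermx (map_rows p)).
have Fc : mform d (fun q => (phi q *m c) 0 0) by exists c.
have := Hl _ Fc; rewrite (@pairing_coef w _ c) // big1 => [wc|j _].
  by rewrite [RHS]mxE -[RHS]wc !mxE; apply: eq_bigr => l _; rewrite [in RHS]mxE.
have : map_rows p *m c = 0 by rewrite /c colE mulmxA mulmx_coker mul0mx.
move=> /(congr1 (row j)); rewrite row_mul rowK row0 => ->.
by rewrite mxE mulr0.
Qed.

End Uniqueness.

(** * Secant points, their rank and the planes through them *)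

Lemma pairing_span h (q : 'I_h -> params) v : (v <= map_rows q)%MS ->
  exists c : 'I_h -> C, forall f, mform d f -> pairing v f = \sum_j c j * f (q j).
Proof.
move=> /submxP[D ->]; exists (D 0) => f Ff; rewrite mulmx_sum_row pairing_sum; apply: eq_bigr => j _.
by rewrite rowK /pairing -scalemxAl mxE -/(pairing _ _) pairing_phi.
Qed.

(** No coefficients are needed: they are absorbed in the factor [i0]. *)
Definition secant_point h (p : 'I_h -> params) : 'rV[C]_m := \sum_j phi (p j).

Lemma pairing_secant_point h (p : 'I_h -> params) f : mform d f -> pairing (secant_point p) f = \sum_j f (p j).
Proof. by move=> Ff; rewrite pairing_sum; apply: eq_bigr => j _; rewrite pairing_phi. Qed.

Lemma secant_point_sub h (p : 'I_h -> params) : (secant_point p <= map_rows p)%MS.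
Proof. by apply: summx_sub => j _; rewrite -(rowK (fun j => phi (p j))) row_sub. Qed.

Let gamma k := (d k - 2 * (e * eps i1 k))%N.

Let gammaE k : (e * eps i1 k + e * eps i1 k + gamma k = d k)%N.
Proof.
rewrite addnn -mul2n /gamma /eps; case: eqP => [->|_]; last by rewrite !muln0 subn0.
by rewrite muln1; lia.
Qed.

Lemma gram_mform h (A : 'I_h -> params -> C) G a b :
  (forall a, mform (fun k => e * eps i1 k)%N (A a)) -> mform gamma G ->
  mform d (fun q => A a q * A b q * G q).
Proof. by move=> FA FG; apply: mformMd (mformM (FA a) (FA b)) FG gammaE. Qed.

(** The left side is a polynomial in the vector alone; through the factorization E^T diag(G(p_j)) E
    it detects that the points are separated and off [G = 0]. *)
Lemma gram_det h (A : 'I_h -> params -> C) G (p : 'I_h -> params) :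
  (forall a, mform (fun k => e * eps i1 k)%N (A a)) -> mform gamma G ->
  \det (\matrix_(a, b) pairing (secant_point p) (fun q => A a q * A b q * G q)) =
  (\det (\matrix_(j, a) A a (p j))) ^+ 2 * \prod_j G (p j).
Proof.
move=> FA FG; set E := \matrix_(j, a) A a (p j).
have -> : \matrix_(a, b) pairing (secant_point p) (fun q => A a q * A b q * G q) =
    E^T *m diag_mx (\row_j G (p j)) *m E.
  apply/matrixP => a b; rewrite mxE pairing_secant_point; last exact: gram_mform.
  rewrite mxE; apply: eq_bigr => j _; rewrite mul_mx_diag !mxE; ring.
rewrite !det_mulmx det_tr det_diag expr2 mulrAC; congr (_ * _).
by apply: eq_bigr => j _; rewrite mxE.
Qed.

(** A zero factor of [p j] would make [phi (p j)] zero, hence all [A a (p j)], and the matrix of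
    values would have a zero row. *)
Lemma gram_good h (A : 'I_h -> params -> C) G (p : 'I_h -> params) :
  (forall a, mform (fun k => e * eps i1 k)%N (A a)) -> mform gamma G ->
  \det (\matrix_(a, b) pairing (secant_point p) (fun q => A a q * A b q * G q)) != 0 -> good p.
Proof.
move=> FA FG; rewrite gram_det // mulf_eq0 negb_or expf_eq0 /= => /andP[dE /prodf_neq0 Gp].
split; first exact: separated_det dE.
move=> j i; apply: contraNneq dE => pji.
rewrite (expand_det_row _ j) big1 // => a _; rewrite mxE.
suff -> : A a (p j) = 0 by rewrite mul0r.
have := pairing_phi (p j) (gram_mform a a FA FG); rewrite (map_eq0 (d_gt0 i) pji) /pairing mul0mx mxE => /esym/eqP.
by rewrite !mulf_eq0 (negPf (Gp j isT)) orbF orbb => /eqP.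
Qed.

(** Pairing with the products of dual forms gives the identity matrix of size [h], which factors
    through size [k] if the vector is spanned by [k] points. *)
Lemma rank_ge h k (p : 'I_h -> params) (x : 'M[C]_(k, m)) : good p -> tuple_of_points X x ->
  (secant_point p <= x)%MS -> (h <= k)%N.
Proof.
move=> gp /tuple_of_pointsP[q q0 ->] /pairing_span[c Hc].
have [[H [FH Hp]] _] := gp.
have [K FK Kp] : exists2 K : 'I_h -> params -> C, forall j, mform (fun k => d k - e * eps i1 k)%N (K j) &
    forall j k, K j (p k) = (j == k)%:R.
  by apply: dual_forms gp _ => l; rewrite -(gammaE l); lia.
have FHK a b : mform d (fun q => H a q * K b q).
  by apply: mformMd (FH a) (FK b) _ => l; rewrite -(gammaE l); lia.
have E : (1%:M : 'M[C]_h) = \matrix_(a, l) (c l * H a (q l)) *m \matrix_(l, b) K b (q l).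
  apply/matrixP => a b; rewrite !mxE.
  transitivity (pairing (secant_point p) (fun q => H a q * K b q)).
    rewrite pairing_secant_point // (bigD1 a) //= Hp Kp eqxx mul1r big1 ?addr0 => [|j ja].
      by rewrite eq_sym.
    by rewrite Hp eq_sym (negPf ja) mul0r.
  by rewrite Hc //; apply: eq_bigr => l _; rewrite !mxE mulrA.
by rewrite -(mxrank1 C h) E mulmx_max_rank.
Qed.

Lemma row_free_good h (p : 'I_h -> params) : good p -> row_free (map_rows p).
Proof.
move=> gp; have [K FK Kp] := @dual_forms h p d gp (fun k => leq_trans (leq_trans (leq_addr _ _) (leq_addr _ _)) (eq_leq (gammaE k))).
apply/row_freeP; exists (\matrix_(k, b) coef (K b) k 0); apply/matrixP => a b.
rewrite !mxE -[RHS]/((a == b)%:R) eq_sym -Kp -(pairing_phi _ (FK b)) /pairing mxE.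
by apply: eq_bigr => k _; rewrite !mxE.
Qed.

Lemma distinct_good h (p : 'I_h -> params) : good p -> distinct_points (map_rows p).
Proof.
move=> gp j l jl; apply/negP => /sub_rVP[c]; rewrite !rowK => E.
have [K FK Kp] := @dual_forms h p d gp (fun k => leq_trans (leq_trans (leq_addr _ _) (leq_addr _ _)) (eq_leq (gammaE k))).
have := pairing_phi (p j) (FK j); rewrite E /pairing -scalemxAl mxE -/(pairing _ _) pairing_phi // !Kp eqxx (negPf jl).
by rewrite mulr0 => /esym/eqP; rewrite oner_eq0.
Qed.

Lemma for_general_all h (P : 'M[C]_(h, m) -> Prop) : (forall x, tuple_of_points X x -> P x) -> for_general X P.
Proof.
move=> HP; exists 1; split; last by move=> x Xx _; exact: HP.
exists (map_rows (fun=> ones)); last by rewrite meval1 oner_neq0.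
by apply: points_map_rows => j i; apply/rV0Pn; exists 0; rewrite mxE oner_neq0.
Qed.

(** Polynomial identities on the planes spanned by points pass to their limits. *)
Lemma secant_planes_polyfun h (L : 'M[C]_(h, m)) (g : 'M[C]_(h, m) -> C) : secant_planes X L ->
  polyfun (fun w => g (vec_mx w)) ->
  (forall q : 'I_h -> params, (forall j, nonzero (q j)) -> forall L' : 'M[C]_(h, m), (L' <= map_rows q)%MS -> g L' = 0) ->
  g L = 0.
Proof.
move=> [_ HL] [F HF] gX; rewrite -[L]mxvecK -HF; apply: HL; apply: for_general_all => x Xx L' _ /andP[L'x _].
by have [q q0 xq] := tuple_of_pointsP Xx; rewrite HF mxvecK; apply: gX q0 _ _; rewrite -xq.
Qed.

(** A polynomial nonzero at [p] is nonzero at some general separated tuple, whose rows are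
    independent; so it cannot vanish on all general secant planes. *)
Lemma good_secant_plane h (p : 'I_h -> params) : good p -> secant_planes X (map_rows p).
Proof.
move=> gp; split=> [|F FP]; first exact: row_free_good.
have [[H [FH Hp]] _] := gp; apply/eqP/negPn/negP => Fp.
have PF : polyfun (fun v : 'rV[C]_(h * m) => F.@[v 0]) by exists F.
have Pg := polyfunM (polyfun_rows PF) (polyfun_tuple_det id FH).
have [|u] := for_general_params FP Pg.
  exists (of_tuple_params p); rewrite of_tuple_paramsK mulf_neq0 //.
  rewrite (_ : \matrix_(j, a) _ = 1%:M) ?det1 ?oner_neq0 //.
  by apply/matrixP => j a; rewrite !mxE Hp eq_sym.
rewrite mulf_eq0 negb_or => /andP[Fu du] [u0 Pu]; case/eqP: Fu; apply: Pu; last by rewrite !submx_refl.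
by apply: row_free_good; split=> //; exact: separated_det du.
Qed.

Section Plane.
Variables (h : nat) (p : 'I_h -> params) (L : 'M[C]_(h, m)) (s t : 'rV[C]_h).
Hypotheses (gp : good p) (SL : secant_planes X L) (sL : secant_point p = s *m L).

Lemma spanned_plane : spanned (t *m L).
Proof.
move=> c cX; apply: (secant_planes_polyfun (g := fun M => (t *m M *m c) 0 0) SL).
  apply: (@polyfun_ext _ _ (fun w : 'rV_(h * m) => \sum_k (\sum_j t 0 j * w 0 (mxvec_index j k)) * c k 0)).
    by move=> w; rewrite mxE; apply: eq_bigr => k _; rewrite mxE; congr (_ * _); apply: eq_bigr => j _; rewrite mxE.
  apply: polyfun_sum => k; apply: polyfunM; last exact: polyfun_cst.
  by apply: polyfun_sum => j; apply: polyfunM; [exact: polyfun_cst | exact: polyfun_coord].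
move=> q _ L' /submxP[D ->]; rewrite mulmxA (mulmx_sum_row (t *m D)) mulmx_suml summxE big1 // => j _.
by rewrite rowK -scalemxAl mxE cX mulr0.
Qed.

(* The [(h + 1)]-minors of the flattenings of two vectors of a generic plane vanish; on [L] this minor *)
(* is block triangular with an identity block. *)
Lemma apolar_plane A B : mform (fun k => e * eps i1 k)%N A -> mform (fun k => d k - e * eps i1 k)%N B ->
  (forall j, B (p j) = 0) -> pairing (t *m L) (fun q => A q * B q) = 0.
Proof.
move=> FA FB Bp; have [[H [FH Hp]] _] := gp.
have [K FK Kp] : exists2 K : 'I_h -> params -> C, forall j, mform (fun k => d k - e * eps i1 k)%N (K j) &
    forall j k, K j (p k) = (j == k)%:R.
  by apply: dual_forms gp _ => l; rewrite -(gammaE l); lia.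
have Fd A' B' : mform (fun k => e * eps i1 k)%N A' -> mform (fun k => d k - e * eps i1 k)%N B' -> mform d (fun q => A' q * B' q).
  by move=> F1 F2; apply: mformMd F1 F2 _ => l; rewrite -(gammaE l); lia.
(* The first [h] columns pair the secant point with the dual forms, the last one pairs [t *m L] with
   [A]. *)
pose vv (a : 'I_(h + 1)) := if split a is inl _ then s else t.
pose Af (a : 'I_(h + 1)) := if split a is inl a' then H a' else A.
pose Bf (b : 'I_(h + 1)) := if split b is inl b' then K b' else B.
have FAf a : mform (fun k => e * eps i1 k)%N (Af a) by rewrite /Af; case: split.
have FBf b : mform (fun k => d k - e * eps i1 k)%N (Bf b) by rewrite /Bf; case: split.
pose N (M : 'M[C]_(h, m)) : 'M[C]_(h + 1) := \matrix_(b, a) pairing (vv a *m M) (fun q => Af a q * Bf b q).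
have N0 : \det (N L) = 0.
  apply: (secant_planes_polyfun (g := fun M => \det (N M)) SL).
    apply: polyfun_det => b a.
    apply: (@polyfun_ext _ _ (fun w => pairing (vv a *m vec_mx w) (fun q => Af a q * Bf b q))) => [w|]; first by rewrite mxE.
    apply: polyfun_comp (polyfun_pairing _) _ => k.
    apply: (@polyfun_ext _ _ (fun w : 'rV_(h * m) => \sum_j vv a 0 j * w 0 (mxvec_index j k))).
      by move=> w; rewrite [RHS]mxE; apply: eq_bigr => j _; rewrite mxE.
    by apply: polyfun_sum => j; apply: polyfunM; [exact: polyfun_cst | exact: polyfun_coord].
  move=> q _ L' L'q; have ex_c a := pairing_span (submx_trans (submxMl (vv a) L') L'q).
  have [c Hc] := choice ex_c.
  have -> : N L' = \matrix_(b, j) Bf b (q j) *m \matrix_(j, a) (c a j * Af a (q j)).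
    apply/matrixP => b a; rewrite !mxE Hc; last exact: Fd.
    by apply: eq_bigr => j _; rewrite !mxE; ring.
  set M1 := \matrix_(b, j) _; set M2 := \matrix_(j, a) _; apply/eqP; apply: contraT => dN.
  by have := mulmx_max_rank M1 M2; rewrite mxrank_unit ?unitmxE ?unitfE // addn1 ltnn.
have spL f : mform d f -> pairing (s *m L) f = \sum_j f (p j) by rewrite -sL; exact: pairing_secant_point.
have sl (b : 'I_h) : split (lshift 1 b) = inl b by exact: (unsplitK (inl b)).
have sr (b : 'I_1) : split (rshift h b) = inr b by exact: (unsplitK (inr b)).
have NE : N L = block_mx 1%:M (ursubmx (N L)) 0 (pairing (t *m L) (fun q => A q * B q))%:M.
  rewrite -[LHS]submxK; congr block_mx.
  - apply/matrixP => b a; rewrite !mxE /vv /Af /Bf !sl spL; last exact: Fd.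
    rewrite (bigD1 a) //= Hp Kp eqxx mul1r big1 ?addr0 // => j ja.
    by rewrite Hp eq_sym (negPf ja) mul0r.
  - apply/matrixP => b a; rewrite !mxE /vv /Af /Bf sl sr spL; last exact: Fd.
    by rewrite big1 // => j _; rewrite Bp mulr0.
  by apply/matrixP => b a; rewrite !mxE /vv /Af /Bf !sr !ord1 eqxx.
by move: N0; rewrite NE det_ublock det1 mul1r det_scalar1.
Qed.

End Plane.

(** The rows of [L] lie in the span of the points, and both spaces have dimension [h]. *)
Lemma unique_plane h (p : 'I_h -> params) (L : 'M[C]_(h, m)) : good p -> secant_planes X L ->
  (secant_point p <= L)%MS -> (L == map_rows p)%MS.
Proof.
move=> gp SL /submxP[s sL].
have LS : (L <= map_rows p)%MS.
  apply/row_subP => i; rewrite rowE; apply: (apolar_sub gp (spanned_plane _ SL)) => A B FA FB Bp.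
  exact: (apolar_plane _ gp SL sL FA FB Bp).
have [fL _] := SL; have [_ eqr] := mxrank_leqif_sup LS.
by rewrite LS -eqr (eqP fL) (eqP (row_free_good gp)) eqxx.
Qed.

Lemma good_identifiable h (p : 'I_h -> params) : good p -> identifiable_point X h (secant_point p).
Proof.
move=> gp; have [_ p0] := gp; split.
  split; first by exists (map_rows p); split; [exact: points_map_rows | exact: distinct_good | exact: secant_point_sub].
  move=> k kh [x [Xx _ vx]]; have := rank_ge gp Xx vx; by rewrite leqNgt kh.
exists (map_rows p); split; [exact: good_secant_plane | exact: secant_point_sub|].
by move=> L SL; exact: unique_plane.
Qed.


(** * Parametrization of the secant variety and its general point *)

Lemma phi_scale c q : phi (fun k => (if k == i0 then c else 1) *: q k) = c *: phi q.
Proof.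
rewrite (@map_homog R r n d q _ (fun k => if k == i0 then c else 1)) //; congr (_ *: _).
by rewrite (bigD1 i0) //= eqxx d0 expr1 big1 ?mulr1 // => k /negPf ->; rewrite expr1n.
Qed.

Definition zero_params : params := fun=> 0.

Lemma phi_zero : phi zero_params = 0.
Proof. exact: (map_eq0 (d_gt0 i0)). Qed.

Lemma secant_set_param h : [set v : 'rV[C]_m | v != 0 /\
    exists2 x : 'M[C]_(h, m), tuple_of_points X x & (v <= x)%MS] =
  [set v | v != 0 /\ exists p : 'I_h -> params, v = secant_point p].
Proof.
apply/seteqP; split=> [v [v0 [x /tuple_of_pointsP[q q0 ->] /submxP[D vD]]]|v [v0 [p vp]]]; split=> //.
  exists (fun j k => (if k == i0 then D 0 j else 1) *: q j k).
  by rewrite vD mulmx_sum_row; apply: eq_bigr => j _; rewrite phi_scale rowK.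
(* A parameter with a zero factor contributes 0 to the sum, so [ones] can replace it in the spanning
   tuple. *)
pose q j := if `[< nonzero (p j) >] then p j else ones.
exists (map_rows q).
  apply: points_map_rows => j; rewrite /q; case: asboolP => // _ i; apply/rV0Pn; exists 0.
  by rewrite mxE oner_neq0.
rewrite vp; apply: summx_sub => j _; have [p0|/existsNP[i /negP]] := pselect (nonzero (p j)).
  have <- : q j = p j by rewrite /q asboolT.
  by rewrite -(rowK (fun j => phi (q j))) row_sub.
by rewrite negbK => /eqP pi; rewrite (map_eq0 (d_gt0 i) pi) sub0mx.
Qed.

Lemma polyfun_secant_point h k : polyfun (fun u : 'rV_(h * nparams n) => secant_point (tuple_params u) 0 k).
Proof.
apply: (@polyfun_ext _ _ (fun u : 'rV_(h * nparams n) => \sum_(j < h) phi (tuple_params u j) 0 k)) => [u|].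
  by rewrite summxE.
by apply: polyfun_sum => j; exact: polyfun_tuple_phi.
Qed.

(** Zero lies in the span of no points at all, so [rank_ge] with [k = 0] excludes it. *)
Lemma secant_point_neq0 h (p : 'I_h -> params) : (0 < h)%N -> good p -> secant_point p != 0.
Proof.
move=> h0 gp; apply/eqP => p0; have X0 : tuple_of_points X (0 : 'M[C]_(0, m)) by case.
by have := rank_ge gp X0; rewrite p0 sub0mx leqNgt h0 => /(_ isT).
Qed.

Lemma polyfun_gram h (A : 'I_h -> params -> C) G : 
  polyfun (fun v : 'rV[C]_m => \det (\matrix_(a, b) pairing v (fun q => A a q * A b q * G q))).
Proof.
apply: polyfun_det => a b; apply: polyfun_ext (polyfun_pairing (fun q => A a q * A b q * G q)) => v.
by rewrite mxE.
Qed.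

Lemma secant_set_projective h : projective_set [set v | v != 0 /\ exists p : 'I_h -> params, v = secant_point p].
Proof.
move=> v [v0 [p vp]]; split=> // c c0; split; first by rewrite scaler_eq0 negb_or c0.
exists (fun j k => (if k == i0 then c else 1) *: p j k).
by rewrite vp scaler_sumr; apply: eq_bigr => j _; rewrite phi_scale.
Qed.

(** Two open conditions on a vector: [alpha] makes it an actual secant point instead of a limit, and
    the Gram determinant makes its points separated. *)
Theorem general_identifiable h (A : 'I_h -> params -> C) (p : 'I_h -> params) : (0 < h)%N ->
  (forall a, mform (fun k => e * eps i1 k)%N (A a)) -> \det (\matrix_(j, a) A a (p j)) != 0 ->
  identifiable X h.
Proof.
move=> h0 FA dA; have ones0 i : ones i != 0 by apply/rV0Pn; exists 0; rewrite mxE oner_neq0.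
have [G FG G1] := mform_nonzero gamma ones0.
have [alpha Palpha [ex_alpha Halpha]] := image_contains_open (@polyfun_secant_point h).
pose gram (v : 'rV[C]_m) := \det (\matrix_(a, b) pairing v (fun q => A a q * A b q * G q)).
have [u] : exists u : 'rV_(h * nparams n), alpha (secant_point (tuple_params u)) * gram (secant_point (tuple_params u)) != 0.
  apply: polyfun_prime => //.
  - exact: polyfun_comp Palpha (@polyfun_secant_point h).
  - exact: polyfun_comp (polyfun_gram A G) (@polyfun_secant_point h).
  have [||u Hu] := polyfun_prime (polyfun_tuple_det id FA)
     (polyfun_prod (index_enum 'I_h) xpredT (fun j => polyfun_tuple_form j FG)).
  - by exists (of_tuple_params p); rewrite of_tuple_paramsK.
  - exists (of_tuple_params (fun=> ones)); rewrite of_tuple_paramsK.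
    by apply/prodf_neq0 => j _.
  by exists u; rewrite /gram gram_det // expr2 -mulrA mulf_neq0 //; move: Hu; rewrite mulf_eq0 negb_or => /andP[].
rewrite mulf_eq0 negb_or => /andP[alu gru].
pose g (v : 'rV[C]_m) := alpha v * gram v.
have [F HF] : polyfun (fun w : 'rV[C]_(1 * m) => g (row 0 (vec_mx w))).
  by apply: polyfun_row; apply: polyfunM Palpha _; exact: polyfun_gram.
have HF' (v : 'M[C]_(1, m)) : F.@[mxvec v 0] = g v by rewrite HF mxvecK row_id.
have gu := gram_good FA FG gru; have su0 := secant_point_neq0 h0 gu.
exists F; split.
  exists (secant_point (tuple_params u)) => [j|]; last by rewrite HF' mulf_neq0.
  rewrite ord1 row_id /secant_variety secant_set_param; apply: sub_closure; first exact: secant_set_projective.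
  by split=> //; exists (tuple_params u).
move=> x Xx; rewrite HF' mulf_eq0 negb_or => /andP[alx grx].
have := Xx 0; rewrite row_id /secant_variety secant_set_param => clx.
have [|u' xu'] := Halpha x _ alx.
  move=> f Pf f0; apply: (closure_polyfun (@secant_set_projective h) Pf _ clx) => v [_ [q ->]].
  by rewrite -(of_tuple_paramsK q); apply: f0; exists (of_tuple_params q).
rewrite xu'; apply: good_identifiable; apply: gram_good FA FG _.
by rewrite -xu'.
Qed.


(** * Non-defectivity *)

Definition affine_coords := {i : 'I_r & 'I_(n i)}.
Local Notation D := #|{: affine_coords}|.

Definition rk i (c : 'I_(n i)) : nat := enum_rank (Tagged (fun i => 'I_(n i)) c : affine_coords).

(* The affine coordinates of rank at least [a] are set to [p i 0 0], i.e. to [1] in the chart [p i 0 0 = 1]. *)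
Definition mask a p : params := fun i =>
  \row_c (if unlift ord0 c is Some c' then if (rk c' < a)%N then p i 0 c else p i 0 0 else p i 0 0).

Lemma mask0 a p i : mask a p i 0 0 = p i 0 0.
Proof. by rewrite mxE unlift_none. Qed.

Lemma mask_lift a p i c : mask a p i 0 (lift ord0 c) = if (rk c < a)%N then p i 0 (lift ord0 c) else p i 0 0.
Proof. by rewrite mxE liftK. Qed.

Lemma params_ext p q : (forall i, p i 0 0 = q i 0 0) -> (forall i c, p i 0 (lift ord0 c) = q i 0 (lift ord0 c)) -> p = q.
Proof.
move=> e0 e1; apply: functional_extensionality_dep => i; apply/rowP => c.
by case: (unliftP ord0 c) => [c'|] ->.
Qed.

Lemma mask_mask a b p : (a <= b)%N -> mask b (mask a p) = mask a p.
Proof.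
move=> ab; apply: params_ext => [i|i c]; first by rewrite mask0.
rewrite !mask_lift mask0; case: ifP => // /negbT; rewrite -leqNgt => bc.
by rewrite ltnNge (leq_trans ab bc).
Qed.

Lemma mask_const a p : (forall i c, p i 0 (lift ord0 c) = p i 0 0) -> mask a p = p.
Proof. by move=> H; apply: params_ext => [i|i c]; rewrite ?mask0 // mask_lift H; case: ifP. Qed.

Lemma mask_ones a : mask a ones = ones.
Proof. by apply: mask_const => i c; rewrite !mxE. Qed.

Lemma mask_zero a : mask a zero_params = zero_params.
Proof. by apply: mask_const => i c; rewrite !mxE. Qed.

Lemma mask_scale a (c : 'I_r -> C) p : mask a (fun k => c k *: p k) = fun k => c k *: mask a p k.
Proof.
apply: params_ext => [i|i l]; first by rewrite [RHS]mxE !mask0 mxE.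
by rewrite [RHS]mxE !mask_lift; case: ifP; rewrite mxE.
Qed.

Section Chain.
Variable h : nat.

(** The stages, in lexicographic order of [(j, a)], of a flag from one point to the secant variety.
    Points not yet present are [zero_params], which [phi] sends to 0. *)
Definition trunc j a (p : 'I_h -> params) : 'I_h -> params := fun k =>
  if (k < j)%N then p k else if k == j :> nat then mask a (p k) else zero_params.

Lemma trunc_lt j a (p : 'I_h -> params) (k : 'I_h) : (k < j)%N -> trunc j a p k = p k.
Proof. by rewrite /trunc => ->. Qed.

Lemma trunc_eq j a (p : 'I_h -> params) (k : 'I_h) : k = j :> nat -> trunc j a p k = mask a (p k).
Proof. by rewrite /trunc => ->; rewrite ltnn eqxx. Qed.

Lemma trunc_gt j a (p : 'I_h -> params) (k : 'I_h) : (j < k)%N -> trunc j a p k = zero_params.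
Proof. by rewrite /trunc => jk; rewrite ltnNge (ltnW jk) gtn_eqF. Qed.

Definition partial j a : set 'rV[C]_m := [set v | v != 0 /\ exists p : 'I_h -> params, v = secant_point (trunc j a p)].

Lemma trunc_succ j a (p : 'I_h -> params) : (a < D)%N -> trunc j a.+1 (trunc j a p) = trunc j a p.
Proof.
move=> aD; apply: functional_extensionality_dep => k; case: (ltngtP k j) => kj.
- by rewrite trunc_lt.
- by rewrite !trunc_gt.
by rewrite !trunc_eq // mask_mask.
Qed.

Lemma trunc_next j (p : 'I_h -> params) : trunc j.+1 0 (trunc j D p) = trunc j D p.
Proof.
apply: functional_extensionality_dep => k; case: (ltngtP k j.+1) => kj.
- by rewrite trunc_lt.
- by rewrite !trunc_gt // ltnW.
by rewrite trunc_eq // trunc_gt ?kj // mask_zero.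
Qed.

Lemma partial_projective j a : projective_set (partial j a).
Proof.
move=> v [v0 [p vp]]; split=> // c c0; split; first by rewrite scaler_eq0 negb_or c0.
exists (fun k l => (if l == i0 then c else 1) *: p k l).
rewrite vp scaler_sumr; apply: eq_bigr => k _; rewrite -phi_scale; congr (phi _).
rewrite /trunc; case: ifP => // _; case: ifP => // _; first by rewrite mask_scale.
by apply: functional_extensionality_dep => i; rewrite scaler0.
Qed.

Lemma polyfun_mask a delta f : mform delta f -> polyfun (fun u => f (mask a (params_of u))).
Proof.
move=> Ff; apply: (@polyfun_ext _ _ (fun u => f (params_of (of_params (mask a (params_of u)))))) => [u|].
  by rewrite of_paramsK.
apply: (polyfun_comp (polyfun_form Ff)) => k.
apply: (@polyfun_ext _ _ (fun u => mask a (params_of u) (tag (enum_val k)) 0 (tagged (enum_val k)))) => [u|].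
  by rewrite [RHS]mxE.
case: (enum_val k) => i c /=; case: (unliftP ord0 c) => [c'|] ->.
  case rc: (rk c' < a)%N.
    by apply: polyfun_ext (@polyfun_params R r n i (lift ord0 c')) => u; rewrite mask_lift rc.
  by apply: polyfun_ext (@polyfun_params R r n i 0) => u; rewrite mask_lift rc.
by apply: polyfun_ext (@polyfun_params R r n i 0) => u; rewrite mask0.
Qed.

Lemma polyfun_trunc j a k delta f : mform delta f ->
  polyfun (fun u => f (trunc j a (tuple_params u) k)).
Proof.
move=> Ff; rewrite /trunc; case: (k < j)%N; first exact: polyfun_tuple_form Ff.
case: (k == j :> nat); last exact: polyfun_cst.
exact: (polyfun_row k (polyfun_mask a Ff)).
Qed.

Lemma polyfun_partial j a l : polyfun (fun u : 'rV_(h * nparams n) => secant_point (trunc j a (tuple_params u)) 0 l).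
Proof.
apply: (@polyfun_ext _ _ (fun u : 'rV_(h * nparams n) => \sum_(k < h) phi (trunc j a (tuple_params u) k) 0 l)) => [u|].
  by rewrite summxE.
by apply: polyfun_sum => k; apply: (polyfun_trunc j a k (@mform_entry R r n d l)).
Qed.

Lemma irreducible_partial j a : (0 < h)%N -> irreducible (zariski_closure (partial j a)).
Proof.
move=> h0; have -> : partial j a = [set v | v != 0 /\ exists u : 'rV_(h * nparams n), v = secant_point (trunc j a (tuple_params u))].
  apply/seteqP; split=> v [v0 [p vp]]; split=> //; last by exists (tuple_params p).
  by exists (of_tuple_params p); rewrite of_tuple_paramsK.
apply: irreducible_closure_param => [l||]; first exact: polyfun_partial.
  move=> v [v0 [u vu]]; have [_ cv] := @partial_projective j a v (conj v0 (ex_intro _ _ vu)).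
  split=> // c c0; have [cv0 [p cvp]] := cv c c0; split=> //.
  by exists (of_tuple_params p); rewrite of_tuple_paramsK.
pose k0 := Ordinal h0.
exists (of_tuple_params (fun k => if k == k0 then ones else zero_params)).
rewrite of_tuple_paramsK /secant_point (bigD1 k0) //= big1 => [|k kk0].
  rewrite addr0; have -> : trunc j a (fun k => if k == k0 then ones else zero_params) k0 = ones.
    by rewrite /trunc eqxx mask_ones; case: j => //= j'.
  by apply: map_neq0 => i; apply/rV0Pn; exists 0; rewrite mxE oner_neq0.
suff -> : trunc j a (fun k => if k == k0 then ones else zero_params) k = zero_params by exact: phi_zero.
by rewrite /trunc (negPf kk0) mask_zero; do 2 case: ifP => //.
Qed.

Lemma secant_point_narrow j (jh : (j < h)%N) (P : 'I_h -> params) :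
  (forall k : 'I_h, (j < k)%N -> P k = zero_params) ->
  secant_point P = secant_point (fun k : 'I_j.+1 => P (widen_ord jh k)).
Proof.
move=> P0; rewrite /secant_point (bigID (fun k : 'I_h => k < j.+1)%N) /= [X in _ + X]big1 ?addr0 => [|k].
  by rewrite (big_ord_narrow jh).
by rewrite -leqNgt => /P0 ->; exact: phi_zero.
Qed.

(** The last point is required to be [ones] because masks fix it: separated tuples then exist at
    every stage of the moving point. *)
Hypothesis separable : forall j, (j < h)%N -> exists A : 'I_j.+1 -> params -> C,
  (forall a, mform (fun k => e * eps i1 k)%N (A a)) /\
  exists q : 'I_j.+1 -> params, q ord_max = ones /\ \det (\matrix_(k, a) A a (q k)) != 0.

(* The Gram determinant with weight [G] vanishes on the smaller set, where [G] kills the last point, *)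
(* and not on the larger one. *)
Lemma partial_strict j a j' a' (jh : (j' < h)%N) G v0 :
  (forall p : 'I_h -> params, trunc j' a' (trunc j a p) = trunc j a p) -> mform gamma G -> G v0 != 0 -> mask a' v0 = v0 ->
  (forall p : 'I_h -> params, G (trunc j a p (Ordinal jh)) = 0) ->
  zariski_closure (partial j a) `<` zariski_closure (partial j' a').
Proof.
move=> tt FG Gv0 mv0 Gt; split; first by apply: closure_mono => v [v_0 [p vp]]; split=> //; exists (trunc j a p); rewrite tt.
move=> sub; have [A [FA [q [q1 dq]]]] := separable jh.
pose gram (v : 'rV[C]_m) := \det (\matrix_(a, b) pairing v (fun q => A a q * A b q * G q)).
have gramE (p : 'I_h -> params) : (forall k : 'I_h, (j' < k)%N -> p k = zero_params) -> gram (secant_point p) =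
   (\det (\matrix_(k, a) A a (p (widen_ord jh k)))) ^+ 2 * \prod_(k < j'.+1) G (p (widen_ord jh k)).
  by move=> p0; rewrite (secant_point_narrow jh p0) /gram gram_det.
have gram0 v : zariski_closure (partial j a) v -> gram v = 0.
  apply: closure_polyfun; [exact: partial_projective | exact: polyfun_gram|].
  move=> w [_ [p ->]]; rewrite gramE => [|k jk]; last by rewrite -tt trunc_gt.
  rewrite big_ord_recr /=; have -> : widen_ord jh ord_max = Ordinal jh by apply: val_inj.
  by rewrite Gt !mulr0.
(* The determinant is nonzero at [q] padded by zeros, the product of weights at the constant tuple
   [v0]; [polyfun_prime] finds a common tuple. *)
have [u] : exists u : 'rV_(h * nparams n), \det (\matrix_(k, a) A a (trunc j' a' (tuple_params u) (widen_ord jh k))) *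
     \prod_(k < j'.+1) G (trunc j' a' (tuple_params u) (widen_ord jh k)) != 0.
  apply: polyfun_prime.
  - apply: polyfun_det => k b; apply: polyfun_ext (polyfun_trunc j' a' (widen_ord jh k) (FA b)) => u.
    by rewrite mxE.
  - by apply: polyfun_prod => k; exact: (polyfun_trunc j' a' (widen_ord jh k) FG).
  - exists (of_tuple_params (fun k : 'I_h => if insub (k : nat) is Some k' then q k' else zero_params)).
    rewrite of_tuple_paramsK; move: dq; congr (\det _ != 0); apply/matrixP => k b; rewrite !mxE; congr (A b _).
    have -> : trunc j' a' (fun k : 'I_h => if insub (k : nat) is Some k' then q k' else zero_params) (widen_ord jh k) =
        if (k < j')%N then q k else mask a' (q k).
      rewrite /trunc /= valK; case: ltnP => // jk; have -> : k == j' :> nat by rewrite eqn_leq jk -ltnS ltn_ord.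
      by [].
    case: ltnP => // jk; have -> : k = ord_max by apply/val_inj/eqP; rewrite eqn_leq jk -ltnS ltn_ord.
    by rewrite q1 mask_ones.
  exists (of_tuple_params (fun=> v0)); rewrite of_tuple_paramsK; apply/prodf_neq0 => k _.
  rewrite /trunc /= mv0; have : (k <= j')%N by rewrite -ltnS.
  by case: ltngtP.
rewrite mulf_eq0 negb_or => /andP[du Gu].
have gu : gram (secant_point (trunc j' a' (tuple_params u))) != 0.
  by rewrite gramE => [|k jk]; [rewrite mulf_neq0 ?expf_neq0 | rewrite trunc_gt].
case/eqP: (gu); apply: gram0; apply: sub; apply: sub_closure; first exact: partial_projective.
split; last by exists (tuple_params u).
apply: contraNneq gu => ->; rewrite /gram (_ : \matrix_(b, c) _ = 0) ?det0 //.
by apply/matrixP => b c; rewrite !mxE /pairing mul0mx mxE.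
Qed.

Let period := D.+1.

(** Euclidean division of [t] by [D.+1] gives the stage: the quotient is the moving point, the
    remainder the number of its free affine coordinates. *)
Lemma secant_chain : (0 < h)%N -> irreducible_chain (secant_variety X h) (h * period - 1).
Proof.
move=> h0; pose Z t := zariski_closure (partial (t %/ period) (t %% period)).
exists Z; split=> [t tk|t tk].
  split; first exact: irreducible_partial.
  rewrite /Z; apply: closed_in_sub (@zariski_closure_closed _ _ _).
  rewrite /secant_variety secant_set_param; apply: closure_mono => v [v0 [p vp]]; split=> //.
  by exists (trunc (t %/ period) (t %% period) p).
rewrite /Z; set j := (t %/ period)%N; set a := (t %% period)%N.
have aD : (a <= D)%N by rewrite -ltnS ltn_pmod.
have tE : t = (j * period + a)%N by exact: divn_eq.
have jh : (j < h)%N by rewrite ltn_divLR //; lia.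
have ones0 i : ones i != 0 by apply/rV0Pn; exists 0; rewrite mxE oner_neq0.
have gamma_gt0 k : (0 < gamma k)%N.
  by rewrite /gamma /eps; case: eqP => [->|_]; rewrite ?muln0 ?subn0 // muln1 subn_gt0.
case: (ltngtP a D) aD => // aD _.
  have -> : (t.+1 %/ period = j)%N by rewrite tE -addnS divnMDl // divn_small ?addn0.
  have -> : (t.+1 %% period = a.+1)%N by rewrite tE -addnS modnMDl modn_small.
  (* The coordinate x_c of rank [a] becomes free. The weight contains x_c - x_0, which vanishes at
     stage [a] but not at [v0], where x_c = 2 and all other coordinates are 1. *)
  pose k := enum_val (Ordinal aD : 'I_D); pose i := tag k; pose c : 'I_(n i) := tagged k.
  have TagK (x : affine_coords) : Tagged (fun i => 'I_(n i)) (tagged x) = x by case: x.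
  have rkc : rk c = a by rewrite /rk TagK enum_valK.
  pose v0 : params := fun i' => \row_l (if unlift ord0 l is Some c' then if rk c' == a then 2 else 1 else 1).
  have v0l i' c' : v0 i' 0 (lift ord0 c') = if rk c' == a then 2 else 1 by rewrite mxE liftK.
  have v00 i' : v0 i' 0 0 = 1 by rewrite mxE unlift_none.
  have v0_neq0 i' : v0 i' != 0 by apply/rV0Pn; exists 0; rewrite v00 oner_neq0.
  have [U FU Uv0] := mform_nonzero (fun k => gamma k - eps i k)%N v0_neq0.
  pose l : params -> C := fun p => p i 0 (lift ord0 c) + -1 * p i 0 0.
  have Fl : mform (eps i) l by apply: mformD; [exact: mform_coord | apply: mformZ; exact: mform_coord].
  apply: (@partial_strict j a j a.+1 jh (fun p => l p * U p) v0).
  - by move=> p; rewrite trunc_succ.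
  - apply: mform_ext (mformM Fl FU) => // k'; rewrite subnKC //.
    by apply: leq_trans (gamma_gt0 k'); exact: leq_b1.
  - by rewrite mulf_neq0 // /l v0l rkc eqxx v00 mulN1r -[2]/(1 + 1) addrK oner_neq0.
  - apply: params_ext => [i'|i' c']; first by rewrite mask0.
    by rewrite mask_lift v00 v0l; case: ltnP => // ac; rewrite gtn_eqF.
  by move=> p; rewrite trunc_eq //= /l mask_lift mask0 rkc ltnn mulN1r subrr mul0r.
(* A new point appears. Before, it was [zero_params], where forms of positive degree vanish. *)
have -> : (t.+1 %/ period = j.+1)%N by rewrite tE aD -addnS divnMDl // divnn addn1.
have -> : (t.+1 %% period = 0)%N by rewrite tE aD -addnS modnMDl modnn.
have jh' : (j.+1 < h)%N by move: tk; rewrite tE aD /period; nia.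
have [U FU U1] := mform_nonzero gamma ones0.
rewrite aD; apply: (@partial_strict j D j.+1 0 jh' U ones) => //.
- exact: trunc_next.
- exact: mask_ones.
move=> p; rewrite trunc_gt //.
have := mform_homog FU (p := zero_params) (q := zero_params) (c := fun=> 0).
move=> -> => [|k]; last by rewrite scaler0.
by rewrite (bigD1 i0) //= expr0n gtn_eqF // !mul0r.
Qed.

End Chain.


Definition chart (y : 'rV[C]_D.+1) : params := fun i =>
  \row_c (if unlift ord0 c is Some c' then y 0 (lift ord0 (enum_rank (Tagged (fun i => 'I_(n i)) c' : affine_coords))) else 1).

Lemma polyfun_chart delta f : mform delta f -> polyfun (fun y => f (chart y)).
Proof.
move=> Ff; apply: (@polyfun_ext _ _ (fun y => f (params_of (of_params (chart y))))) => [y|].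
  by rewrite of_paramsK.
apply: (polyfun_comp (polyfun_form Ff)) => k.
apply: (@polyfun_ext _ _ (fun y => chart y (tag (enum_val k)) 0 (tagged (enum_val k)))) => [y|].
  by rewrite [RHS]mxE.
case: (enum_val k) => i c /=; case: (unliftP ord0 c) => [c'|] ->.
  apply: polyfun_ext (polyfun_coord R (lift ord0 (enum_rank (Tagged (fun i => 'I_(n i)) c' : affine_coords)))) => y.
  by rewrite mxE liftK.
by apply: polyfun_ext (polyfun_cst _ 1) => y; rewrite mxE unlift_none.
Qed.

(** The cone over the dense chart is parametrized by [D.+1] numbers: the affine coordinates and the
    scalar [y 0 ord0]. *)
Lemma dim_X_le : (Defs.dim X <= D)%N.
Proof.
apply: dim_le => k ck; rewrite -ltnS.
apply: (chain_bound (rho := fun y => y 0 ord0 *: phi (chart y)) _ _ ck) => [a|f Pf f0 v /memX[p _ ->]].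
  apply: (@polyfun_ext _ _ (fun y => y 0 ord0 * phi (chart y) 0 a)) => [y|]; first by rewrite [RHS]mxE.
  by apply: polyfunM; [exact: polyfun_coord | exact: (polyfun_chart (@mform_entry R r n d a))].
apply: X_dense => // q q0.
pose y : 'rV[C]_D.+1 := \row_a (if unlift ord0 a is Some b then
  let x : affine_coords := enum_val b in q (tag x) 0 (lift ord0 (tagged x)) / q (tag x) 0 0
  else \prod_i q i 0 0 ^+ d i).
suff -> : phi q = y 0 ord0 *: phi (chart y) by exact: f0.
rewrite mxE unlift_none; apply: map_homog => i; apply/rowP => c; rewrite !mxE.
case: (unliftP ord0 c) => [c'|] ->; last by rewrite mulr1.
rewrite mxE liftK enum_rankK /= mulrC divfK //.
by move/prodf_neq0: q0 => /(_ i isT).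
Qed.

(** The expected dimension grows with the dimension of [X], so the length of [secant_chain] is
    compared with it through the upper bound [dim_X_le]. *)
Theorem not_defective h : (0 < h)%N ->
  (forall j, (j < h)%N -> exists A : 'I_j.+1 -> params -> C,
    (forall a, mform (fun k => e * eps i1 k)%N (A a)) /\
    exists q : 'I_j.+1 -> params, q ord_max = ones /\ \det (\matrix_(k, a) A a (q k)) != 0) ->
  ~ defective X h.
Proof.
move=> h0 sep; apply/negP; rewrite -leqNgt geq_min; apply/orP; left.
have := dim_ge (secant_chain sep h0); apply: leq_trans.
by rewrite mulnS addnC leq_sub2r // leq_add2l leq_mul2l dim_X_le orbT.
Qed.

End SegreVeronese.

(** * Separating points by monomials *)

Section ManyMonomials.
Variable m' : nat.
Local Notation m := m'.+2.

Lemma odd_delta_double (c i : 'I_m) (mu : 'X_{1..m}) : odd ((U_(c) + (mu + mu))%MM i) = (c == i).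
Proof. by rewrite !mnmDE mnm1E addnn oddD odd_double addbF oddb. Qed.

(* The monomials [x_c mu^2] are pairwise distinct: the exponent of [x_c] is the only odd one. *)
Lemma many_monomials N b : (0 < b)%N -> exists s : seq 'X_{1..m},
  [/\ uniq s, all (fun mu => mdeg mu == b.-1) s &
      size s = \sum_(0 <= l < N | odd (b %/ 2 ^ l)) m ^ l]%N.
Proof.
elim: N b => [|N IH] b b0; first by exists [::]; rewrite big_nil.
have recE : (\sum_(0 <= l < N.+1 | odd (b %/ 2 ^ l)) m ^ l =
    odd b + m * \sum_(0 <= l < N | odd (b./2 %/ 2 ^ l)) m ^ l)%N.
  rewrite big_mkcond big_nat_recl // expn0 divn1 big_distrr /=; congr (_ + _)%N.
  rewrite [RHS]big_mkcond; apply: eq_bigr => l _.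
  by rewrite -divn2 -divnMA -expnS; case: (odd _); rewrite // expnS.
case: (posnP b./2) => [bh0|bh_gt0].
  have b1 : b = 1%N by lia.
  exists [:: 0%MM]; split; [by []|by rewrite /= mdeg0 b1|].
  by rewrite recE bh0 b1 big1 ?muln0 // => l; rewrite div0n.
have [s [us ds ss]] := IH _ bh_gt0.
pose s1 := [seq (U_(c) + (mu + mu))%MM | c <- enum 'I_m, mu <- s].
have us1 : uniq s1.
  apply: allpairs_uniq => //; first exact: enum_uniq.
  move=> [c mu] [c' mu'] _ _ /= E.
  have cc' : c = c' by apply/eqP; rewrite eq_sym -(odd_delta_double c' c mu') -E odd_delta_double eqxx.
  rewrite cc' in E *; congr (_, _); apply/mnmP => i.
  by have /mnmP/(_ i) := E; rewrite !mnmDE; lia.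
have ds1 mu : mu \in s1 -> mdeg mu = (b./2.*2).-1.
  move=> /allpairsP[[c nu] /= [_ /(allP ds)/eqP dnu ->]]; rewrite !mdegD mdeg1 dnu; lia.
have ss1 : size s1 = (m * \sum_(0 <= l < N | odd (b./2 %/ 2 ^ l)) m ^ l)%N.
  by rewrite size_allpairs size_enum_ord ss.
case: (boolP (odd b)) => bo; last first.
  exists s1; split=> //; last by rewrite recE (negPf bo).
  by apply/allP => mu /ds1 ->; apply/eqP; congr _.-1; have := odd_double_half b; rewrite (negPf bo).
(* For odd [b] the monomials of [s1] have degree [b - 2]. They are multiplied by x_0, and a power of
   x_1, not divisible by x_0, accounts for the digit of weight 1. *)
pose c0 : 'I_m := ord0; pose c1 : 'I_m := Ordinal (isT : (1 < m)%N).
exists ((U_(c1) *+ b.-1)%MM :: [seq (U_(c0) + mu)%MM | mu <- s1]); split.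
- rewrite /= map_inj_uniq ?us1 ?andbT; last by move=> mu nu /addmI.
  apply/mapP => -[mu _ /mnmP/(_ c0)]; rewrite mnmDE mulmnE !mnm1E eqxx (_ : (c1 == c0) = false) //; lia.
- rewrite /= mdegMn mdeg1 mul1n eqxx /=; apply/allP => mu /mapP[nu /ds1 dnu ->].
  by apply/eqP; rewrite mdegD mdeg1 dnu; have := odd_double_half b; rewrite bo; lia.
by rewrite /= size_map ss1 recE bo.
Qed.

Lemma h_E_sum k : h_ m k = (\sum_(0 <= l < k.+1 | odd (k.+1 %/ 2 %/ 2 ^ l)) m ^ l)%N.
Proof.
rewrite /h_ big_mkcond [RHS]big_mkcond big_add1 /=; apply: eq_bigr => l _.
by rewrite -divnMA -expnS.
Qed.

End ManyMonomials.

Section Separators.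
Variables (R : realType) (r : nat) (n : 'I_r -> nat) (i1 : 'I_r) (e : nat).
Local Notation C := R[i].

(** The points are the Vandermonde points of [monomials_independent], repeated in every factor and
    in reverse order, so that the exponent 0 makes the last one [ones]. *)
Lemma separators_exist (s : seq 'X_{1..(n i1).+1}) k : uniq s -> all (fun mu => mdeg mu == e) s -> (k.+1 <= size s)%N ->
  exists A : 'I_k.+1 -> params R n -> C,
  (forall a, mform (fun l => e * eps i1 l)%N (A a)) /\
  exists q : 'I_k.+1 -> params R n, q ord_max = ones R n /\ \det (\matrix_(j, a) A a (q j)) != 0.
Proof.
move=> us ds ks; pose mu a := nth 0%MM s (a : 'I_k.+1).
have mu_deg a : mdeg (mu a) = e by apply/eqP/(allP ds)/mem_nth/(leq_trans (ltn_ord a)).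
pose alpha a i (c : 'I_(n i).+1) := if i == i1 then mu a (inord c) else 0%N.
exists (fun a p => \prod_i \prod_c p i 0 c ^+ alpha a i c); split=> [a|].
  apply: mform_mon => i; rewrite /alpha /eps; case: eqP => [->|_]; last by rewrite big1 // muln0.
  by rewrite muln1 -(mu_deg a) mdegE; apply: eq_bigr => c _; rewrite inord_val.
exists (fun j i => \row_c (nprime c)%:R ^+ (k - j)); split.
  by apply: functional_extensionality_dep => i; apply/rowP => c; rewrite !mxE subnn expr0.
have inj (a b : 'I_k.+1) : mu a =1 mu b -> a = b.
  move=> /mnmP/eqP; rewrite nth_uniq ?(leq_trans (ltn_ord _)) // => /eqP; exact: val_inj.
have := @monomials_independent R _ _ mu inj; set M := (X in X \in unitmx) => uM.
rewrite -unitfE -unitmxE (_ : \matrix_(j, a) _ = row_perm (perm rev_ord_inj) M).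
  by rewrite row_permE unitmx_mul unitmx_perm.
apply/matrixP => j a; rewrite !mxE permE (bigD1 i1) //= [X in _ * X]big1 ?mulr1 => [|i /negPf ii1].
  by apply: eq_bigr => c _; rewrite mxE /alpha eqxx inord_val subSS.
by rewrite big1 // => c _; rewrite /alpha ii1 expr0.
Qed.

End Separators.

Lemma bigmin_le r (d : 'I_r -> nat) (P : pred 'I_r) x : (\big[minn/x]_(i < r | P i) d i <= x)%N.
Proof. by elim/big_rec: _ => // i y _; rewrite geq_min => ->; rewrite orbT. Qed.

Theorem theorem1p2 (R : realType) (r : nat) (hr : (2 <= r)%N)
    (n d : 'I_r -> nat)
    (n_gt0 : forall i, (0 < n i)%N) (d_gt0 : forall i, (0 < d i)%N)
    (n1 : n (Ordinal (ltnW hr)) = 1%N) (d1 : d (Ordinal (ltnW hr)) = 1%N)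
    (n_mono : forall i j : 'I_r, (0 < i)%N -> (i <= j)%N -> (n i <= n j)%N)
    (h : nat) (h_gt0 : (0 < h)%N)
    (h_lt : (h < h_ (n (Ordinal hr) + 1)
                    (\big[minn/d (Ordinal hr)]_(i < r | (0 < i)%N) d i - 1))%N) :
  [/\ ~ tangentially_weakly_defective (segre_veronese R n d) h,
      identifiable (segre_veronese R n d) h &
      ~ defective (segre_veronese R n d) h].
Proof.
set i0 := Ordinal (ltnW hr) in n1 d1; set i1 := Ordinal hr in h_lt.
have i10 : i1 != i0 by [].
have lemin := @bigmin_le r d (fun i => 0 < i)%N (d i1).
(* [k.+1] is d_min, [b] is its half rounded down, and the separating degree is [b.-1]. *)
set k := (_ - 1)%N in h_lt; set b := (k.+1 %/ 2)%N.
have [nn nE] : exists nn, n i1 = nn.+1 by exists (n i1).-1; rewrite prednK.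
(* For [b = 0] there are no binary digits and the bound on [h] would be 0. *)
have b_gt0 : (0 < b)%N.
  rewrite lt0n; apply/eqP => b0; move: h_lt; rewrite nE addn1 h_E_sum -/b b0 big1 // => l.
  by rewrite div0n.
have d_big : (2 * b.-1 < d i1)%N by have := d_gt0 i1; rewrite /b /k; lia.
have [s [us ds ss]] : exists s : seq 'X_{1..(n i1).+1},
    [/\ uniq s, all (fun mu => mdeg mu == b.-1) s & (h < size s)%N].
  move: h_lt; rewrite nE addn1 h_E_sum -/b => h_lt.
  have [s [us ds ss]] := @many_monomials nn k.+1 b b_gt0.
  by exists s; split=> //; rewrite ss.
have sep j : (j < h)%N -> exists A : 'I_j.+1 -> params R n -> R[i],
    (forall a, mform (fun l => b.-1 * eps i1 l)%N (A a)) /\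
    exists q : 'I_j.+1 -> params R n, q ord_max = ones R n /\ \det (\matrix_(l, a) A a (q l)) != 0.
  by move=> jh; apply: separators_exist us ds _; exact: ltn_trans ss.
have [A [FA [q [_ dA]]]] : exists A : 'I_h -> params R n -> R[i],
    (forall a, mform (fun l => b.-1 * eps i1 l)%N (A a)) /\
    exists q : 'I_h -> params R n, True /\ \det (\matrix_(l, a) A a (q l)) != 0.
  by case: (h) h_gt0 sep => // h' _ /(_ h' (ltnSn h'))[A [FA [q [_ dq]]]]; exists A; split=> //; exists q.
split.
- exact: (not_tangentially_weakly_defective n_gt0 d_gt0 i10 d1 d_big FA dA).
- exact: (general_identifiable d_gt0 i10 d1 d_big h_gt0 FA dA).
exact: (not_defective d_gt0 i10 d1 d_big h_gt0 sep).
Qed.
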